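(* Let $\mu$ be a positive integer and $G$ be a free abelian group of rank $\mu$. Let $(\tau,\psi)$ be a $\mu$-colored welded $n$-tangle and $(T,\varphi)$ be a $G$-colored ribbon tangle such that $T$ is the image of $\tau$ by the Tube map. Suppose that there are generators $t_1,\dots,t_\mu$ of $G$ such that the diagram $$\begin{array}{ccc}\pi_1(B^4\setminus T)&\xrightarrow{\ \varphi\ }&G\\ \downarrow{\simeq}&&\downarrow{\simeq}\\ \pi(\tau)&\xrightarrow{\ \psi\ }&\langle t_1,\dots,t_\mu\rangle\end{array}$$ commutes. Then, up to multiplication by a unit of $R=\mathbb{Z}[G]\simeq\mathbb{Z}[t_1^{\pm1},\dots,t_\mu^{\pm1}]$, $$\mathsf{A}(T,\varphi)=\alpha(\tau,\psi)\in\wedge^nH_\partial,$$ where the marked points $x_1,\dots,x_{2n}$ of $\tau$ are identified with the corresponding meridians of the components of the boundary link $L$ of $T$.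
   Context: **Ribbon tangles.** An intersection $D=Y_1\cap Y_2$ of (pieces of) locally flat immersed $3$-manifolds in $B^4$ is a *ribbon disk* if it is homeomorphic to the $2$-disk, $D\subset \mathring{Y}_1$, $\mathring{D}\subset\mathring{Y}_2$ and $\partial D$ is an essential curve in $\partial Y_2$. Let $L$ be an oriented trivial link with $2n$ components in $S^3=\partial B^4$. A *ribbon tangle* $T$ is a locally flat proper embedding in $B^4$ of disjoint oriented annuli $A_1,\dots,A_n$ and disjoint oriented tori $E_1,\dots,E_m$ such that: (i) there are locally flat immersed solid tori $F_i$ with $\partial F_i=E_i$; (ii) $\partial A_i\subset L$ and the orientation induced by $A_i$ on $\partial A_i$ is the one given on $L$; (iii) there are locally flat immersed $3$-balls $B_i\simeq B^2\times I$ with $\partial B_i=A_i\cup_\partial(B^2\times\{0,1\})$; the singularities of these immersed $3$-manifolds are finitely many ribbon disks. A *$G$-colored* ribbon tangle is a pair $(T,\varphi)$ with $\varphi\colon H_1(X_T)\to G$ a homomorphism, $X_T=B^4\setminus T$ ($\varphi$ is also viewed as a map on $\pi_1(X_T)$). **The invariant $\mathsf{A}$.** For a pair $(X,Y)$ with maximal abelian cover $p\colon\hat X\to X$ and a ring homomorphism $\varphi\colon\mathbb{Z}[H_1(X)]\to R$, $H^\varphi_*(X,Y)$ is the homology of $C(\hat X,p^{-1}(Y))\otimes_{\mathbb{Z}[H_1(X)]}R$. For $\ast\in S^3\setminus L$, $H_1^\varphi(X_T,\ast)$ has a presentation $\langle\gamma_1,\dots,\gamma_{n+q}\mid r_1,\dots,r_q\rangle$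 of deficiency $n$. Let $\Gamma$ be the free $R$-module on the $\gamma_i$, $\gamma=\gamma_1\wedge\cdots\wedge\gamma_{n+q}$, $r=r_1\wedge\cdots\wedge r_q$. The Alexander function $\mathcal{A}_T^\varphi\colon\wedge^nH_1^\varphi(X_T,\ast)\to R$ is defined by $r\wedge\tilde u_1\wedge\cdots\wedge\tilde u_n=\mathcal{A}_T^\varphi(u_1\wedge\cdots\wedge u_n)\cdot\gamma$ for arbitrary lifts $\tilde u_i\in\Gamma$; it is well defined up to a unit. The module $H_\partial=H_1^\varphi(S^3\setminus L,\ast)$ is free of rank $2n$ on meridians; let $m_\partial\colon H_\partial\to H_1^\varphi(X_T,\ast)$ be induced by inclusion and $\omega_\partial$ be a volume form on $H_\partial$. Then $\mathsf{A}(T,\varphi)\in\wedge^nH_\partial$ is defined (up to a unit) by $\mathcal{A}_T^\varphi(\wedge^nm_\partial(z))=\omega_\partial(\mathsf{A}(T,\varphi)\wedge z)$ for all $z\in\wedge^nH_\partial$. **Welded tangles.** Let $D$ be the unit disk in $\mathbb{C}$ with fixed ordered points $x_1,\dots,x_{2n}\in\partial D$. A *welded $n$-tangle* $\tau$ is a proper immersion in $D$ of an oriented $1$-manifold consisting of circles and $n$ intervals (strands) with boundary $\{x_1,\dots,x_{2n}\}$, whose singularities are finitely many transversal double points, each either *classical* (with over/under information, and positive or negative according to whether the basis formed by the tangent vectors of the over and under strand is positive or negative) or *virtual* (no such information); tangles are considered up to generalized (welded) Reidemeister moves. A *$\mu$-coloring* $\psi$ is a map from the set of strands and circles to $\{t_1,\dots,t_\mu\}$.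 **The group $\pi(\tau)$.** It is given by the Wirtinger method: generators are the arcs of $\tau$ (pieces of $\tau$ between consecutive under-crossings or boundary points; virtual crossings are ignored), with, at each classical crossing with over arc $o$, incoming under arc $a$ and outgoing under arc $b$, the relation $b=oao^{-1}$ if the crossing is positive and $a=obo^{-1}$ if it is negative. A $\mu$-coloring is viewed as the homomorphism $\psi$ from $\pi(\tau)$ to the free abelian group on $t_1,\dots,t_\mu$ sending each arc to its color. **The Tube map** (Satoh, Yajima). It replaces each strand of $\tau$ by a thin oriented tube, a classical crossing by a crossing of tubes where the tube of the under strand passes through the filling of the tube of the over strand (the sign of the crossing prescribing the direction of passage), and a virtual crossing by tubes passing without interaction; this gives a broken surface in $B^3$, the projection of a ribbon tangle $T$ in $B^4$. There is an isomorphism $\pi(\tau)\simeq\pi_1(B^4\setminus T)$ sending arcs of $\tau$ to meridians of $T$, and this is the left vertical isomorphism. The points $x_i$ correspond to the components of $L$, and the generator $x_i$ of $H_\partial$ is the meridian corresponding to the arc of $\tau$ ending at the marked point $x_i$. **The invariant $\alpha$.** If necessary, subdivide arcs of $\tau$ by additional points, so that each strand has at least two arcs and each circle at least one crossing or point at which an arc begins. Let $M^\psi(\tau)$ be the matrix over $\mathbb{Z}[t_1^{\pm1},\dots,t_\mu^{\pm1}]$ with columns indexed by the arcs and rows by the classical crossings and subdivision points, with the following entries (contributions are added if arcs coincide; other entries are $0$). For a crossing whose over strand has color $t_j$ and under strand has color $t_i$, with over arc $o$, incoming under arc $a$, outgoing under arc $b$: if positive, $-1$ at $b$, $t_j$ at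 $a$, $1-t_i$ at $o$; if negative, $-1$ at $a$, $t_j$ at $b$, $1-t_i$ at $o$. For a subdivision point: $-1$ at the arc beginning there and $1$ at the arc ending there. If $p$ is the number of internal arcs (arcs not meeting $\partial D$), $M^\psi(\tau)$ has size $(p+n)\times(p+2n)$, the columns of the internal arcs being put first. Let $H_\partial$ be freely generated by $x_1,\dots,x_{2n}$. Then $$\alpha(\tau,\psi)=\sum_I|M^\psi(\tau)_I|\cdot x_I\in\wedge^nH_\partial,$$ the sum being over the $n$-element subsets $I\subset\{1,\dots,2n\}$, where $|M^\psi(\tau)_I|$ is the minor of order $n+p$ on the columns of the internal arcs and of the boundary arcs indexed by $I$, and $x_I$ is the wedge product of the $x_i$, $i\in I$ (in increasing order). It is well defined up to a unit. *)

(* Defs.v *)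
(* The real numbers are an arbitrary R : realType. Singular chains and group rings *)
(* are free modules {freeg K / A} of the multinomials library.                     *)
From HB Require Import structures.
From mathcomp Require Import all_boot all_order all_algebra.
From mathcomp Require Import all_classical all_reals all_analysis.
From mathcomp Require Import freeg.

Set Implicit Arguments.
Unset Strict Implicit.
Unset Printing Implicit Defensive.

Import Order.TTheory GRing.Theory Num.Theory numFieldNormedType.Exports.

Local Open Scope ring_scope.

Definition group_ring (G : zmodType) : Type := {freeg G / int}.
HB.instance Definition _ (G : zmodType) := 
  GRing.Zmodule.copy (group_ring G) {freeg G / int}.

Section GroupRing.
Variable G : zmodType.
Implicit Types (a b c : {freeg G / int}) (g h : G).
Local Notation FG := {freeg G / int}.

Lemma freegU_scale (k : int) g : << k *g g >> = k *: << g >> :> FG.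
Proof. by apply/eqP/freeg_eqP=> x; rewrite coeffZ !coeffU mul1r. Qed.

Section Lift.
Variables (M : lmodType int) (f : G -> M).
HB.instance Definition _ := GRing.isZmodMorphism.Build FG M (fglift f) (lift_is_additive f).
Lemma fglift_add : {morph fglift f : a b / a + b}.
Proof. exact: raddfD. Qed.
Lemma fglift_scale (k : int) a : fglift f (k *: a) = k *: fglift f a.
Proof. by rewrite -[k]intz !scaler_int raddfMz. Qed.
End Lift.
Lemma fglift_unit (M : lmodType int) (f : G -> M) g : fglift f << g >> = f g.
Proof. by rewrite liftU scale1r. Qed.

Lemma freeg_ext (M : lmodType int) (F H : FG -> M) :
  (forall a b, F (a + b) = F a + F b) -> (forall (k : int) a, F (k *: a) = k *: F a) ->
  (forall a b, H (a + b) = H a + H b) -> (forall (k : int) a, H (k *: a) = k *: H a) ->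
  (forall g, F << g >> = H << g >>) -> F =1 H.
Proof.
move=> FD FZ HD HZ FH a; rewrite -[a]freeg_sumE.
elim: (dom a) => [|z s IH].
  by rewrite big_nil -(scale0r 0) FZ HZ !scale0r.
by rewrite big_cons FD HD IH freegU_scale FZ HZ FH.
Qed.

Definition group_ring_mul a b : FG :=
  fglift (fun g => fglift (fun h => << g + h >>) b) a.
Local Notation mul := group_ring_mul.

Lemma group_ring_mulDl a b c : mul (a + b) c = mul a c + mul b c.
Proof. exact: fglift_add. Qed.
Lemma group_ring_mulZl (k : int) a b : mul (k *: a) b = k *: mul a b.
Proof. exact: fglift_scale. Qed.
Lemma group_ring_mulU g b : mul << g >> b = fglift (fun h => << g + h >>) b.
Proof. exact: fglift_unit. Qed.
Lemma group_ring_mulDr a b c : mul a (b + c) = mul a b + mul a c.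
Proof.
apply: (freeg_ext (F := mul^~ (b + c)) (H := fun a => mul a b + mul a c)).
- by move=> *; rewrite /= group_ring_mulDl.
- by move=> *; rewrite /= group_ring_mulZl.
- by move=> *; rewrite /= !group_ring_mulDl addrACA.
- by move=> *; rewrite /= !group_ring_mulZl scalerDr.
by move=> g; rewrite /= !group_ring_mulU fglift_add.
Qed.
Lemma group_ring_mulZr (k : int) a b : mul a (k *: b) = k *: mul a b.
Proof.
apply: (freeg_ext (F := mul^~ (k *: b)) (H := fun a => k *: mul a b)).
- by move=> *; rewrite /= group_ring_mulDl.
- by move=> *; rewrite /= group_ring_mulZl.
- by move=> *; rewrite /= !group_ring_mulDl scalerDr.
- by move=> *; rewrite /= !group_ring_mulZl !scalerA mulrC.
by move=> g; rewrite /= !group_ring_mulU fglift_scale.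
Qed.
Lemma group_ring_mulUU g h : mul << g >> << h >> = << g + h >>.
Proof. by rewrite group_ring_mulU fglift_unit. Qed.

Definition bilE := (group_ring_mulDl, group_ring_mulZl, group_ring_mulDr, group_ring_mulZr).

Lemma group_ring_mulC : commutative mul.
Proof.
move=> a b; apply: (freeg_ext (F := mul^~ b) (H := mul b)) => [??|??|??|??|g];
  rewrite /= ?bilE //.
apply: (freeg_ext (F := mul << g >>) (H := mul^~ << g >>)) => [??|??|??|??|h];
  rewrite /= ?bilE //.
by rewrite !group_ring_mulUU addrC.
Qed.
Lemma group_ring_mulA : associative mul.
Proof.
move=> a b c; apply: (freeg_ext (F := fun a => mul a (mul b c))
   (H := fun a => mul (mul a b) c)) => [??|??|??|??|g]; rewrite /= ?bilE //.
apply: (freeg_ext (F := fun b => mul << g >> (mul b c))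
   (H := fun b => mul (mul << g >> b) c)) => [??|??|??|??|h]; rewrite /= ?bilE //.
apply: (freeg_ext (F := fun c => mul << g >> (mul << h >> c))
   (H := mul (mul << g >> << h >>))) => [??|??|??|??|x]; rewrite /= ?bilE //.
by rewrite !group_ring_mulUU addrA.
Qed.
Lemma group_ring_mul1 : left_id << 0 >> mul.
Proof.
apply: (freeg_ext (F := mul << 0 >>) (H := id)) => [??|??|??|??|g]; rewrite /= ?bilE //.
by rewrite group_ring_mulUU add0r.
Qed.
Lemma group_ring_1neq0 : << 0 >> != 0 :> FG.
Proof. by rewrite freegU_eq0. Qed.
End GroupRing.

HB.instance Definition _ (G : zmodType) :=
  GRing.Zmodule_isComNzRing.Build (group_ring G) (@group_ring_mulA G) (@group_ring_mulC G)
    (@group_ring_mul1 G) (@group_ring_mulDl G) (@group_ring_1neq0 G).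

Definition group_elt (G : zmodType) (g : G) : group_ring G := << g >>.

Definition is_unit_elt (A : comNzRingType) (u : A) : Prop := exists v, u * v = 1.

Definition generates (mu : nat) (G : zmodType) (t : 'I_mu -> G) : Prop :=
  forall g, exists k : {ffun 'I_mu -> int}, g = \sum_i t i *~ k i.

Definition free_abelian_of_rank (mu : nat) (G : zmodType) : Prop :=
  exists b : 'I_mu -> G,
    forall g, exists! k : {ffun 'I_mu -> int}, g = \sum_i b i *~ k i.

(* The exterior algebra of the free module A^N with standard basis x_i: an      *)
(* element is its family of coordinates on the products x_I, I a subset of      *)
(* {0, ..., N-1}, where x_I is the wedge product of the x_i in increasing order. *)
Section Exterior.
Variables (A : comNzRingType) (N : nat).

Definition ext : Type := {ffun {set 'I_N} -> A}.

(* x_I /\ x_J = (-1)^(number of inversions) x_(I :|: J) for disjoint I and J *)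
Definition inversions (I J : {set 'I_N}) : nat :=
  #|[set ij : 'I_N * 'I_N | (ij.1 \in I) && (ij.2 \in J) && (ij.2 < ij.1)%N]|.

Definition wedge (a b : ext) : ext :=
  [ffun K : {set 'I_N} => \sum_(I : {set 'I_N} | I \subset K)
     (-1) ^+ inversions I (K :\: I) * a I * b (K :\: I)].

Definition ext1 : ext := [ffun K : {set 'I_N} => (K == finset.set0)%:R].

Definition ext_vec (v : 'rV[A]_N) : ext :=
  [ffun K : {set 'I_N} => \sum_i v 0 i * (K == [set i])%:R].

Definition wedge_rows (k : nat) (M : 'M[A]_(k, N)) : ext :=
  \big[wedge/ext1]_(i < k) ext_vec (row i M).

Definition ext_top (a : ext) : A := a [set: 'I_N].

Definition ext_scale (u : A) (a : ext) : ext := [ffun K => u * a K].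

Definition ext_homogeneous (k : nat) (a : ext) : Prop :=
  forall K : {set 'I_N}, #|K| != k -> a K = 0.

End Exterior.

Local Open Scope classical_set_scope.

Section Linear.
Variables (A : comNzRingType) (V : lmodType A).

Definition lin_span (S : set V) : set V :=
  [set v | exists s : seq (A * V),
     (forall p, p \in s -> S p.2) /\ v = \sum_(p <- s) p.1 *: p.2].

(* the subquotient Z / B is presented by the generators c and the rows of r *)
Definition presents (Z B : set V) (k q : nat) (c : 'I_k -> V) (r : 'M[A]_(q, k))
    : Prop :=
  [/\ forall i, Z (c i),
      forall z, Z z -> exists v : 'rV[A]_k, B (z - \sum_i v 0 i *: c i)
    & forall v : 'rV[A]_k,
        B (\sum_i v 0 i *: c i) <-> exists w : 'rV[A]_q, v = w *m r].

Definition free_on (Z B : set V) (k : nat) (c : 'I_k -> V) : Prop :=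
  (forall i, Z (c i)) /\
  (forall z, Z z -> exists! v : 'rV[A]_k, B (z - \sum_i v 0 i *: c i)).

End Linear.

Section Singular.
Variable R : realType.

Definition stdsimplex (k : nat) : set 'rV[R]_k.+1 :=
  [set v | (forall i, 0 <= v 0 i) /\ \sum_i v 0 i = 1].

Arguments stdsimplex : clear implicits.

Definition face_coord (k : nat) (i : 'I_k.+2) (v : 'rV[R]_k.+1) : 'rV[R]_k.+2 :=
  \row_j (if unlift i j is Some l then v 0 l else 0).

Lemma face_stdsimplex (k : nat) (i : 'I_k.+2) (v : stdsimplex k) :
  face_coord i (set_val v) \in stdsimplex k.+1.
Proof.
have [v0 v1] := set_valP v; apply/mem_set; split => [j|].
  by rewrite mxE; case: unlift.
rewrite (bigD1 i) //= mxE unlift_none add0r.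
rewrite (reindex_omap (fintype.lift i) (unlift i)) => [|j]; last first.
  by case: unliftP => [l ->|->] //=; rewrite eqxx.
rewrite -v1; apply: eq_big => [l|l _]; last by rewrite mxE liftK.
by rewrite liftK eqxx eq_sym neq_lift.
Qed.

Definition face_fun (k : nat) (i : 'I_k.+2) (v : stdsimplex k) : stdsimplex k.+1 :=
  exist (fun w => w \in stdsimplex k.+1) _ (face_stdsimplex i v).

Lemma face_continuous (k : nat) (i : 'I_k.+2) : continuous (face_fun i).
Proof.
apply: (continuous_comp_initial (w := set_val)) => v A [P vP PA].
suff : \forall w \near v, forall i' j, P i' j (set_val (face_fun i w) i' j).
  by apply: filterS => w Pw; exact: PA.
have FF : Filter (nbhs v) by exact: nbhs_filter.
apply: (@filter_forall _ _ (fun i' w => forall j, P i' j (set_val (face_fun i w) i' j)) _ FF) => i'.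
apply: (@filter_forall _ _ (fun j w => P i' j (set_val (face_fun i w) i' j)) _ FF) => j.
have := vP i' j; rewrite /= mxE; case Ej: (unlift i j) => [l|] Pij; last first.
  by apply: nearW => w; rewrite /= mxE Ej; exact: nbhs_singleton.
have cl : continuous (fun w : stdsimplex k => set_val w 0 l).
  by move=> w; apply: (@continuous_comp _ _ _ set_val (fun M : 'rV[R]_k.+1 => M 0 l));
    [exact: initial_continuous|exact: coord_continuous].
by apply: (@filterS _ _ FF _ _ _ (cl v _ Pij)) => w /=; rewrite mxE Ej.
Qed.

HB.instance Definition _ k i := @isContinuous.Build _ _ (@face_fun k i) (@face_continuous k i).

Definition edge_coord (s : stdsimplex 1) : R := set_val s 0 1.

Lemma edge_coord_continuous : continuous edge_coord.
Proof.
by move=> s; apply: (@continuous_comp _ _ _ set_val (fun M : 'rV[R]_2 => M 0 1));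
  [exact: initial_continuous|exact: coord_continuous].
Qed.

HB.instance Definition _ := @isContinuous.Build _ _ edge_coord (@edge_coord_continuous).

Definition simplex (k : nat) (X : topologicalType) : Type :=
  continuousType (stdsimplex k) X.

Definition chains (k : nat) (X : topologicalType) (A : comNzRingType) : Type :=
  {freeg (simplex k X) / A}.

Definition boundary (k : nat) (X : topologicalType) (A : comNzRingType)
    (c : chains k.+1 X A) : chains k X A :=
  fglift (fun s : simplex k.+1 X =>
    \sum_(i < k.+2) << (-1) ^+ i *g (s \o @face_fun k i : simplex k X) >>) c.

Definition push_chain (k : nat) (X Y : topologicalType) (A : comNzRingType)
    (f : continuousType X Y) (c : chains k X A) : chains k Y A :=
  fglift (fun s : simplex k X => << (f \o s : simplex k Y) >> : chains k Y A) c.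

(* A path in X is a continuous map R -> X of which only the restriction to      *)
(* [0, 1] matters (every path on [0, 1] extends to R by constants).             *)
Definition rpath (X : topologicalType) : Type := continuousType R X.

Section Paths.
Variable X : topologicalType.
Implicit Types f g h : rpath X.

Definition is_loop (x : X) f : Prop := f 0 = x /\ f 1 = x.

Definition path_concat f g h : Prop := forall s, 0 <= s <= 1 ->
  h s = if s <= 2^-1 then f (2 * s) else g (2 * s - 1).

(* homotopy relative to the endpoints *)
Definition path_homotopic f g : Prop :=
  exists H : continuousType (R * R)%type X, forall s, 0 <= s <= 1 ->
    [/\ H (0, s) = f s, H (1, s) = g s, H (s, 0) = f 0 & H (s, 1) = f 1].

Definition path_connected : Prop := forall x y : X, exists f, f 0 = x /\ f 1 = y.

Definition path_chain (A : comNzRingType) f : chains 1 X A :=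
  << (f \o edge_coord : simplex 1 X) >>.

Definition null_homologous f : Prop :=
  exists e : chains 2 X int, boundary e = path_chain int f.

(* phi induces a group homomorphism H_1(X; Z) -> G; it is viewed as a map on    *)
(* loops through f |-> phi (path_chain int f).                                  *)
Definition is_H1_hom (G : zmodType) (phi : chains 1 X int -> G) : Prop :=
  (forall c c', boundary c = 0 -> boundary c' = 0 -> phi (c + c') = phi c + phi c') /\
  (forall e : chains 2 X int, phi (boundary e) = 0).

End Paths.

Section Covers.
Variables (X' X : topologicalType) (p : continuousType X' X).

Definition is_covering : Prop :=
  (forall x, exists x', p x' = x) /\
  (forall x, exists U : set X, [/\ open U, U x &
     exists (I : Type) (V : I -> set X'),
       [/\ p @^-1` U = \bigcup_i V i,
           forall i j, V i `&` V j !=set0 -> i = j,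
           forall i, open (V i) /\ set_bij (V i) U p &
           forall i W, open W -> W `<=` V i -> open (p @` W)]]).

Definition is_deck (d : continuousType X' X') : Prop :=
  (exists d' : continuousType X' X', cancel d d' /\ cancel d' d) /\
  (forall x, p (d x) = p x).

(* The regular connected cover in which a loop of X lifts to a loop exactly     *)
(* when its class in H_1(X) vanishes.                                           *)
Definition is_max_abelian_cover : Prop :=
  [/\ is_covering, path_connected X',
      forall x y, p x = p y -> exists d, is_deck d /\ d x = y &
      forall f : rpath X', p (f 0) = p (f 1) ->
        (f 0 = f 1 <-> null_homologous (p \o f : rpath X))].

(* C(X', p^-1(Y)) (x)_{Z[H_1(X)]} Z[G] is the free Z[G]-module on the singular   *)
(* simplices of X' modulo twisted_zero: h in H_1(X) acts on X' by the deck       *)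
(* transformation d such that a path from x' to d x' projects to a loop of class *)
(* h, and h s (x) 1 = s (x) phi(h).                                              *)
Variables (G : zmodType) (phi : chains 1 X int -> G) (Y : set X).
Local Notation RG := (group_ring G).

Definition twisted_zero (k : nat) : set (chains k X' RG) :=
  lin_span (
    [set c | exists (d : continuousType X' X') (f : rpath X') (s : simplex k X'),
       [/\ is_deck d, f 1 = d (f 0) &
        c = << (d \o s : simplex k X') >>
            - group_elt (phi (path_chain int (p \o f : rpath X))) *: << s >>]]
    `|` [set c | exists s : simplex k X', (forall v, Y (p (s v))) /\ c = << s >>]).

(* H_(k+1)^phi(X, Y) is twisted_cycle k / twisted_bound k *)
Definition twisted_cycle (k : nat) : set (chains k.+1 X' RG) :=
  [set c | twisted_zero (boundary c)].

Definition twisted_bound (k : nat) : set (chains k.+1 X' RG) :=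
  [set c | exists e : chains k.+2 X' RG, twisted_zero (c - boundary e)].

End Covers.
End Singular.

Section Euclidean.
Variable R : realType.

Definition sqnorm (k : nat) (v : 'rV[R]_k) : R := \sum_i v 0 i ^+ 2.

Definition vec2 (a b : R) : 'rV[R]_2 := \row_i [:: a; b]`_i.
Definition vec4 (a b c d : R) : 'rV[R]_4 := \row_i [:: a; b; c; d]`_i.

Definition det2 (u v : 'rV[R]_2) : R := u 0 0 * v 0 1 - u 0 1 * v 0 0.
Definition conj2 (u : 'rV[R]_2) : 'rV[R]_2 := vec2 (u 0 0) (- u 0 1).

Definition disk : set 'rV[R]_2 := [set q | sqnorm q <= 1].
Definition circle : set 'rV[R]_2 := [set q | sqnorm q = 1].
Definition ball4 : set 'rV[R]_4 := [set y | sqnorm y <= 1].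
Definition sphere3 : set 'rV[R]_4 := [set y | sqnorm y = 1].

Definition corner (Z N : {set 'I_4}) : set 'rV[R]_4 :=
  [set x | (forall i, i \in Z -> x 0 i = 0) /\ (forall i, i \in N -> 0 <= x 0 i)].

(* Near y there are coordinates of R^4, centred at y, in which the ball is the   *)
(* set x_i >= 0 (i in NB) and S is the set x_i = 0 (i in Z), x_i >= 0 (i in N).  *)
Definition flat_chart (S : set 'rV[R]_4) (y : 'rV[R]_4) (NB Z N : {set 'I_4}) : Prop :=
  exists (U V : set 'rV[R]_4) (h g : 'rV[R]_4 -> 'rV[R]_4),
    [/\ open U /\ open V, U y /\ h y = 0,
        {within U, continuous h} /\ {within V, continuous g},
        (forall x, U x -> V (h x) /\ g (h x) = x) /\
        (forall x, V x -> U (g x) /\ h (g x) = x)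
      & forall x, U x -> (ball4 x <-> corner finset.set0 NB (h x)) /\
                         (S x <-> corner Z N (h x))].

End Euclidean.

(* Components: n strands (inl) and m closed components (inr). A strand is        *)
(* parametrized by [0, 1], a closed component by R modulo 1.                     *)
Definition component (n m : nat) : finType := ('I_n + 'I_m)%type.

Section Components.
Variables (R : realType) (n m : nat).
Implicit Types c : component n m.

Definition is_strand c : bool := if c is inl _ then true else false.

Definition tdom c : set R := if c is inl _ then [set t | 0 <= t <= 1] else setT.
Definition tinner c : set R := if c is inl _ then [set t | 0 < t < 1] else setT.
Definition same_time c (t t' : R) : Prop :=
  if c is inl _ then t = t' else exists k : int, t' = t + k%:~R.
(* a fundamental domain *)
Definition tfund c : set R :=
  if c is inl _ then [set t | 0 <= t <= 1] else [set t | 0 <= t < 1].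

Definition periodic (V : Type) (f : component n m -> R -> V) : Prop :=
  forall (j : 'I_m) t, f (inr j) (t + 1) = f (inr j) t.

Definition is_end c (t : R) : Prop := is_strand c /\ (t = 0 \/ t = 1).

End Components.

(* A tangle diagram; a double point is a pair of points (component, time). The   *)
(* j-th marked point is the initial (b = false) or final (b = true) point of the *)
(* strand i, where ends j = (i, b).                                              *)
Record diagram (R : realType) (n m : nat) := Diagram {
  mark : 'I_(n + n) -> 'rV[R]_2;
  ends : 'I_(n + n) -> 'I_n * bool;
  curve : component n m -> R -> 'rV[R]_2;
  nclassical : nat;
  over : 'I_nclassical -> component n m * R;
  under : 'I_nclassical -> component n m * R;
  nvirtual : nat;
  virt1 : 'I_nvirtual -> component n m * R;
  virt2 : 'I_nvirtual -> component n m * R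
}.

Section Diagrams.
Variables (R : realType) (n m : nat) (d : diagram R n m).
Local Notation cmp := (component n m).

Definition place (P : cmp * R) : 'rV[R]_2 := curve d P.1 P.2.
Definition velocity (P : cmp * R) : 'rV[R]_2 := derive1 (curve d P.1) P.2.

Definition double_point (k : 'I_(nclassical d) + 'I_(nvirtual d)) :
    (cmp * R) * (cmp * R) :=
  match k with
  | inl k => (over k, under k)
  | inr k => (virt1 k, virt2 k)
  end.

Definition positive (k : 'I_(nclassical d)) : bool :=
  0 < det2 (velocity (over k)) (velocity (under k)).

Record is_welded_tangle : Prop := {
  wt_mark : injective (mark d) /\ forall j, circle (mark d j);
  wt_ends : bijective (ends d) /\
    forall j, curve d (inl (ends d j).1) (nat_of_bool (ends d j).2)%:R = mark d j;
  wt_proper : forall c t, tinner c t -> sqnorm (curve d c t) < 1;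
  wt_periodic : periodic (curve d);
  wt_immersion : forall c,
    [/\ forall t, derivable (curve d c) t 1, continuous (derive1 (curve d c))
      & forall t, tdom c t -> velocity (c, t) != 0];
  wt_double : forall P Q, tfund P.1 P.2 -> tfund Q.1 Q.2 -> P <> Q ->
    place P = place Q ->
    exists k, double_point k = (P, Q) \/ double_point k = (Q, P);
  wt_crossing : forall k, let P := (double_point k).1 in let Q := (double_point k).2 in
    [/\ tfund P.1 P.2, tfund Q.1 Q.2, P <> Q, place P = place Q
      & det2 (velocity P) (velocity Q) != 0];
  (* all multiple points are double, and counted once *)
  wt_simple : forall k k', place (double_point k).1 = place (double_point k').1 -> k = k'
}.

(* Arcs, relative to additional subdivision points at the times sub c of the     *)
(* component c. With b_0 < ... < b_(k-1) the break points of c (under-crossings  *)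
(* and subdivision points), arc number i ends at b_i and arc number i+1 begins   *)
(* there, modulo k on a closed component; a closed component without break point *)
(* is a single arc.                                                              *)
Section Arcs.
Variable sub : cmp -> seq R.

Definition breaks (c : cmp) : seq R :=
  sort <=%R ([seq (under k).2 | k <- enum 'I_(nclassical d) & (under k).1 == c] ++ sub c).

Definition last_arc (c : cmp) : nat :=
  if is_strand c then size (breaks c) else (size (breaks c)).-1.

Definition tarc : finType := {c : cmp & 'I_(last_arc c).+1}.

Definition arc_of (c : cmp) (i : nat) : tarc :=
  Tagged (fun c => 'I_(last_arc c).+1) (inord (i %% (last_arc c).+1) : 'I_(last_arc c).+1).

(* the arcs ending and beginning at the break point P, which are both the arc    *)
(* through P if P is not a break point                                           *)
Definition arc_in (P : cmp * R) : tarc := arc_of P.1 (count (< P.2) (breaks P.1)).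
Definition arc_out (P : cmp * R) : tarc := arc_of P.1 (count (<= P.2) (breaks P.1)).

Definition mark_arc (j : 'I_(n + n)) : tarc :=
  let c : cmp := inl (ends d j).1 in
  arc_of c (if (ends d j).2 then last_arc c else 0%N).

Definition internal (a : tarc) : bool := a \notin codom mark_arc.

Definition is_subdivision : Prop :=
  (forall c, uniq (sub c)) /\
  forall c t, t \in sub c ->
    [/\ tfund c t, tinner c t
      & forall k, (double_point k).1 <> (c, t) /\ (double_point k).2 <> (c, t)].

End Arcs.

Definition nosub : component n m -> seq R := fun=> [::].

(* pi(tau): words in the arcs (a, false) = a and their inverses (a, true) *)
Definition word : Type := seq (tarc nosub * bool).

Definition conj_word (o a : tarc nosub) : word :=
  [:: (o, false); (a, false); (o, true)].

Inductive wirtinger : word -> word -> Prop :=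
| wirt_refl u : wirtinger u u
| wirt_sym u v : wirtinger u v -> wirtinger v u
| wirt_trans u v w : wirtinger u v -> wirtinger v w -> wirtinger u w
| wirt_cat u u' v v' : wirtinger u u' -> wirtinger v v' -> wirtinger (u ++ v) (u' ++ v')
| wirt_cancel a b : wirtinger [:: (a, b); (a, ~~ b)] [::]
| wirt_positive k : positive k ->
    wirtinger [:: (arc_out nosub (under k), false)]
      (conj_word (arc_in nosub (over k)) (arc_in nosub (under k)))
| wirt_negative k : ~~ positive k ->
    wirtinger [:: (arc_in nosub (under k), false)]
      (conj_word (arc_in nosub (over k)) (arc_out nosub (under k))).

(* the coloring of arcs by G, extended to words *)
Definition word_color (mu : nat) (G : zmodType) (psi : cmp -> 'I_mu) (t : 'I_mu -> G)
    (w : word) : G :=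
  \sum_(l <- w) (if l.2 then - t (psi (tag l.1)) else t (psi (tag l.1))).

Section Alpha.
Variables (mu : nat) (G : zmodType) (psi : cmp -> 'I_mu) (t : 'I_mu -> G).
Variable sub : cmp -> seq R.
Local Notation RG := (group_ring G).

Definition alpha_row : finType :=
  ('I_(nclassical d) + {c : cmp & 'I_(size (sub c))})%type.

Definition alpha_entry (r : alpha_row) (x : tarc sub) : RG :=
  match r with
  | inl k =>
    let o := arc_in sub (over k) in
    let a := arc_in sub (under k) in
    let b := arc_out sub (under k) in
    let tj := group_elt (t (psi (over k).1)) in
    let ti := group_elt (t (psi (under k).1)) in
    let a' := if positive k then a else b in
    let b' := if positive k then b else a in
    - (x == b')%:R + tj * (x == a')%:R + (1 - ti) * (x == o)%:R
  | inr p =>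
    let P := (tag p, (sub (tag p))`_(tagged p)) in
    - (x == arc_out sub P)%:R + (x == arc_in sub P)%:R
  end.

Variables (p : nat) (rows : 'I_(p + n) -> alpha_row) (inner : 'I_p -> tarc sub).

Definition alpha_matrix : 'M[RG]_(p + n, p + (n + n)) :=
  row_mx (\matrix_(r, k) alpha_entry (rows r) (inner k))
         (\matrix_(r, j) alpha_entry (rows r) (mark_arc sub j)).

Definition alpha_columns (I : {set 'I_(n + n)}) (k : 'I_(p + n)) : 'I_(p + (n + n)) :=
  match fintype.split k with
  | inl i => lshift (n + n) i
  | inr i => rshift p (nth (lshift n i) (enum I) i)
  end.

Definition alpha : ext RG (n + n) :=
  [ffun I : {set 'I_(n + n)} =>
     if #|I| == n then \det (colsub (alpha_columns I) alpha_matrix) else 0].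

(* the orders of the rows and columns, and the condition on subdivisions *)
Definition alpha_admissible : Prop :=
  [/\ is_subdivision sub, forall c, (0 < size (breaks sub c))%N, bijective rows,
      injective inner & forall a, internal a <-> exists k, inner k = a].

End Alpha.
End Diagrams.
Arguments nosub {R n m} _ : assert.

(* A system of annuli S^1 x [0, 1] and tori S^1 x (R / Z) in the 4-ball, with the *)
(* components of the boundary link, all parametrized compatibly with their        *)
(* orientations (S^1 x [0, 1] and S^1 x R / Z carry the product orientation). The *)
(* j-th component of the link is the boundary component of the annulus i at time  *)
(* b, where link_ends j = (i, b).                                                 *)
Record tangle4 (R : realType) (n m : nat) := Tangle4 {
  surf : component n m -> 'rV[R]_2 -> R -> 'rV[R]_4;
  link : 'I_(n + n) -> 'rV[R]_2 -> 'rV[R]_4;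
  link_ends : 'I_(n + n) -> 'I_n * bool
}.

Section RibbonTangles.
Variables (R : realType) (n m : nat).
Local Notation cmp := (component n m).
Local Notation point := (cmp * ('rV[R]_2 * R))%type.

Definition solid_dom (c : cmp) : set ('rV[R]_2 * R) :=
  [set p | disk p.1 /\ tdom c p.2].
Definition surf_dom (c : cmp) : set ('rV[R]_2 * R) :=
  [set p | circle p.1 /\ tdom c p.2].

Definition same_point (P Q : point) : Prop :=
  [/\ P.1 = Q.1, P.2.1 = Q.2.1 & same_time P.1 P.2.2 Q.2.2].

Section OneTangle.
Variable T : tangle4 R n m.

Definition tangle_set : set 'rV[R]_4 :=
  [set y | exists c q t, [/\ circle q, tdom c t & y = surf T c q t]].
Definition link_set : set 'rV[R]_4 :=
  [set y | exists j q, circle q /\ y = link T j q].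

Definition exterior : set 'rV[R]_4 := @ball4 R `\` tangle_set.
Definition link_exterior : set 'rV[R]_4 := @sphere3 R `\` link_set.

Record is_embedded : Prop := {
  emb_cont : forall c,
    {within surf_dom c, continuous (fun p : 'rV[R]_2 * R => surf T c p.1 p.2)};
  emb_periodic : forall (j : 'I_m) q t, surf T (inr j) q (t + 1) = surf T (inr j) q t;
  emb_ball : forall c q t, circle q -> tdom c t -> ball4 (surf T c q t);
  emb_inj : forall P Q : point, surf_dom P.1 P.2 -> surf_dom Q.1 Q.2 ->
    surf T P.1 P.2.1 P.2.2 = surf T Q.1 Q.2.1 Q.2.2 -> same_point P Q;
  emb_proper : forall c q t, circle q -> tdom c t ->
    (sphere3 (surf T c q t) <-> is_end c t);
  emb_flat : forall y, tangle_set y -> exists NB Z : {set 'I_4},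
    [/\ #|Z| = 2%N, (#|NB| <= 1)%N, NB :&: Z = finset.set0 & flat_chart tangle_set y NB Z NB]
}.

(* q |-> surf T (inl i) q b is positively oriented with respect to the boundary  *)
(* orientation when b = 0, and negatively oriented when b = 1.                   *)
Definition is_boundary_link : Prop :=
  bijective (link_ends T) /\
  forall j q, circle q -> link T j q =
    let (i, b) := link_ends T j in
    surf T (inl i) (if b then conj2 q else q) (nat_of_bool b)%:R.

(* the link bounds disjoint locally flat disks in the sphere *)
Definition is_trivial_link : Prop :=
  exists D : 'I_(n + n) -> 'rV[R]_2 -> 'rV[R]_4,
    [/\ forall j, {within @disk R, continuous (D j)},
        forall j q, circle q -> D j q = link T j q,
        forall j q, disk q -> sphere3 (D j q),
        forall j j' q q', disk q -> disk q' -> D j q = D j' q' -> j = j' /\ q = q' &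
        forall j q, disk q -> exists NB Z N : {set 'I_4},
          [/\ #|NB| = 1%N, NB \subset Z, #|Z| = 2%N,
              (#|N| <= 1)%N /\ N :&: Z = finset.set0
            & flat_chart (D j @` @disk R) (D j q) NB Z N]].

Section Filling.
Variable F : cmp -> 'rV[R]_2 -> R -> 'rV[R]_4.

Definition fill (P : point) : 'rV[R]_4 := F P.1 P.2.1 P.2.2.

(* F immerses the solid tori and the 3-balls B^2 x [0, 1], the latter with their  *)
(* ends B^2 x {0, 1} in the sphere.                                               *)
Record is_filling : Prop := {
  fill_cont : forall c,
    {within solid_dom c, continuous (fun p : 'rV[R]_2 * R => F c p.1 p.2)};
  fill_periodic : forall (j : 'I_m) q t, F (inr j) q (t + 1) = F (inr j) q t;
  fill_surf : forall c q t, circle q -> tdom c t -> F c q t = surf T c q t;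
  fill_ball : forall c q t, disk q -> tdom c t -> ball4 (F c q t);
  fill_proper : forall c q t, disk q -> tdom c t -> (sphere3 (F c q t) <-> is_end c t);
  fill_flat : forall c (x : 'rV[R]_2 * R), solid_dom c x ->
    exists V : set ('rV[R]_2 * R),
      [/\ open V, V x,
          forall y z, V y -> V z -> solid_dom c y -> solid_dom c z ->
            F c y.1 y.2 = F c z.1 z.2 -> y = z &
          exists NB Z N : {set 'I_4},
            [/\ #|Z| = 1%N, Z :&: N = finset.set0, NB \subset N, (#|NB| <= 1)%N &
              flat_chart [set F c y.1 y.2 | y in V `&` solid_dom c] (F c x.1 x.2) NB Z N]]
}.

(* The disk parametrized by the disk of R^2 through a and b is a ribbon disk:     *)
(* a lies in the interior of the first 3-manifold, b is proper in the second      *)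
(* one with boundary essential in the annulus or torus.                           *)
Definition is_ribbon_disk (cA cB : cmp) (a b : 'rV[R]_2 -> 'rV[R]_2 * R) : Prop :=
  [/\ {within @disk R, continuous a} /\ {within @disk R, continuous b},
      forall q, disk q -> fill (cA, a q) = fill (cB, b q),
      forall q, disk q -> sqnorm (a q).1 < 1 /\ tinner cA (a q).2,
      forall q, disk q -> [/\ tinner cB (b q).2, sqnorm q < 1 -> sqnorm (b q).1 < 1
        & circle q -> circle (b q).1]
    & ~ exists g : 'rV[R]_2 -> 'rV[R]_2 * R,
        [/\ {within @disk R, continuous g}, forall q, disk q -> surf_dom cB (g q)
          & forall q, circle q -> g q = b q]].

Definition has_ribbon_singularities : Prop :=
  exists (K : nat) (cA cB : 'I_K -> cmp) (a b : 'I_K -> 'rV[R]_2 -> 'rV[R]_2 * R),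
    [/\ forall k, is_ribbon_disk (cA k) (cB k) (a k) (b k),
        forall k k' q q', disk q -> disk q' ->
          fill (cA k, a k q) = fill (cA k', a k' q') -> k = k' /\ q = q'
      & forall P Q : point, solid_dom P.1 P.2 -> solid_dom Q.1 Q.2 ->
          fill P = fill Q -> ~ same_point P Q ->
          exists k q, disk q /\
            ((same_point P (cA k, a k q) /\ same_point Q (cB k, b k q)) \/
             (same_point Q (cA k, a k q) /\ same_point P (cB k, b k q)))].

End Filling.

Definition is_ribbon_tangle : Prop :=
  [/\ is_embedded, is_boundary_link, is_trivial_link
    & exists F, is_filling F /\ has_ribbon_singularities F].

End OneTangle.

(* The Tube map. A realization of Tube(tau) is given by bands band c t s          *)
(* (-1 <= s <= 1) thickening the curves of tau, and by the radius, the height     *)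
(* (third coordinate) and the level (fourth coordinate) of the tubes in           *)
(* D x [-1, 1]^2; motion is an ambient isotopy of the ball.                       *)
Record tube_data := TubeData {
  band : cmp -> R -> R -> 'rV[R]_2;
  radius : cmp -> R -> R;
  height : cmp -> R -> R;
  level : cmp -> R -> R;
  motion : R -> 'rV[R]_4 -> 'rV[R]_4
}.

(* the radial homeomorphism from D x [-1, 1]^2 to the unit ball *)
Definition cyl_to_ball (v : 'rV[R]_4) : 'rV[R]_4 :=
  (Num.max (Num.sqrt (v 0 0 ^+ 2 + v 0 1 ^+ 2)) (Num.max `|v 0 2| `|v 0 3|)
    / Num.sqrt (sqnorm v)) *: v.

Definition is_ambient_isotopy (H : R -> 'rV[R]_4 -> 'rV[R]_4) : Prop :=
  [/\ {within [set p | 0 <= p.1 <= 1 /\ ball4 p.2],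
         continuous (fun p : R * 'rV[R]_4 => H p.1 p.2)},
      forall s, 0 <= s <= 1 -> set_bij (@ball4 R) (@ball4 R) (H s),
      forall y, ball4 y -> H 0 y = y
    & forall s y, 0 <= s <= 1 -> sphere3 y -> H s y = y].

Section Tube.
Variables (d : diagram R n m) (D : tube_data).

(* the point of D x [-1, 1]^2 with coordinates (x, z) in the cross-section of the  *)
(* tube at time t, relative to its axis, and at level e above it                  *)
Definition tube_coord (c : cmp) (t : R) (x z e : R) : 'rV[R]_4 :=
  let y := band D c t x in
  vec4 (y 0 0) (y 0 1) (height D c t + z) (level D c t + e).

Definition tube_solid (P : point) : 'rV[R]_4 :=
  let: (c, (q, t)) := P in
  tube_coord c t (radius D c t * q 0 0) (radius D c t * q 0 1) 0.

Definition to_ball (v : 'rV[R]_4) : 'rV[R]_4 := motion D 1 (cyl_to_ball v).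

Record is_tube_data : Prop := {
  tube_motion : is_ambient_isotopy (motion D);
  tube_cont : forall c,
    [/\ {within [set p : R * R | tdom c p.1 /\ -1 <= p.2 <= 1],
           continuous (fun p : R * R => band D c p.1 p.2)},
        {within tdom c, continuous (radius D c)}, {within tdom c, continuous (height D c)}
      & {within tdom c, continuous (level D c)}];
  tube_periodic :
    [/\ periodic (band D), periodic (radius D), periodic (height D) & periodic (level D)];
  tube_range : forall c t, tdom c t ->
    [/\ 0 < radius D c t < 1, `|height D c t| + radius D c t < 1, `|level D c t| < 1
      & forall s, -1 <= s <= 1 ->
          disk (band D c t s) /\ (circle (band D c t s) <-> is_end c t)];
  (* s increases towards the left of the curve *)
  tube_core : forall c t, tdom c t ->
    band D c t 0 = curve d c t /\
    (tinner c t -> derivable (band D c t) 0 1 /\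
                   0 < det2 (velocity d (c, t)) (derive1 (band D c t) 0));
  tube_immersed : forall c t, tdom c t -> exists2 e : R, 0 < e &
    forall t1 s1 t2 s2, tdom c t1 -> tdom c t2 -> `|t1 - t| < e -> `|t2 - t| < e ->
      -1 <= s1 <= 1 -> -1 <= s2 <= 1 ->
      band D c t1 s1 = band D c t2 s2 -> t1 = t2 /\ s1 = s2;
  (* Around each classical crossing the over tube stays at a constant level, and  *)
  (* the under tube meets its filling in one cross-section, going upwards if the  *)
  (* crossing is positive and downwards if it is negative; there is no other      *)
  (* intersection, in particular none at virtual crossings.                       *)
  tube_crossing : exists2 e : R, 0 < e &
    [/\ forall (k k' : 'I_(nclassical d)) (b b' : bool),
          let P := if b then over k else under k in
          let Q := if b' then over k' else under k' in
          P <> Q -> P.1 = Q.1 ->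
          forall t t', `|t - P.2| <= e -> `|t' - Q.2| <= e -> ~ same_time P.1 t t',
        forall k : 'I_(nclassical d),
          [/\ height D (over k).1 (over k).2 = height D (under k).1 (under k).2,
              level D (over k).1 (over k).2 = level D (under k).1 (under k).2
            & forall t, tdom (over k).1 t -> `|t - (over k).2| <= e ->
                level D (over k).1 t = level D (over k).1 (over k).2],
        forall k : 'I_(nclassical d), forall q, disk q -> exists q' t',
          [/\ sqnorm q' < 1, tdom (over k).1 t', `|t' - (over k).2| < e
            & tube_solid ((under k).1, (q, (under k).2)) = tube_solid ((over k).1, (q', t'))],
        forall (k : 'I_(nclassical d)) t,
          tdom (under k).1 t -> t <> (under k).2 -> `|t - (under k).2| <= e ->
          let rise := (level D (under k).1 t - level D (under k).1 (under k).2)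
                        * (t - (under k).2) in
          (positive k -> 0 < rise) /\ (~~ positive k -> rise < 0)
      & forall P Q : point, solid_dom P.1 P.2 -> solid_dom Q.1 Q.2 ->
          tube_solid P = tube_solid Q -> ~ same_point P Q ->
          let meets (P Q : point) (k : 'I_(nclassical d)) :=
            [/\ P.1 = (under k).1, same_time P.1 P.2.2 (under k).2, Q.1 = (over k).1
              & exists2 t, same_time Q.1 Q.2.2 t & `|t - (over k).2| < e] in
          exists k, meets P Q k \/ meets Q P k]
}.

Definition is_tube (T : tangle4 R n m) : Prop :=
  [/\ is_tube_data, link_ends T = ends d
    & forall c q t, circle q -> tdom c t -> surf T c q t = to_ball (tube_solid (c, (q, t)))].

(* The disk of centre the point q of the cross-section of the tube at time t,     *)
(* spanned by the outer radial direction and the direction of increasing levels.  *)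
(* The orientation of the tube (as the image of S^1 x [0, 1] or S^1 x R / Z)      *)
(* followed by that of this disk is the orientation of R^4.                       *)
Definition meridian_disk (c : cmp) (t : R) (q : 'rV[R]_2) (e : R) (v : 'rV[R]_2) :
    'rV[R]_4 :=
  let r := radius D c t + e * v 0 0 in
  to_ball (tube_coord c t (r * q 0 0) (r * q 0 1) (e * v 0 1)).

Definition is_meridian (A : set 'rV[R]_4) (x : A) (c : cmp) (t : R) (f : rpath R A) :
    Prop :=
  exists (q : 'rV[R]_2) (e : R) (tail g : rpath R A),
    [/\ circle q /\ 0 < e,
        [/\ radius D c t + e < 1, `|height D c t| + radius D c t + e < 1
          & `|level D c t| + e < 1],
        forall v, disk v -> v != 0 -> A (meridian_disk c t q e v),
        tail 0 = x /\ is_loop x f /\ path_homotopic f g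
      & forall s : R, 0 <= s <= 1 ->
          [/\ s <= 3^-1 -> g s = tail (3 * s),
              3^-1 <= s <= 2 / 3 -> set_val (g s) = meridian_disk c t q e
                (vec2 (cos (2 * pi * (3 * s - 1))) (sin (2 * pi * (3 * s - 1))))
            & 2 / 3 <= s -> g s = tail (3 - 3 * s)]].

End Tube.
End RibbonTangles.

(* An isomorphism pi_1(X, x) -> pi(tau), given by words representing the images   *)
(* of loops; products of loops are read from left to right.                       *)
Definition is_group_iso (R : realType) (n m : nat) (d : diagram R n m)
    (X : topologicalType) (x : X) (iota : rpath R X -> word d) : Prop :=
  [/\ forall f g h, is_loop x f -> is_loop x g -> is_loop x h -> path_concat f g h ->
        wirtinger (iota h) (iota f ++ iota g),
      forall f g, is_loop x f -> is_loop x g ->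
        (wirtinger (iota f) (iota g) <-> path_homotopic f g)
    & forall w, exists2 f, is_loop x f & wirtinger (iota f) w].

(* The invariant A for X = X_T, Y = S^3 \ L and the inclusion j : Y -> X, computed *)
(* in maximal abelian covers pX and pY of X and Y; jhat lifts j. The loops x_i     *)
(* in Y based at y0 lift to the paths xhat i.                                      *)
Section InvariantA.
Variables (R : realType) (n : nat) (G : zmodType).
Variables (X Y X' Y' : topologicalType).
Variables (pX : continuousType X' X) (pY : continuousType Y' Y).
Variables (j : continuousType Y X) (jhat : continuousType Y' X').
Variables (phi : chains R 1 X int -> G) (y0 : Y) (xhat : 'I_(n + n) -> rpath R Y').
Local Notation RG := (group_ring G).

Definition phi_bd (c : chains R 1 Y int) : G := phi (push_chain j c).

Definition cycX : set (chains R 1 X' RG) :=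
  @twisted_cycle R X' X pX G phi [set j y0] 0.
Definition bdX : set (chains R 1 X' RG) :=
  @twisted_bound R X' X pX G phi [set j y0] 0.
Definition cycY : set (chains R 1 Y' RG) :=
  @twisted_cycle R Y' Y pY G phi_bd [set y0] 0.
Definition bdY : set (chains R 1 Y' RG) :=
  @twisted_bound R Y' Y pY G phi_bd [set y0] 0.

Definition xclass (i : 'I_(n + n)) : chains R 1 Y' RG := path_chain RG (xhat i).

(* For a presentation with n + q generators and relations the rows of r, and     *)
(* u_1, ..., u_n with lifts the rows of ut, this is A_T^phi(u_1 /\ ... /\ u_n).  *)
Definition alexander_function (q : nat) (r : 'M[RG]_(q, n + q)) (ut : 'M[RG]_(n, n + q)) : RG :=
  ext_top (wedge (wedge_rows r) (wedge_rows ut)).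

(* a represents A(T, phi): nu defines the volume form omega on H_bd, the free     *)
(* module on the classes of the xhat i, and the rows of v are the coordinates of  *)
(* z_1, ..., z_n in H_bd.                                                         *)
Definition represents_A (a : ext RG (n + n)) : Prop :=
  ext_homogeneous n a /\
  exists (q : nat) (gens : 'I_(n + q) -> chains R 1 X' RG) (r : 'M[RG]_(q, n + q)) (nu : RG),
    [/\ presents cycX bdX gens r, is_unit_elt nu
      & forall (z : 'I_n -> chains R 1 Y' RG) (v : 'M[RG]_(n, n + n)) (ut : 'M[RG]_(n, n + q)),
          (forall i, cycY (z i)) ->
          (forall i, bdY (z i - \sum_k v i k *: xclass k)) ->
          (forall i, bdX (push_chain jhat (z i) - \sum_k ut i k *: gens k)) ->
          alexander_function r ut = nu * ext_top (wedge a (wedge_rows v))].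

End InvariantA.

(* Main.v *)
(* The loops representing the arcs of tau lift to 1-chains of the cover, and the   *)
(* rows of M(tau) are the Fox derivatives of the Wirtinger relations. Since loops  *)
(* multiply as words, f |-> Fox derivative of iota f is a crossed homomorphism     *)
(* modulo the rows of M(tau); extended to all 1-chains by joining every point of   *)
(* X_T to the base point, it inverts the map sending the arcs to their lifts, so   *)
(* that M(tau) presents H_1(X_T, pt). By Laplace expansion, alpha(tau) is the      *)
(* element of the exterior algebra of H_bd defined by this presentation. Two       *)
(* presentations of deficiency n give Alexander functions that are multiples of    *)
(* each other, hence associates because Z[G] is a domain.                          *)
From HB Require Import structures.
Require Import Defs.
From mathcomp Require Import all_boot all_order all_algebra.
From mathcomp Require Import all_classical all_reals all_analysis.
From mathcomp Require Import freeg ring zify lra.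

Set Implicit Arguments.
Unset Strict Implicit.
Unset Printing Implicit Defensive.

Import Order.TTheory GRing.Theory Num.Theory numFieldNormedType.Exports.

Local Open Scope ring_scope.

(** * Exterior algebra *)

(** Both invariants are read off one presentation matrix. Under the isomorphism of $\pi(\tau)$ with
    $\pi_1(X_T)$, Fox calculus on the Wirtinger relations shows that $M^\psi(\tau)$ presents
    $H_1^\varphi(X_T,\ast)$ on the lifts of loops representing the arcs ([alpha_presents]). It has
    $p+2n$ generators and $p+n$ relations, and its last $2n$ generators are the images of the
    meridians $x_i$ (by [word_lift]). Hence the Alexander function at
    $m_\partial(z_1)\wedge\dots\wedge m_\partial(z_n)$ is the determinant of $M$ stacked on
    $[0\; v]$, with $v$ the matrix of coordinates of the $z_i$. Laplace expansion
    ([ext_top_wedge_row_mx0], [wedge_rows_alpha_columns]) turns this determinant into the top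
    coordinate of $\alpha\wedge z_1\wedge\dots\wedge z_n$.

    Homology is singular homology of a maximal abelian cover, so the presentation is obtained
    without a cell structure ([crossed_presentation]). Joining all points of $X_T$ to the base point
    by tethers extends a crossed homomorphism $D$ on loops to a linear map [cross_chain] on 1-chains
    of the cover, which kills boundaries modulo the relations. In the other direction, lifting the
    tethers gives a chain homotopy ([chain_decomposition]) showing that the lifts of the generating
    loops span the cycles. For $D$ one takes the Fox derivative of the word of a loop, which is well
    defined modulo the rows of $M$ ([arc_basis_fox]).

    There remains the choice of the presentation. Two presentations of deficiency $n$ become
    comparable after adjoining the generators of each to the other, and their Alexander functions
    divide each other ([presents_compare]). Since $\mathbb{Z}[G]$ is a domain
    ([free_abelian_group_ring_integral]), they differ by a unit ([alexander_element]). *)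

Section Wedge.
Variables (A : comNzRingType) (N : nat).
Implicit Types (I J K : {set 'I_N}) (a b c : ext A N).

(** In this form the exponent of the sign is visibly additive in each of the two sets. *)
Lemma inversions_sum I J : inversions I J = (\sum_(i in I) \sum_(j in J) (j < i))%N.
Proof.
rewrite /inversions -sum1_card pair_big_dep /=.
under eq_bigl => ij do rewrite inE.
by rewrite big_mkcondr; apply: eq_bigr => -[i j] _ /=; case: ltnP.
Qed.

Lemma inversionsUl I J K : [disjoint I & J] ->
  inversions (I :|: J) K = (inversions I K + inversions J K)%N.
Proof. 
by move=> dIJ; rewrite !inversions_sum -bigU //; apply: eq_bigl => i; rewrite !inE.
Qed.

Lemma inversionsUr I J K : [disjoint J & K] ->
  inversions I (J :|: K) = (inversions I J + inversions I K)%N.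
Proof.
move=> dJK; rewrite !inversions_sum -big_split.
by apply: eq_bigr => i _; rewrite -bigU //; apply: eq_bigl => j; rewrite !inE.
Qed.

(** Both triple products are sums over the splittings of K into three disjoint parts, and additivity
    of the inversion counts makes the signs agree. *)
Lemma wedgeA : associative (@wedge A N).
Proof.
move=> a b c; apply/ffunP => K; rewrite !ffunE.
under [RHS]eq_bigr => L _ do rewrite ffunE big_distrr big_distrl /=.
rewrite (exchange_big_dep (fun I => I \subset K)) /=; last first.
  by move=> L I sLK sIL; exact: fintype.subset_trans sIL sLK.
apply: eq_bigr => I sIK; rewrite ffunE big_distrr /=.
(* On the right the summation variable is the union L of the first two parts; it is replaced by the
   second part J. *)
rewrite [RHS](reindex_onto (fun J => I :|: J) (fun L => L :\: I)) /=; last first.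
  by move=> L /andP[_ sIL]; rewrite -[in RHS](finset.setID L I) (finset.setIidPr sIL).
apply: eq_big => [J|J sJ].
  rewrite subsetU ?subxx // andbT finset.setDUl finset.setDv finset.set0U.
  rewrite finset.subUset sIK subsetD /=; case: (J \subset K) => //=.
  by apply/idP/eqP => [/finset.setDidPl|<-] //; rewrite finset.setDE -setI_eq0
    -finset.setIA [X in _ :&: X]finset.setIC finset.setICr finset.setI0.
have /andP[sJK dJI] : (J \subset K) && [disjoint J & I] by rewrite -subsetD.
have dIJ : [disjoint I & J] by rewrite disjoint_sym.
have EJ : (I :|: J) :\: I = J.
  by rewrite finset.setDUl finset.setDv finset.set0U; apply/finset.setDidPl.
rewrite EJ.
have EK : K :\: I = J :|: (K :\: (I :|: J)).
  by rewrite finset.setUC -[LHS](finset.setID _ J) finset.setDDl finset.setUC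
   (finset.setIidPr sJ).
have dJr : [disjoint J & K :\: (I :|: J)].
  by rewrite disjoint_subset; apply/fintype.subsetP => i iJ; rewrite !inE iJ orbT.
rewrite finset.setDDl inversionsUl // {1}EK inversionsUr // !exprD.
ring.
Qed.

Lemma wedge1l : left_id (ext1 A N) (@wedge A N).
Proof.
move=> a; apply/ffunP => K; rewrite ffunE (bigD1 finset.set0) ?finset.sub0set //= big1 => [|I].
  by rewrite ffunE eqxx mulr1 finset.setD0 addr0 inversions_sum finset.big_set0 mul1r.
by case/andP => _ /negPf nI; rewrite ffunE nI mulr0 mul0r.
Qed.

Lemma wedge1r : right_id (ext1 A N) (@wedge A N).
Proof.
move=> a; apply/ffunP => K; rewrite ffunE (bigD1 K) //= big1 => [|I].
  rewrite ffunE finset.setDv eqxx mulr1 addr0 inversions_sum.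
  by rewrite big1 ?mul1r // => i _; rewrite finset.big_set0.
case/andP => sIK nIK; rewrite ffunE (_ : _ == _ = false) ?mulr0 //.
by apply: contraNF nIK => /eqP KI; rewrite finset.eqEsubset sIK -finset.setD_eq0 KI eqxx.
Qed.

HB.instance Definition _ := Monoid.isLaw.Build (ext A N) (ext1 A N) (@wedge A N)
  wedgeA wedge1l wedge1r.

Lemma wedge_rows_col_mx k l (P : 'M[A]_(k, N)) (Q : 'M[A]_(l, N)) :
  wedge (wedge_rows P) (wedge_rows Q) = wedge_rows (col_mx P Q).
Proof.
rewrite /wedge_rows big_split_ord /=.
by congr wedge; apply: eq_bigr => i _; rewrite ?rowKu ?rowKd.
Qed.

(** This is the expansion along a first row: the sign counts the elements of K below i. *)
Lemma wedge_vec (v : 'rV[A]_N) b K :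
  wedge (ext_vec v) b K = 
  \sum_(i in K) (-1) ^+ (\sum_(j in K) (j < i))%N * v 0 i * b (K :\ i).
Proof.
rewrite ffunE.
under eq_bigr => I sI do rewrite ffunE big_distrr big_distrl /=.
rewrite exchange_big /= [RHS]big_mkcond; apply: eq_bigr => i _ /=.
case: ifP => iK; last first.
  rewrite big1 // => I sI; rewrite (_ : _ == _ = false) ?mulr0 ?mul0r //.
  by apply: contraFF iK => /eqP EI; rewrite EI finset.sub1set in sI.
rewrite (bigD1 [set i]) ?finset.sub1set //= eqxx mulr1 big1 => [|I /andP[_ /negPf->]]; last first.
  by rewrite !(mulr0, mul0r).
rewrite addr0 inversions_sum finset.big_set1 [in RHS](finset.big_setD1 i) //=.
by rewrite ltnn.
Qed.

End Wedge.
(** By induction on the number of rows, [wedge_vec] being the Laplace expansion of the minor along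
    its first row: as f is increasing, exactly l chosen columns precede [f l]. *)
Lemma wedge_rows_minor (A : comNzRingType) (N k : nat) (M : 'M[A]_(k, N)) (f : 'I_k -> 'I_N) :
  {homo f : i j / (i < j)%N} ->
  wedge_rows M (f @: [set: 'I_k]) = \det (colsub f M).
Proof.
elim: k M f => [|k IH] M f fI.
  rewrite /wedge_rows big_ord0 det_mx00 ffunE (_ : _ == _ = true) //.
  by rewrite -cards_eq0 -leqn0 (leq_trans (leq_imset_card _ _)) // cardsT card_ord.
have fi : injective f.
  by move=> i j ij; case: (ltngtP i j) => [/fI|/fI|/val_inj //]; rewrite ij ltnn.
have fm i j : (f i < f j)%N = (i < j)%N.
  apply/idP/idP => [|/fI //]; case: (ltngtP i j) => [//|/fI|/val_inj->]; last by rewrite ltnn.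
  by move=> /ltnW; rewrite leqNgt => /negPf->.
rewrite /wedge_rows big_ord_recl wedge_vec big_imset /=; last by move=> ? ? _ _; exact: fi.
rewrite (expand_det_row _ 0); apply: eq_big => [l|l _]; first by rewrite inE.
rewrite big_imset /=; last by move=> ? ? _ _; exact: fi.
have -> : (\sum_(i in [set: 'I_k.+1]) (f i < f l))%N = l.
  rewrite big_mkcond /=; under eq_bigr do rewrite inE fm.
  rewrite (_ : \sum_i _ = \sum_(i < k.+1) if (i < l)%N then 1%N else 0%N) => [|];
    last by apply: eq_bigr => i _; case: ifP.
  by rewrite -big_mkcond -(big_ord_widen k.+1 (fun=> 1%N) (ltnW (ltn_ord l))) sum_nat_const
    card_ord muln1.
have -> : \big[@wedge A N/ext1 A N]_(i < k) ext_vec (row (fintype.lift ord0 i) M) =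
    wedge_rows (row' 0 M).
  by apply: eq_bigr => i _; congr ext_vec; apply/rowP => j; rewrite !mxE.
have -> : f @: [set: 'I_k.+1] :\ f l = (f \o fintype.lift l) @: [set: 'I_k].
  apply/setP => x; rewrite !inE; apply/andP/imsetP => [[xl /imsetP[j _ xj]]|[j _ ->]].
    have /unlift_some[j' Ej _] : l != j by apply: contraNneq xl => ->; rewrite xj.
    by exists j'; rewrite ?inE //= -Ej.
  by rewrite /= (inj_eq fi) eq_sym neq_lift; split=> //; apply: imset_f; rewrite inE.
rewrite IH /cofactor ?mxE ?add0n; last first.
  by move=> i j ij; rewrite fm /= /bump; move: ij; do 2 case: leqP; lia.
rewrite [_ * M _ _]mulrC -mulrA; congr (_ * (_ * \det _)).
by apply/matrixP => i j; rewrite !mxE.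
Qed.
Lemma wedge_rows_recl (A : comNzRingType) (N k : nat) (M : 'M[A]_(k.+1, N)) :
  wedge_rows M = wedge (ext_vec (row ord0 M)) (wedge_rows (row' ord0 M)).
Proof.
rewrite /wedge_rows big_ord_recl; congr wedge.
by apply: eq_bigr => j _; congr ext_vec; apply/rowP => l; rewrite !mxE.
Qed.

Lemma wedge_rows_homogeneous (A : comNzRingType) (N k : nat) (M : 'M[A]_(k, N)) :
  ext_homogeneous k (wedge_rows M).
Proof.
elim: k M => [|k IH] M K Kk.
  by rewrite /wedge_rows big_ord0 ffunE -cards_eq0 (negPf Kk).
rewrite wedge_rows_recl wedge_vec big1 // => i iK.
rewrite IH ?mulr0 //; apply: contra_neq Kk => Kk.
by rewrite (cardsD1 i) iK Kk.
Qed.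

Lemma ext_top_wedge_rows (A : comNzRingType) (N k : nat) (M : 'M[A]_(k, N)) (e : k = N) :
  ext_top (wedge_rows M) = \det (castmx (e, erefl N) M).
Proof.
subst N; rewrite castmx_id; have <- : colsub id M = M by apply/matrixP => i j; rewrite mxE.
rewrite -wedge_rows_minor // (_ : colsub id M = M); last by apply/matrixP => i j; rewrite mxE.
by congr (wedge_rows M _); apply/esym/setP => i; rewrite -[i]/(id i) imset_f ?inE.
Qed.

(** Vectors supported on the last m coordinates multiply within these coordinates; the shift by p
    preserves the order, hence the signs. *)
Lemma wedge_rows_row_mx0 (A : comNzRingType) (k p m : nat) (v : 'M[A]_(k, m))
    (K : {set 'I_(p + m)}) :
  wedge_rows (row_mx (0 : 'M[A]_(k, p)) v) K =
  [forall i, lshift m i \notin K]%:R * wedge_rows v [set j | rshift p j \in K].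
Proof.
elim: k v K => [|k IH] v K.
  rewrite /wedge_rows !big_ord0 !ffunE; case: forallP => nK; last first.
    rewrite mul0r (_ : _ == _ = false) //.
    by apply: contra_notF nK => /eqP -> i; rewrite inE.
  rewrite mul1r; congr (nat_of_bool _)%:R; apply/eqP/eqP => [->|K0]; apply/setP => x.
    by rewrite !inE.
  rewrite inE; apply/negP; case: (split_ordP x) => j ->; first exact/negP.
  by apply/negP; move/setP/(_ j): K0; rewrite !inE => ->.
rewrite !wedge_rows_recl !wedge_vec [LHS]big_mkcond big_split_ord /= big1 ?add0r => [|i _];
  last first.
  by case: ifP => // _; rewrite [row _ _ _ _]mxE row_mxEl mxE mulr0 mul0r.
rewrite [in RHS]big_mkcond big_distrr /=; apply: eq_bigr => j _.
rewrite inE; case: ifP => jK; last by rewrite mulr0.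
have -> : row' ord0 (row_mx (0 : 'M[A]_(k.+1, p)) v) = row_mx 0 (row' ord0 v).
  apply/matrixP => a b; rewrite [LHS]mxE; case: (split_ordP b) => c ->.
    by rewrite !row_mxEl !mxE.
  by rewrite !row_mxEr !mxE.
rewrite IH.
have -> : [set i | rshift p i \in K :\ rshift p j] = [set i | rshift p i \in K] :\ j.
  by apply/setP => a; rewrite !inE (inj_eq (@rshift_inj _ _)).
have -> : [forall i, lshift m i \notin K :\ rshift p j] = [forall i, lshift m i \notin K].
  by apply: eq_forallb => i; rewrite !inE eq_lrshift.
case: forallP => nK; last by rewrite !mul0r mulr0.
rewrite !mul1r [row _ (row_mx _ _) _ _]mxE row_mxEr [row _ v _ _]mxE; congr (_ ^+ _ * _ * _).
rewrite big_mkcond big_split_ord /= big1 ?add0n => [|i _]; last by rewrite (negPf (nK i)).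
rewrite [RHS]big_mkcond; apply: eq_bigr => i _.
by rewrite inE ltn_add2l.
Qed.

(** * Laplace expansion with the first p columns always chosen *)

Section EmbedLow.
Variables (p m : nat).
Implicit Types I J : {set 'I_m}.

Definition low_union I : {set 'I_(p + m)} :=
  [set lshift m i | i in [set: 'I_p]] :|: [set rshift p j | j in I].

Lemma lshift_low_union I i : lshift m i \in low_union I.
Proof. by rewrite inE imset_f ?inE. Qed.

Lemma rshift_low_union I j : (rshift p j \in low_union I) = (j \in I).
Proof.
rewrite inE (finset.mem_imset _ _ (@rshift_inj _ _)) orbC.
by case: imsetP => [[i _ /eqP]|]; rewrite ?eq_rlshift // orbF.
Qed.

Lemma card_low_union I : #|low_union I| = (p + #|I|)%N.
Proof.
rewrite cardsU !card_imset; try exact: lshift_inj; try exact: rshift_inj.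
rewrite cardsT card_ord (_ : _ :&: _ = finset.set0) ?cards0 ?subn0 //.
apply/setP => x; rewrite !inE; apply/negP => /andP[/imsetP[i _ ->] /imsetP[j _ /eqP]].
by rewrite eq_lrshift.
Qed.

(** The p low indices precede every index of the complement, so they create no inversion. *)
Lemma inversions_low_union I :
  inversions (low_union I) ([set: 'I_(p + m)] :\: low_union I) =
  inversions I ([set: 'I_m] :\: I).
Proof.
rewrite !inversions_sum big_mkcond big_split_ord /= big1 ?add0n => [|i _]; last first.
  rewrite lshift_low_union big1 // => x; rewrite finset.in_setD finset.in_setT andbT.
  case: (split_ordP x) => j -> /=; first by rewrite lshift_low_union.
  by rewrite ltnNge (leq_trans (ltnW (ltn_ord i))) ?leq_addr.
rewrite [RHS]big_mkcond; apply: eq_bigr => i _; rewrite rshift_low_union; case: ifP => // iI.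
rewrite big_mkcond big_split_ord /= big1 ?add0n => [|j _]; last first.
  by rewrite finset.in_setD lshift_low_union.
rewrite [RHS]big_mkcond; apply: eq_bigr => j _.
by rewrite !finset.in_setD !finset.in_setT rshift_low_union ltn_add2l.
Qed.

(* the generalized Laplace expansion along the rows of [0 v] *)
Lemma ext_top_wedge_row_mx0 (A : comNzRingType) k (a : ext A (p + m)) (v : 'M[A]_(k, m)) :
  ext_top (wedge a (wedge_rows (row_mx (0 : 'M[A]_(k, p)) v))) =
  ext_top (wedge [ffun I : {set 'I_m} => a (low_union I)] (wedge_rows v)).
Proof.
rewrite /ext_top !ffunE.
under eq_bigr => K _ do rewrite wedge_rows_row_mx0.
rewrite (bigID (fun K : {set 'I_(p + m)} => [forall i, lshift m i \in K])) /=.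
rewrite addrC big1 ?add0r => [|K /andP[_ /forallPn[i iK]]]; last first.
  rewrite (_ : [forall i, _] = false) ?mul0r ?mulr0 //.
  by apply/forallP => /(_ i); rewrite !inE iK.
rewrite (reindex_onto low_union (fun K : {set 'I_(p + m)} => [set j | rshift p j \in K])) /=.
  apply: eq_big => [I|I _].
    rewrite !finset.subsetT /= (_ : [forall _, _]) /=.
      by apply/eqP/setP => j; rewrite finset.inE rshift_low_union.
    by apply/forallP => i; exact: lshift_low_union.
  rewrite inversions_low_union ffunE; congr (_ * _).
  rewrite (_ : [forall i, _]) ?mul1r; last by apply/forallP => i;
    rewrite finset.in_setD lshift_low_union.
  by congr (wedge_rows v _); apply/setP => j; rewrite finset.in_set !finset.in_setD
    !finset.in_setT rshift_low_union.
move=> K /andP[_ /forallP lK]; apply/setP => x.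
by case: (split_ordP x) => i ->; rewrite ?lshift_low_union ?lK // rshift_low_union finset.in_set.
Qed.
End EmbedLow.
Lemma sorted_enum_ord N (K : {set 'I_N}) : sorted (fun i j : 'I_N => (i < j)%N) (enum K).
Proof.
rewrite /enum_mem sorted_filter //; first by move=> j i k; exact: ltn_trans.
by rewrite -enumT; have := iota_ltn_sorted 0 N; rewrite -val_enum_ord sorted_map.
Qed.

Lemma nth_enum_ord_ltn N (K : {set 'I_N}) (x0 : 'I_N) i j :
  (i < j)%N -> (j < #|K|)%N -> (nth x0 (enum K) i < nth x0 (enum K) j)%N.
Proof.
move=> ij jK; apply: (sorted_ltn_nth _ x0 (sorted_enum_ord K)) => //.
- by move=> ? ? ?; exact: ltn_trans.
- by rewrite inE -cardE (ltn_trans ij).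
- by rewrite inE -cardE.
Qed.

Lemma increasing_enumeration N k (K : {set 'I_N}) : #|K| = k ->
  exists2 f : 'I_k -> 'I_N, {homo f : i j / (i < j)%N} & f @: [set: 'I_k] = K.
Proof.
move=> e; subst k; exists enum_val => [i j ij|].
  by have := nth_enum_ord_ltn (enum_val i) ij (ltn_ord j); rewrite -!enum_val_nth.
apply/setP => x; apply/imsetP/idP => [[i _ ->]|xK]; first exact: enum_valP.
by exists (enum_rank_in xK x); rewrite ?inE // enum_rankK_in.
Qed.

Definition select_rows (A : comNzRingType) N k (f : 'I_k -> 'I_N) : 'M[A]_(k, N) :=
  \matrix_(i, j) (j == f i)%:R.

Lemma wedge_select_rows (A : comNzRingType) N k (f : 'I_k -> 'I_N) (K : {set 'I_N}) :
  {homo f : i j / (i < j)%N} ->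
  wedge_rows (select_rows A f) K = (K == f @: [set: 'I_k])%:R.
Proof.
move=> fI; have [->|nK] := eqVneq.
  rewrite wedge_rows_minor // (_ : colsub _ _ = 1%:M) ?det1 //.
  apply/matrixP => i j; rewrite !mxE; congr (nat_of_bool _)%:R.
  have fi : injective f.
    by move=> a b ab; case: (ltngtP a b) => [/fI|/fI|/val_inj //]; rewrite ab ltnn.
  by rewrite (inj_eq fi) eq_sym.
have fi : injective f.
  by move=> a b ab; case: (ltngtP a b) => [/fI|/fI|/val_inj //]; rewrite ab ltnn.
have [/increasing_enumeration[g gI gK]|/eqP/wedge_rows_homogeneous //] := pselect (#|K| = k).
have /fintype.subsetPn[x] : ~~ (K \subset f @: [set: 'I_k]).
  apply: contra nK => s; rewrite finset.eqEcard s card_imset // -gK card_imset ?leqnn //.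
  by move=> a b ab; case: (ltngtP a b) => [/gI|/gI|/val_inj //]; rewrite ab ltnn.
rewrite -gK => /imsetP[j _ ->] nf; rewrite wedge_rows_minor // (expand_det_col _ j) big1 // => i
  _.
rewrite !mxE (_ : _ == _ = false) ?mul0r //; apply: contraNF nf => /eqP ->.
by rewrite imset_f ?inE.
Qed.

(** Pairing with a product of basis vectors extracts one coordinate up to sign, so an element of the
    exterior algebra can be recovered from the functional that it defines through the volume
    form. *)
Lemma ext_top_wedge_select_rows (A : comNzRingType) N k (a : ext A N) (f : 'I_k -> 'I_N) :
  {homo f : i j / (i < j)%N} -> let K := f @: [set: 'I_k] in
  ext_top (wedge a (wedge_rows (select_rows A f))) = (-1) ^+ inversions (~: K) K * a (~: K).
Proof.
move=> fI K; rewrite /ext_top ffunE (bigD1 (~: K)) ?finset.subsetT //= big1 ?addr0.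
  rewrite (_ : _ :\: _ = K) ?wedge_select_rows ?eqxx ?mulr1 //.
  by apply/setP => x; rewrite !finset.in_setD !finset.in_setT !finset.in_setC negbK andbT.
move=> I /andP[_ nI]; rewrite wedge_select_rows // (_ : _ == _ = false) ?mulr0 //.
apply: contraNF nI => /eqP E; apply/eqP/setP => x; move/setP/(_ x): E.
by rewrite !finset.in_setD !finset.in_setT finset.in_setC andbT => <-; rewrite negbK.
Qed.

(** [alpha_columns I] enumerates [low_union p I] increasingly when I has n elements; for other I the
    coordinate vanishes for reasons of degree. *)
Lemma wedge_rows_alpha_columns (A : comNzRingType) n p (M : 'M[A]_(p + n, p + (n + n)))
    (I : {set 'I_(n + n)}) :
  wedge_rows M (low_union p I) =
  if #|I| == n then \det (colsub (alpha_columns I) M) else 0.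
Proof.
case: eqP => [cI|nI]; last first.
  by apply: wedge_rows_homogeneous; rewrite card_low_union eqn_add2l; apply/eqP.
have cI' (i : 'I_n) : (i < #|I|)%N by rewrite cI.
rewrite -wedge_rows_minor => [|i j]; last first.
  rewrite /alpha_columns; case: (splitP i) => i' ->; case: (splitP j) => j' -> //=.
  - by move=> _; rewrite (leq_trans (ltn_ord i')) // leq_addr.
  - by rewrite ltnNge leq_eqVlt ltn_addr ?orbT.
  rewrite !ltn_add2l => ij.
  by rewrite (set_nth_default (lshift n i')) -?cardE // nth_enum_ord_ltn.
congr (wedge_rows M _); apply/setP => x; case: (split_ordP x) => i ->.
  rewrite lshift_low_union; apply/esym/imsetP; exists (lshift n i); rewrite ?inE //.
  by rewrite /alpha_columns (unsplitK (inl i)).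
rewrite rshift_low_union; apply/idP/imsetP => [iI|[k _]].
  have lt : (index i (enum I) < n)%N by rewrite -[X in (_ < X)%N]cI cardE index_mem mem_enum.
  exists (rshift p (Ordinal lt)); rewrite ?inE // /alpha_columns (unsplitK (inr (Ordinal lt))).
  by rewrite nth_index ?mem_enum.
rewrite /alpha_columns; case: (split_ordP k) => j _ /eqP; first by rewrite eq_rlshift.
by rewrite (inj_eq (@rshift_inj _ _)) => /eqP ->; rewrite -mem_enum mem_nth // -cardE.
Qed.

(** * Presentations of a module *)

Section TopDeterminants.
Variable A : comNzRingType.

(** The factor is the determinant of J. Sizes are related by a propositional equality so that sums
    such as n + q' + (n + q) and n + q + (n + q') can be exchanged without casts in the
    statement. *)
Lemma ext_top_mulmxr N N' (J : 'M[A]_(N, N')) : N = N' ->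
  exists d, forall k (M : 'M[A]_(k, N)), k = N ->
    ext_top (wedge_rows (M *m J)) = d * ext_top (wedge_rows M).
Proof.
move=> e; subst N'; exists (\det J) => k M e; subst k.
by rewrite !(ext_top_wedge_rows _ (erefl N)) !castmx_id det_mulmx mulrC.
Qed.

Lemma ext_top_mulmxl N n Q Q' (U : 'M[A]_(Q', Q)) : (Q + n)%N = N -> Q = Q' ->
  exists d, forall (M : 'M[A]_(Q, N)) (Z : 'M[A]_(n, N)),
    ext_top (wedge (wedge_rows (U *m M)) (wedge_rows Z)) =
    d * ext_top (wedge (wedge_rows M) (wedge_rows Z)).
Proof.
move=> e e'; subst Q' N; exists (\det U) => M Z.
rewrite !wedge_rows_col_mx !(ext_top_wedge_rows _ (erefl (Q + n)%N)) !castmx_id.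
have -> : col_mx (U *m M) Z = block_mx U 0 0 1%:M *m col_mx M Z.
  by rewrite mul_block_col !mul0mx mul1mx addr0 add0r.
by rewrite det_mulmx det_ublock det1 mulr1.
Qed.

(** Row operations: the Alexander function does not change when the lifts are modified by
    relations. *)
Lemma ext_top_addmx N n Q (M : 'M[A]_(Q, N)) (Z : 'M[A]_(n, N)) (X : 'M[A]_(n, Q)) :
  (Q + n)%N = N ->
  ext_top (wedge (wedge_rows M) (wedge_rows (Z + X *m M))) =
  ext_top (wedge (wedge_rows M) (wedge_rows Z)).
Proof.
move=> e; subst N.
rewrite !wedge_rows_col_mx !(ext_top_wedge_rows _ (erefl (Q + n)%N)) !castmx_id.
have -> : col_mx M (Z + X *m M) = block_mx 1%:M 0 X 1%:M *m col_mx M Z.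
  by rewrite mul_block_col !mul0mx !mul1mx addr0 addrC.
by rewrite det_mulmx det_lblock !det1 !mul1r.
Qed.

Lemma ext_top_block a b k (X : 'M[A]_(k, b)) (M : 'M[A]_(a, b)) : a = b ->
  ext_top (wedge_rows (block_mx 1%:M X 0 M)) = ext_top (wedge_rows M).
Proof.
move=> e; subst a.
rewrite (ext_top_wedge_rows _ (erefl (k + b)%N)) (ext_top_wedge_rows _ (erefl b)) !castmx_id.
by rewrite det_ublock det1 mul1r.
Qed.

(** Adjoining generators together with relations expressing them through the old ones preserves the
    Alexander function, because the new matrix is block triangular with an identity block. *)
Lemma ext_top_stabilize k k' q n (S : 'M[A]_(k', k)) (r : 'M[A]_(q, k)) (u : 'M[A]_(n, k)) :
  (q + n)%N = k ->
  ext_top (wedge (wedge_rows (col_mx (row_mx 1%:M (- S)) (row_mx 0 r)))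
                 (wedge_rows (row_mx (0 : 'M[A]_(n, k')) u))) =
  ext_top (wedge (wedge_rows r) (wedge_rows u)).
Proof.
move=> e; rewrite -wedge_rows_col_mx -wedgeA !wedge_rows_col_mx.
have -> : col_mx (row_mx 0 r) (row_mx (0 : 'M[A]_(n, k')) u) = row_mx 0 (col_mx r u).
  by rewrite -block_mxEv block_mxEh col_mx0.
by rewrite -block_mxEv ext_top_block.
Qed.

End TopDeterminants.

Section ComparePresentations.
Variables (A : comNzRingType) (V : lmodType A).

Definition lincomb k (c : 'I_k -> V) (v : 'rV[A]_k) : V := \sum_i v 0 i *: c i.

Lemma lincombD k (c : 'I_k -> V) v w : lincomb c (v + w) = lincomb c v + lincomb c w.
Proof. by rewrite -big_split; apply: eq_bigr => i _; rewrite mxE scalerDl. Qed.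

Lemma lincombZ k (c : 'I_k -> V) a v : lincomb c (a *: v) = a *: lincomb c v.
Proof. by rewrite scaler_sumr; apply: eq_bigr => i _; rewrite mxE scalerA. Qed.

Lemma lincombN k (c : 'I_k -> V) v : lincomb c (- v) = - lincomb c v.
Proof. by rewrite -(scaleN1r v) lincombZ scaleN1r. Qed.

Lemma lincombB k (c : 'I_k -> V) v w : lincomb c (v - w) = lincomb c v - lincomb c w.
Proof. by rewrite lincombD lincombN. Qed.

Lemma lincomb0 k (c : 'I_k -> V) : lincomb c 0 = 0.
Proof. by rewrite -(scale0r (0 : 'rV[A]_k)) lincombZ scale0r. Qed.

Lemma lincomb_delta k (c : 'I_k -> V) i : lincomb c (delta_mx 0 i) = c i.
Proof.
rewrite /lincomb (bigD1 i) //= mxE !eqxx scale1r big1 ?addr0 // => j /negPf ji.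
by rewrite mxE ji andbF scale0r.
Qed.

Lemma lincomb_mulmx k l (c : 'I_l -> V) (v : 'rV[A]_k) (M : 'M[A]_(k, l)) :
  lincomb c (v *m M) = \sum_i v 0 i *: lincomb c (row i M).
Proof.
rewrite /lincomb; under eq_bigr do rewrite mxE scaler_suml.
rewrite exchange_big; apply: eq_bigr => i _ /=; rewrite scaler_sumr.
by apply: eq_bigr => j _; rewrite mxE scalerA.
Qed.

Definition is_submodule (B : set V) : Prop :=
  [/\ B 0, forall x y, B x -> B y -> B (x + y) & forall a x, B x -> B (a *: x)].

Section Submodule.
Variable B : set V.
Hypothesis sB : is_submodule B.

Lemma submod0 : B 0. Proof. by case: sB. Qed.
Lemma submodD x y : B x -> B y -> B (x + y). Proof. by case: sB => _ h _; exact: h. Qed.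
Lemma submodZ a x : B x -> B (a *: x). Proof. by case: sB => _ _; exact. Qed.
Lemma submodN x : B x -> B (- x). Proof. by rewrite -scaleN1r; exact: submodZ. Qed.
Lemma submodB x y : B x -> B y -> B (x - y).
Proof. by move=> Bx /submodN; exact: submodD. Qed.
Lemma submod_sum (I : Type) (s : seq I) (F : I -> V) :
  (forall i, B (F i)) -> B (\sum_(i <- s) F i).
Proof. by move=> BF; elim/big_ind: _ => [|x y|]; [exact: submod0|exact: submodD|]. Qed.
Lemma submod_sym x y : B (x - y) -> B (y - x).
Proof. by move/submodN; rewrite opprB. Qed.
Lemma submod_trans y x z : B (x - y) -> B (y - z) -> B (x - z).
Proof. by move=> Bx /(submodD Bx); rewrite addrA subrK. Qed.
Lemma submod_congr x y x' y' : B (x - x') -> B (y - y') -> B (x + y - (x' + y')).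
Proof. by move=> Bx /(submodD Bx); rewrite addrACA opprD. Qed.

Lemma lincomb_congr k (c c' : 'I_k -> V) v :
  (forall i, B (c i - c' i)) -> B (lincomb c v - lincomb c' v).
Proof.
move=> h; rewrite /lincomb -sumrB; apply: submod_sum => i.
by rewrite -scalerBr; apply: submodZ.
Qed.
End Submodule.

Variables (Z B : set V).
Hypothesis sB : is_submodule B.

(** A Tietze move: once the redundant generators c' are adjoined, the relations c' = S c eliminate
    them from any relation, and what remains is a relation among the c i. *)
Lemma presents_relation k q (c : 'I_k -> V) (r : 'M[A]_(q, k)) k' (c' : 'I_k' -> V)
    (S : 'M[A]_(k', k)) m (M : 'M[A]_(m, k' + k)) :
  presents Z B c r -> (forall i, B (c' i - lincomb c (row i S))) ->
  (forall i, B (lincomb c' (row i (lsubmx M)) + lincomb c (row i (rsubmx M)))) ->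
  exists Y, M = Y *m col_mx (row_mx 1%:M (- S)) (row_mx 0 r).
Proof.
move=> [_ _ rel] cS relM.
have /boolp.choice[Y MY] i : exists y : 'rV_q, row i (lsubmx M) *m S + row i (rsubmx M) = y *m r.
  apply/rel; rewrite -/(lincomb c _) lincombD.
  rewrite -[X in B X](subrK (lincomb c' (row i (lsubmx M)) + lincomb c (row i (rsubmx M)))).
  apply: (submodD sB) => //; rewrite opprD addrACA subrr addr0 lincomb_mulmx.
  exact: (submod_sym sB) (lincomb_congr sB _ cS).
exists (row_mx (lsubmx M) (\matrix_i Y i)).
rewrite mul_row_col !mul_mx_row mulmx1 mulmx0 add_row_mx addr0 -[LHS]hsubmxK; congr row_mx.
apply/row_matrixP => i; rewrite linearD /= [X in _ + X]row_mul rowK -MY mulmxN linearN /= row_mul.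
by rewrite addrA addNr add0r.
Qed.

(** Both presentations are enlarged to the union of the generators. Their relation matrices then
    have equally many rows, so each is a square multiple of the other, and the determinant of the
    multiplier compares the Alexander functions. One application gives divisibility in one
    direction. *)
Lemma presents_compare n q q' (c : 'I_(n + q) -> V) (r : 'M[A]_(q, n + q))
    (c' : 'I_(n + q') -> V) (r' : 'M[A]_(q', n + q')) :
  presents Z B c r -> presents Z B c' r' ->
  exists d, forall (u : 'M[A]_(n, n + q)) (u' : 'M[A]_(n, n + q')),
    (forall i, B (lincomb c (row i u) - lincomb c' (row i u'))) ->
    ext_top (wedge (wedge_rows r') (wedge_rows u')) =
    d * ext_top (wedge (wedge_rows r) (wedge_rows u)).
Proof.
move=> pc pc'; have [Zc gen rel] := pc; have [Zc' gen' rel'] := pc'.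
have /boolp.choice[S0 cS0] i : exists v, B (c' i - lincomb c v) by exact: gen (Zc' i).
have /boolp.choice[T0 cT0] i : exists v, B (c i - lincomb c' v) by exact: gen' (Zc i).
pose S := \matrix_i S0 i; pose T := \matrix_i T0 i.
have cS i : B (c' i - lincomb c (row i S)) by rewrite rowK.
pose P := col_mx (row_mx 1%:M (- S)) (row_mx 0 r).
pose P' := col_mx (row_mx (- T) 1%:M) (row_mx r' 0).
have [U P'U] : exists U, P' = U *m P.
  apply: (presents_relation pc cS) => i; rewrite /P' -block_mxEv block_mxEh row_mxKl row_mxKr.
  case: (split_ordP i) => j ->.
    rewrite !rowKu linearN /= rowK lincombN row1 lincomb_delta addrC; exact: cT0.
  rewrite !rowKd row0 lincomb0 addr0.
  by apply/rel'; exists (delta_mx 0 j); rewrite -rowE.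
(* [J] exchanges the two blocks of generators, bringing [P'] to the shape of [ext_top_stabilize]. *)
pose J : 'M[A]_(n + q' + (n + q), n + q + (n + q')) := block_mx 0 1%:M 1%:M 0.
have [d1 dJ] := ext_top_mulmxr J (addnC _ _).
have [d2 dU] : exists d, forall (M : 'M[A]_(n + q' + q, n + q' + (n + q))) (Z : 'M[A]_(n,
  n + q' + (n + q))),
    ext_top (wedge (wedge_rows (U *m M)) (wedge_rows Z)) =
    d * ext_top (wedge (wedge_rows M) (wedge_rows Z)).
  by apply: ext_top_mulmxl; lia.
exists (d1 * d2) => u u' uu'.
rewrite -(ext_top_stabilize T r' u') 1?addnC // -(ext_top_stabilize S r u) 1?addnC //.
have -> : col_mx (row_mx 1%:M (- T)) (row_mx 0 r') = P' *m J.
  rewrite /P' /J mul_col_mx !mul_row_block !mulmx0 !mulmx1 !add0r !addr0.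
  by [].
have -> : row_mx 0 u' = row_mx u' 0 *m J.
  by rewrite mul_row_block !mulmx0 !mulmx1 !add0r !addr0.
rewrite wedge_rows_col_mx -mul_col_mx dJ; last lia.
rewrite -wedge_rows_col_mx P'U dU mulrA; congr (_ * _).
(* The rows of u and u' represent the same elements, so the two lifts differ by combinations of the
   relations. *)
have [X EX] : exists X, row_mx u' 0 - row_mx 0 u = X *m P.
  apply: (presents_relation pc cS) => i.
  rewrite opp_row_mx add_row_mx subr0 sub0r row_mxKl row_mxKr linearN /= lincombN.
  exact: (submod_sym sB).
rewrite -(ext_top_addmx P (row_mx 0 u) X); last lia.
by rewrite -EX addrC subrK.
Qed.
End ComparePresentations.

(** * Group rings of free abelian groups *)

Section OrderedGroupRing.
Variables (G : zmodType) (lt : rel G).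
Hypothesis lt_irr : irreflexive lt.
Hypothesis lt_trans : transitive lt.
Hypothesis lt_total : forall x y, x != y -> lt x y || lt y x.
Hypothesis ltD : forall z x y, lt x y -> lt (x + z) (y + z).
Local Notation FG := {freeg G / int}.

Lemma exists_max (s : seq G) : s != [::] ->
  exists2 g, g \in s & forall x, x \in s -> x != g -> lt x g.
Proof.
elim: s => // y s IH _; have [->|/IH[g gs gmax]] := eqVneq s [::].
  by exists y => [|x]; rewrite inE // => /eqP -> /eqP.
have [lyg|nyg] := boolP (lt y g); [exists g|exists y]; rewrite ?inE ?gs ?eqxx ?orbT // => x.
  by rewrite inE => /predU1P[->|/gmax].
rewrite inE => /predU1P[->/eqP //|xs xy].
have gy : g = y \/ lt g y.
  by have [->|/lt_total] := eqVneq g y; [left|rewrite (negPf nyg) orbF; right].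
have [xg|/(gmax _ xs)] := eqVneq x g; first by case: gy => [gy|]; move: xy; rewrite xg // gy eqxx.
by move=> lxg; case: gy => [<- //|]; exact: lt_trans.
Qed.

Lemma coeff_mul (a b : FG) x : coeff x (group_ring_mul a b) =
  \sum_(z <- dom a) \sum_(w <- dom b) coeff z a * coeff w b * (z + w == x)%:R.
Proof.
have mulDl (c : FG) : {morph (@group_ring_mul G)^~ c : u v / u + v}.
  by move=> *; exact: group_ring_mulDl.
have mul0l (c : FG) : group_ring_mul 0 c = 0.
  by apply: (addrI (group_ring_mul 0 c)); rewrite -mulDl !addr0.
rewrite -[a in LHS]freeg_sumE (big_morph _ (mulDl b) (mul0l b)) raddf_sum.
apply: eq_bigr => z _ /=; rewrite group_ring_mulC.
rewrite -[b in LHS]freeg_sumE (big_morph _ (mulDl _) (mul0l _)) raddf_sum.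
apply: eq_bigr => w _ /=; rewrite !(freegU_scale (coeff _ _)).
rewrite group_ring_mulZl group_ring_mulZr group_ring_mulUU scalerA -freegU_scale coeffU.
by rewrite [coeff w b * _]mulrC addrC.
Qed.

(** The product of the two leading terms cannot cancel: every other pair of terms has a sum strictly
    below ga + gb. *)
Lemma ordered_group_ring_integral (a b : group_ring G) : a * b = 0 -> a = 0 \/ b = 0.
Proof.
move=> ab0; have [->|a0] := eqVneq a 0; first by left.
have [->|b0] := eqVneq b 0; [by right|exfalso].
have [ga gaa gam] : exists2 g, g \in dom (a : FG) & forall x, x \in dom (a : FG) -> x != g ->
  lt x g.
  by apply: exists_max; rewrite dom_eq0.
have [gb gbb gbm] : exists2 g, g \in dom (b : FG) & forall x, x \in dom (b : FG) -> x != g ->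
  lt x g.
  by apply: exists_max; rewrite dom_eq0.
have : coeff (ga + gb) (group_ring_mul (a : FG) b) = 0 by rewrite [group_ring_mul a b]ab0 coeff0.
rewrite coeff_mul (bigD1_seq ga) ?uniq_dom //= (bigD1_seq gb) ?uniq_dom //= eqxx mulr1.
rewrite big1_seq ?addr0 => [|w /andP[wgb wb]]; last first.
  by rewrite (inj_eq (addrI ga)) (negPf wgb) mulr0.
rewrite big1_seq ?addr0 => [/eqP|z /andP[zga za]]; last first.
  rewrite big1_seq // => w /andP[_ wb]; rewrite (_ : _ == _ = false) ?mulr0 //.
  apply/negP => /eqP E; have l1 : lt (z + w) (ga + w) by apply/ltD/gam.
  have [wgb|wgb] := eqVneq w gb; first by rewrite E wgb lt_irr in l1.
  have l2 : lt (ga + w) (ga + gb) by rewrite ![ga + _]addrC; apply/ltD/gbm.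
  by have := lt_trans l1 l2; rewrite E lt_irr.
by rewrite mulf_eq0; move: gaa gbb; rewrite !mem_dom => /negPf-> /negPf->.
Qed.
End OrderedGroupRing.
(** The lexicographic order on the coordinates in a basis is a total order on G invariant under
    translation. *)
Lemma free_abelian_group_ring_integral mu (G : zmodType) : free_abelian_of_rank mu G ->
  forall a b : group_ring G, a * b = 0 -> a = 0 \/ b = 0.
Proof.
move=> [b bP]; have /boolp.choice[k kP] g : exists k : {ffun 'I_mu -> int}, g = \sum_i b i *~ k i.
  by have [k []] := bP g; exists k.
have kuniq g (l : {ffun 'I_mu -> int}) : g = \sum_i b i *~ l i -> k g = l.
  by have [l0 [_ ul0]] := bP g; move=> /ul0 <-; rewrite (ul0 _ (kP g)).
have kD x y i : k (x + y) i = k x i + k y i.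
  rewrite (kuniq _ [ffun i => k x i + k y i]) ?ffunE // {1}(kP x) {1}(kP y) -big_split.
  by apply: eq_bigr => l _; rewrite ffunE mulrzDr.
pose lt : rel G := fun x y => [exists i : 'I_mu,
  [forall j : 'I_mu, (j < i)%N ==> (k x j == k y j)] && (k x i < k y i)].
have ltP x y : reflect (exists2 i : 'I_mu, forall j : 'I_mu, (j < i)%N -> k x j = k y j &
    k x i < k y i) (lt x y).
  apply: (iffP existsP) => [[i /andP[/forallP h l]]|[i h l]]; exists i => //.
    by move=> j ji; apply/eqP; move/implyP: (h j); apply.
  by rewrite l andbT; apply/forallP => j; apply/implyP => /h ->.
apply: (@ordered_group_ring_integral G lt).
- by move=> x; apply/ltP => -[i _]; rewrite ltxx.
- move=> y x z /ltP[i hi li] /ltP[j hj lj]; apply/ltP.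
  case: (ltngtP i j) => ij.
  + exists i => [l la|]; last by rewrite -(hj i ij).
    by rewrite (hi l la) (hj l (ltn_trans la ij)).
  + exists j => [l la|]; last by rewrite (hi j ij).
    by rewrite (hi l (ltn_trans la ij)) (hj l la).
  move/val_inj: ij => ij; subst j; exists i => [l la|]; last exact: lt_trans li lj.
  by rewrite (hi l la) (hj l la).
- move=> x y xy.
  have [i0 ni0] : exists i, k x i != k y i.
    apply/existsP; apply: contraNT xy => /existsPn h; rewrite (kP x) (kP y).
    by apply/eqP/eq_bigr => i _; have /negPn/eqP -> := h i.
  have [i ni imin] := @arg_minnP _ i0 (fun i => k x i != k y i) (fun i :
    'I_mu => nat_of_ord i) ni0.
  have h (j : 'I_mu) : (j < i)%N -> k x j = k y j.
    by move=> ji; apply/eqP; apply: contraTT ji => /imin; rewrite -leqNgt.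
  by apply/orP; case: (ltgtP (k x i) (k y i)) ni => // l _; [left|right]; apply/ltP;
    exists i => // j /h.
by move=> z x y /ltP[i hi li]; apply/ltP; exists i => [j /hi|]; rewrite !kD ?ltrD2r // => ->.
Qed.

(** * Minors of a presentation matrix *)

Section AlexanderElement.
Variables (A : comNzRingType) (V : lmodType A) (Z B : set V).
Hypotheses (sZ : is_submodule Z) (sB : is_submodule B).
Hypothesis integral : forall a b : A, a * b = 0 -> a = 0 \/ b = 0.

Lemma ext_top_wedge_scale N (u : A) (a b : ext A N) :
  ext_top (wedge (ext_scale u a) b) = u * ext_top (wedge a b).
Proof.
rewrite /ext_top !ffunE mulr_sumr; apply: eq_bigr => I _; rewrite ffunE.
by rewrite !mulrA (mulrC _ u).
Qed.

Lemma presents_cast k k' q (e : k = k') (c : 'I_k -> V) (r : 'M[A]_(q, k)) :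
  presents Z B c r -> presents Z B (c \o cast_ord (esym e)) (castmx (erefl, e) r).
Proof.
subst k'; rewrite castmx_id (_ : c \o _ = c) //.
by apply/boolp.funext => i /=; rewrite cast_ord_id.
Qed.

Lemma lincomb_cast k k' m (e : k = k') (c : 'I_k -> V) (r : 'M[A]_(m, k)) i :
  lincomb (c \o cast_ord (esym e)) (row i (castmx (erefl, e) r)) = lincomb c (row i r).
Proof.
subst k'; rewrite castmx_id (_ : c \o _ = c) //.
by apply/boolp.funext => j /=; rewrite cast_ord_id.
Qed.

Lemma ext_top_cast k k' q m (e : k = k') (r : 'M[A]_(q, k)) (u : 'M[A]_(m, k)) :
  ext_top (wedge (wedge_rows (castmx (erefl, e) r)) (wedge_rows (castmx (erefl, e) u))) =
  ext_top (wedge (wedge_rows r) (wedge_rows u)).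
Proof. by subst k'; rewrite !castmx_id. Qed.

Lemma lincomb_submodule k (c : 'I_k -> V) v : (forall i, Z (c i)) -> Z (lincomb c v).
Proof. by move=> Zc; apply: (submod_sum sZ) => i; exact: submodZ. Qed.

Variables (n p : nat) (c : 'I_(p + (n + n)) -> V) (M : 'M[A]_(p + n, p + (n + n))).
Hypothesis pM : presents Z B c M.

(** This is [alpha] with an arbitrary matrix in place of [alpha_matrix]. *)
Definition minors : ext A (n + n) :=
  [ffun I : {set 'I_(n + n)} => if #|I| == n then \det (colsub (alpha_columns I) M) else 0].

Lemma minors_wedge m (v : 'M[A]_(m, n + n)) :
  ext_top (wedge (wedge_rows M) (wedge_rows (row_mx 0 v))) =
    ext_top (wedge minors (wedge_rows v)).
Proof.
rewrite ext_top_wedge_row_mx0; congr (ext_top (wedge _ _)).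
by apply/ffunP => I; rewrite !ffunE wedge_rows_alpha_columns.
Qed.

(** The generators are renumbered so that their number has the form n + q, with q = p + n relations,
    as [presents_compare] requires. *)
Let e : (p + (n + n) = n + (p + n))%N. Proof. by rewrite addnCA. Qed.
Let c1 : 'I_(n + (p + n)) -> V := c \o cast_ord (esym e).
Let M1 : 'M[A]_(p + n, n + (p + n)) := castmx (erefl, e) M.
Let lift1 m (v : 'M[A]_(m, n + n)) : 'M[A]_(m, n + (p + n)) := castmx (erefl, e) (row_mx 0 v).
Let pM1 : presents Z B c1 M1. Proof. exact: presents_cast. Qed.
Let top1 m (v : 'M[A]_(m, n + n)) :
  ext_top (wedge (wedge_rows M1) (wedge_rows (lift1 v))) = ext_top (wedge minors (wedge_rows v)).
Proof. by rewrite ext_top_cast minors_wedge. Qed.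

(** Comparing the presentation with itself shows that the values at ut and at the standard lift
    [0 v] are both d times the value at [0 v]. *)
Lemma alexander_minors (ut : 'M[A]_(n, n + (p + n))) v :
  (forall i, B (lincomb c (row_mx 0 (row i v)) - lincomb c1 (row i ut))) ->
  ext_top (wedge (wedge_rows M1) (wedge_rows ut)) = ext_top (wedge minors (wedge_rows v)).
Proof.
move=> h; have [d dP] := presents_compare sB pM1 pM1.
rewrite -top1 (dP (lift1 v) ut) => [|i]; last by rewrite lincomb_cast row_row_mx row0.
by rewrite -(dP (lift1 v) (lift1 v)) // => i; rewrite subrr; exact: (submod0 sB).
Qed.

(** Write m for the minors. Comparison in both directions gives $\nu a_I = d\,m_I$ and $m_I = d'\nu
    a_I$ for all I of size n. If some $m_I$ is nonzero it cancels and $dd'=1$; otherwise a = 0.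
    Conversely, a unit multiple of m is represented through M itself, with the volume form scaled by
    the inverse unit. *)
Lemma alexander_element (a : ext A (n + n)) :
  (ext_homogeneous n a /\
   exists (q : nat) (gens : 'I_(n + q) -> V) (r : 'M[A]_(q, n + q)) (nu : A),
     [/\ presents Z B gens r, is_unit_elt nu
       & forall (v : 'M[A]_(n, n + n)) (ut : 'M[A]_(n, n + q)),
           (forall i, B (lincomb c (row_mx 0 (row i v)) - lincomb gens (row i ut))) ->
           ext_top (wedge (wedge_rows r) (wedge_rows ut)) =
             nu * ext_top (wedge a (wedge_rows v))]) <->
  exists2 u, is_unit_elt u & a = ext_scale u minors.
Proof.
split=> [[ha [q [gens [r [nu [pr [w nuw] hA]]]]]]|[u [w uw] ->]]; last first.
  split=> [K nK|]; first by rewrite !ffunE (negPf nK) mulr0.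
  exists (p + n)%N, c1, M1, w; split=> // [|v ut h]; first by exists u; rewrite mulrC.
  by rewrite ext_top_wedge_scale mulrA [w * u]mulrC uw mul1r (alexander_minors h).
have [d dP] := presents_compare sB pM1 pr; have [d' dP'] := presents_compare sB pr pM1.
have key (v : 'M[A]_(n, n + n)) : nu * ext_top (wedge a (wedge_rows v)) =
  d * ext_top (wedge minors (wedge_rows v)) /\
    ext_top (wedge minors (wedge_rows v)) = d' * (nu * ext_top (wedge a (wedge_rows v))).
  have [Zc _ _] := pM; have [_ gen _] := pr.
  have /boolp.choice[ut0 utP] (i : 'I_n) : exists u,
    B (lincomb c (row_mx 0 (row i v)) - lincomb gens u).
    by apply: gen; exact: lincomb_submodule.
  pose ut := \matrix_i ut0 i.
  have h i : B (lincomb c (row_mx 0 (row i v)) - lincomb gens (row i ut)) by rewrite rowK.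
  have h1 i : B (lincomb c1 (row i (lift1 v)) - lincomb gens (row i ut)).
    by rewrite lincomb_cast row_row_mx row0.
  rewrite -(hA v ut h) -top1; split; first exact: dP.
  by apply: dP' => i; apply: (submod_sym sB).
(* Taking for v the basis vectors outside I isolates the coordinate at I. *)
have coord (I : {set 'I_(n + n)}) : #|I| = n -> nu * a I = d * minors I /\ minors I =
  d' * (nu * a I).
  move=> cI; have [|f fI fK] := @increasing_enumeration _ n (~: I).
    by rewrite cardsCs finset.setCK card_ord cI addnK.
  have [] := key (select_rows A f); rewrite !ext_top_wedge_select_rows // fK finset.setCK.
  set s := (-1) ^+ _; have sK x y : s * x = s * y -> x = y.
    by move/(congr1 (fun z => s * z)); rewrite !mulrA -expr2 sqrr_sign !mul1r.
  by rewrite !(mulrCA _ s) => /sK h1 /sK h2.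
have aE u : (forall I : {set 'I_(n + n)}, #|I| = n -> a I = u * minors I) -> a =
  ext_scale u minors.
  move=> h; apply/ffunP => I; rewrite [RHS]ffunE; have [cI|nI] := eqVneq #|I| n; first exact: h.
  by rewrite (ha I nI) ffunE (negPf nI) mulr0.
have [[I [cI mI]]|nI] := boolp.pselect (exists I : {set 'I_(n + n)}, #|I| = n /\ minors I <> 0).
  exists (w * d); last first.
    by apply: aE => J /coord[h _]; rewrite -mulrA -h mulrA [w * nu]mulrC nuw mul1r.
  exists (d' * nu); have [h1 h2] := coord I cI.
  have : minors I * (1 - w * d * (d' * nu)) = 0.
    rewrite mulrBr mulr1 [X in X - _]h2 h1.
    apply/eqP; rewrite subr_eq0; apply/eqP.
    have -> : minors I * (w * d * (d' * nu)) = d' * (d * minors I) * (nu * w) by ring.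
    by rewrite nuw mulr1.
  by case/integral => // /eqP; rewrite subr_eq0 => /eqP.
exists 1; first by exists 1; rewrite mul1r.
apply: aE => I cI; have mI : minors I = 0 by apply: boolp.contrapT => h; apply: nI; exists I.
rewrite mI mulr0; have [h _] := coord I cI; move: h; rewrite mI mulr0 => h.
by rewrite -[a I]mul1r -nuw mulrAC h mul0r.
Qed.

End AlexanderElement.

(** * Arcs and Fox derivatives *)

Section ForgetSubdivision.
Variables (R : realType) (n m : nat) (d : diagram R n m) (sub : component n m -> seq R).
Hypotheses (hd : is_welded_tangle d) (hsub : is_subdivision d sub).
Local Notation cmp := (component n m).
Implicit Types c : cmp.

Definition under_times c : seq R :=
  [seq (under k).2 | k <- enum 'I_(nclassical d) & (under k).1 == c].

(** Two crossings sharing an under point lie at the same place of the disk, so they are equal by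
    [wt_simple]. *)
Lemma under_times_uniq c : uniq (under_times c).
Proof.
rewrite map_inj_in_uniq => [|k k']; first exact/filter_uniq/enum_uniq.
rewrite !mem_filter => /andP[/eqP kc _] /andP[/eqP k'c _] kk'.
have E : under k = under k' by rewrite [LHS]surjective_pairing [RHS]surjective_pairing kc k'c kk'.
have [_ _ _ Ek _] := wt_crossing hd (inl k); have [_ _ _ Ek' _] := wt_crossing hd (inl k').
by have [//] : inl k = inl k' :> 'I_(nclassical d) + 'I_(nvirtual d);
  apply: (wt_simple hd); rewrite Ek Ek' /= E.
Qed.

Lemma under_times_sub c t : t \in sub c -> t \notin under_times c.
Proof.
move=> /(hsub.2 c t)[_ _ nt]; apply/mapP => -[k]; rewrite mem_filter => /andP[/eqP kc _] E.
by have [_ []] := nt (inl k); rewrite /= E -kc -surjective_pairing.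
Qed.

Lemma perm_breaks c : perm_eq (breaks d sub c) (under_times c ++ sub c).
Proof. by rewrite /breaks perm_sort. Qed.

Lemma breaks_nosub c : perm_eq (breaks d nosub c) (under_times c).
Proof. by rewrite /breaks perm_sort cats0. Qed.

Lemma breaks_uniq c : uniq (breaks d sub c).
Proof.
rewrite (perm_uniq (perm_breaks c)) cat_uniq under_times_uniq (hsub.1 c) andbT /=.
by apply/hasPn => t /under_times_sub.
Qed.

Lemma breaks_sorted c : sorted <=%R (breaks d sub c).
Proof. exact: sort_le_sorted. Qed.

Lemma breaks_lt_sorted c : sorted <%R (breaks d sub c).
Proof. by rewrite lt_sorted_uniq_le breaks_uniq breaks_sorted. Qed.

(** The number of under-crossings among the first i break points is the index of the original arc
    that contains the subdivided arc i. *)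
Definition under_count c (i : nat) : nat :=
  count (mem (under_times c)) (take i (breaks d sub c)).

Lemma count_under_breaks c (P : pred R) :
  count (mem (under_times c)) [seq t <- breaks d sub c | P t] = count P (breaks d nosub c).
Proof.
rewrite count_filter (permP (perm_breaks c)) (permP (breaks_nosub c)) count_cat.
rewrite [X in (_ + X)%N](_ : _ = 0%N) ?addn0.
  by apply: eq_in_count => t ut /=; rewrite ut.
by apply/eqP; rewrite -leqn0 leqNgt -has_count; apply/hasPn => t /under_times_sub/= /negPf ->.
Qed.

Lemma under_count_lt c t : under_count c (count (< t) (breaks d sub c)) =
  count (< t) (breaks d nosub c).
Proof. by rewrite /under_count -sorted_filter_lt ?breaks_sorted // count_under_breaks. Qed.

Lemma under_count_le c t : under_count c (count (<= t) (breaks d sub c)) =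
  count (<= t) (breaks d nosub c).
Proof. by rewrite /under_count -sorted_filter_le ?breaks_sorted // count_under_breaks. Qed.

Lemma under_count_size c : under_count c (size (breaks d sub c)) = size (breaks d nosub c).
Proof. by rewrite /under_count take_size -[breaks d sub c]filter_predT count_under_breaks
  count_predT. Qed.

Lemma under_count_leq c i : (under_count c i <= size (breaks d nosub c))%N.
Proof. by rewrite -under_count_size /under_count take_size -[X in (_ <= count _
  X)%N](cat_take_drop i) count_cat leq_addr. Qed.

Lemma under_countS c i x0 : (i < size (breaks d sub c))%N ->
  under_count c i.+1 = (under_count c i + (nth x0 (breaks d sub c) i \in under_times c))%N.
Proof. by move=> lti; rewrite /under_count (take_nth x0) // -cats1 count_cat /= addn0. Qed.

Definition forget_arc (a : tarc d sub) : tarc d nosub :=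
  arc_of d nosub (tag a) (under_count (tag a) (tagged a)).

Lemma arc_of_ord s c (i : 'I_(last_arc d s c).+1) : arc_of d s c i = Tagged _ i.
Proof. by rewrite /arc_of modn_small // inord_val. Qed.

(** Arc numbers are cyclic on a closed component; in the absence of break points both sides are its
    single arc. *)
Lemma arc_of_size (s : cmp -> seq R) c : ~~ is_strand c ->
  arc_of d s c (size (breaks d s c)) = arc_of d s c 0.
Proof.
move=> /negPf ns; rewrite /arc_of (_ : _ %% _ = 0 %% (last_arc d s c).+1)%N // /last_arc ns.
by case: (size _) => [|k]; rewrite ?mod0n // modnn.
Qed.

Lemma forget_arc_of c i : (i <= size (breaks d sub c))%N ->
  forget_arc (arc_of d sub c i) = arc_of d nosub c (under_count c i).
Proof.
move=> lei; have [lti|] := ltnP i (last_arc d sub c).+1.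
  by rewrite -[i]/(nat_of_ord (Ordinal lti)) arc_of_ord.
rewrite /last_arc; case: ifP => [_|/negbT ns lt]; first by rewrite ltnNge lei.
have -> : i = size (breaks d sub c) by move: lt lei; case: (size _) => //=; lia.
rewrite arc_of_size // under_count_size arc_of_size //.
have -> : 0%N = @ord0 (last_arc d sub c) by [].
by rewrite arc_of_ord /forget_arc /= /under_count take0.
Qed.

Lemma forget_arc_in P : forget_arc (arc_in d sub P) = arc_in d nosub P.
Proof. by rewrite forget_arc_of ?count_size // under_count_lt. Qed.

Lemma forget_arc_out P : forget_arc (arc_out d sub P) = arc_out d nosub P.
Proof. by rewrite forget_arc_of ?count_size // under_count_le. Qed.

Lemma forget_arc_subdivision c s : s \in sub c ->
  forget_arc (arc_in d sub (c, s)) = forget_arc (arc_out d sub (c, s)).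
Proof.
move=> sc; rewrite forget_arc_in forget_arc_out /arc_in /arc_out; congr arc_of.
apply: eq_in_count => u; rewrite /= (perm_mem (breaks_nosub c)) => hu.
by rewrite le_eqVlt; case: eqP => // E; move: (under_times_sub sc); rewrite -E hu.
Qed.

Lemma forget_mark_arc j : forget_arc (mark_arc d sub j) = mark_arc d nosub j.
Proof.
rewrite /mark_arc; case: ifP => _; rewrite forget_arc_of //= ?under_count_size //.
by rewrite /under_count take0.
Qed.

Lemma last_arc_leq s c : (last_arc d s c <= size (breaks d s c))%N.
Proof. by rewrite /last_arc; case: ifP => // _; exact: leq_pred. Qed.

(** [under_count] starts at 0 and increases by at most one at each step, so it takes all
    intermediate values. *)
Lemma forget_arc_surj b : exists a, forget_arc a = b.
Proof.
case: b => c l.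
have IVT i k : (i <= size (breaks d sub c))%N -> (k <= under_count c i)%N ->
    exists2 j, (j <= i)%N & under_count c j = k.
  elim: i => [_|i IH lti].
    by rewrite {1}/under_count take0 leqn0 => /eqP ->; exists 0%N; rewrite // /under_count take0.
  rewrite (under_countS 0) //; have [/(IH (ltnW lti))[j ji jk] _|lt le] :=
    leqP k (under_count c i).
    by exists j; first exact: leqW.
  by exists i.+1; rewrite // (under_countS 0) //; move: lt le; case: (_ \in _); lia.
have [j jle jl] : exists2 j, (j <= size (breaks d sub c))%N & under_count c j = l.
  apply: (IVT _ _ (leqnn _)); rewrite under_count_size.
  exact: leq_trans (leq_ord l) (last_arc_leq _ _).
by exists (arc_of d sub c j); rewrite forget_arc_of // jl arc_of_ord.
Qed.

(* Two arcs of the subdivided diagram lying on one arc of the original diagram are *)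
(* linked by a chain of subdivision points.                                        *)
Lemma forget_arc_fiber (A : comNzRingType) (V : lmodType A) (B : set V) (e : tarc d sub -> V) :
  is_submodule B ->
  (forall c t, t \in sub c -> B (e (arc_in d sub (c, t)) - e (arc_out d sub (c, t)))) ->
  forall a b, forget_arc a = forget_arc b -> B (e a - e b).
Proof.
move=> sB he.
have step c i : (i < size (breaks d sub c))%N -> under_count c i.+1 = under_count c i ->
    B (e (arc_of d sub c i) - e (arc_of d sub c i.+1)).
  move=> lti; rewrite (under_countS 0) //; case tU: (_ \in under_times c) => E; first by lia.
  have : (breaks d sub c)`_i \in breaks d sub c by exact: mem_nth.
  rewrite (perm_mem (perm_breaks c)) mem_cat tU => /he.
  by rewrite /arc_in /arc_out /= count_lt_nth ?count_le_nth // breaks_lt_sorted.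
have mono c i j : (i <= j)%N -> (under_count c i <= under_count c j)%N.
  by move=> ij; rewrite /under_count -(subnKC ij) takeD count_cat leq_addr.
have run c i j : (i <= j)%N -> (j <= size (breaks d sub c))%N -> under_count c i =
  under_count c j ->
    B (e (arc_of d sub c i) - e (arc_of d sub c j)).
  move=> ij; rewrite -(subnKC ij); elim: (j - i)%N => [|k IH] le E.
    by rewrite addn0 subrr; exact: submod0.
  rewrite addnS in le E *.
  have E' : under_count c i = under_count c (i + k).
    by apply/eqP; rewrite eqn_leq mono ?leq_addr //= E mono.
  apply: (submod_trans sB) (IH (ltnW le) E') _; apply: step => //; by rewrite -E -E'.
have run2 c i j : (i <= size (breaks d sub c))%N -> (j <= size (breaks d sub c))%N ->
    under_count c i = under_count c j -> B (e (arc_of d sub c i) - e (arc_of d sub c j)).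
  move=> il jl E; case: (leqP i j) => [ij|/ltnW ji]; first exact: run.
  by apply: (submod_sym sB); apply: run.
have key c (i j : 'I_(last_arc d sub c).+1) :
    arc_of d nosub c (under_count c i) = arc_of d nosub c (under_count c j) ->
    B (e (Tagged _ i) - e (Tagged _ j)).
  have ltS (k : 'I_(last_arc d sub c).+1) : (k <= size (breaks d sub c))%N.
    exact: leq_trans (leq_ord k) (last_arc_leq _ _).
  wlog ij : i j / (under_count c i <= under_count c j)%N.
    move=> wl E; case: (leqP (under_count c i) (under_count c j)) => [|/ltnW] l; first exact: wl.
    by apply: (submod_sym sB); apply: wl.
  rewrite -!arc_of_ord => Eij.
  have E : (under_count c i = under_count c j %[mod (last_arc d nosub c).+1])%N.
    move/eqP: Eij; rewrite /arc_of eq_Tagged /= => /eqP /(congr1 val) /=.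
    by rewrite !inordK ?ltn_pmod.
  have [Ec|nE] := eqVneq (under_count c i) (under_count c j); first exact: run2.
  have lej := under_count_leq c j; have lj := ltS j; have li := ltS i.
  have [st|ns] := boolP (is_strand c).
    have L : last_arc d nosub c = size (breaks d nosub c) by rewrite /last_arc st.
    by move: E nE; rewrite L !modn_small ?ltnS ?under_count_leq // => ->; rewrite eqxx.
  have L : last_arc d nosub c = (size (breaks d nosub c)).-1 by rewrite /last_arc (negPf ns).
  rewrite L in E.
  (* Different counts name the same arc only on a closed component, at the two ends of the
     numbering; the chain of subdivision points then passes through arc 0. *)
  have [Ei Ej] : under_count c i = 0%N /\ under_count c j = size (breaks d nosub c).
    move: lej E ij nE; move: (under_count c i) (under_count c j) (size _) => x y [|K] /=.
      by lia.
    rewrite [(y <= K.+1)%N]leq_eqVlt => /predU1P[->|lt].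
      by rewrite modnn => E le neq; split=> //; move: E; rewrite modn_small // ltn_neqAle neq.
    by move=> + le; rewrite !modn_small ?(leq_ltn_trans le) // => ->; rewrite eqxx.
  apply: (@submod_trans _ _ _ sB (e (arc_of d sub c 0))).
    by apply: run2 => //; rewrite Ei /under_count take0.
  rewrite -arc_of_size //; apply: run2 => //; by rewrite under_count_size Ej.
move=> [c i] [c' j] E; have cc' : c = c' by move/(congr1 tag): E.
by subst c'; apply: key.
Qed.

(** A break point on every strand separates its first arc from its last. *)
Lemma mark_arc_inj : (forall c, (0 < size (breaks d sub c))%N) -> injective (mark_arc d sub).
Proof.
move=> hb i j; rewrite /mark_arc => E; apply: (bij_inj (wt_ends hd).1).
have E1 : (ends d i).1 = (ends d j).1 by case: (congr1 tag E).
move: E; case: (ends d i) (ends d j) E1 => [a x] [b y] /= <- {b} /eqP.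
rewrite /arc_of eq_Tagged /= => /eqP /(congr1 val) /=.
rewrite !inordK ?ltn_pmod //.
have := hb (inl a); rewrite /last_arc /=.
by case: x y => [] []; rewrite ?mod0n ?modn_small //; case: (size _).
Qed.
End ForgetSubdivision.
Lemma group_eltD (G : zmodType) (g h : G) : group_elt (g + h) = group_elt g * group_elt h.
Proof. by rewrite -[RHS]/(group_ring_mul _ _) group_ring_mulUU. Qed.

Lemma group_elt0 (G : zmodType) : group_elt (0 : G) = 1.
Proof. by []. Qed.

Lemma group_eltN (G : zmodType) (g : G) : group_elt (- g) * group_elt g = 1.
Proof. by rewrite -group_eltD addNr. Qed.

(** * Fox calculus on Wirtinger words *)

Section FoxDerivative.
Variables (R : realType) (n m mu : nat) (d : diagram R n m) (G : zmodType).
Variables (psi : component n m -> 'I_mu) (t : 'I_mu -> G).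
Variables (V : lmodType (group_ring G)) (e : tarc d nosub -> V).
Local Notation word := (word d).
Local Notation color := (@word_color R n m d mu G psi t).
Implicit Types (u v w : word) (a o : tarc d nosub).

Definition letter_color (l : tarc d nosub * bool) : G :=
  if l.2 then - t (psi (tag l.1)) else t (psi (tag l.1)).

(** The inverse of a letter follows the rule $\partial(a^{-1}) = -a^{-1}\partial a$, read through
    the coloring. *)
Definition fox_letter (l : tarc d nosub * bool) : V :=
  if l.2 then - (group_elt (letter_color l) *: e l.1) else e l.1.

Fixpoint fox (w : word) : V :=
  if w is l :: w' then fox_letter l + group_elt (letter_color l) *: fox w' else 0.

Lemma word_color_cons l w : color (l :: w) = letter_color l + color w.
Proof. by rewrite /word_color big_cons. Qed.

Lemma word_color_cat u v : color (u ++ v) = color u + color v.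
Proof. by rewrite /word_color big_cat. Qed.

(** The Fox derivative is a crossed homomorphism for the action of words through their colors. *)
Lemma fox_cat u v : fox (u ++ v) = fox u + group_elt (color u) *: fox v.
Proof.
elim: u => [|l u IH] /=; first by rewrite /word_color big_nil group_elt0 scale1r add0r.
by rewrite IH word_color_cons group_eltD scalerDr addrA scalerA.
Qed.

Lemma fox_letter1 a : fox [:: (a, false)] = e a.
Proof. by rewrite /= scaler0 addr0. Qed.

(** These are the coefficients of a row of M at the over arc and at the conjugated under arc. *)
Lemma fox_conj o a : fox (conj_word o a) =
  group_elt (t (psi (tag o))) *: e a + (1 - group_elt (t (psi (tag a)))) *: e o.
Proof.
rewrite /= /fox_letter /letter_color /= scaler0 addr0 !scalerDr !scalerN !scalerA.
rewrite mulrC mulrA group_eltN mul1r scalerBl scale1r.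
by rewrite addrCA.
Qed.

Variable B : set V.
Hypothesis sB : is_submodule B.
Hypothesis relB : forall k : 'I_(nclassical d),
  let a := arc_in d nosub (under k) in let b := arc_out d nosub (under k) in
  B (- e (if positive k then b else a) +
     group_elt (t (psi (Defs.over k).1)) *: e (if positive k then a else b) +
     (1 - group_elt (t (psi (under k).1))) *: e (arc_in d nosub (Defs.over k))).

(** By induction on [wirtinger]. The product rule involves the color of the first factor, so
    equality of colors is proved at the same time. *)
Lemma wirtinger_fox u v : wirtinger u v -> color u = color v /\ B (fox u - fox v).
Proof.
elim=> {u v} [u|u v _ [E r]|u v w _ [E r] _ [E' r']|u u' v v' _ [E r] _ [E' r']|a b|k pk|k nk].
- by rewrite subrr; split=> //; exact: submod0.
- by split=> //; exact: submod_sym.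
- by split; [rewrite E|exact: (submod_trans sB r r')].
- rewrite !word_color_cat !fox_cat E E'; split=> //; apply: (submod_congr sB r).
  by rewrite -scalerBr; exact: submodZ.
- split; first by rewrite !word_color_cons /letter_color /word_color big_nil; case: b;
    rewrite /= addr0 (addrN, addNr).
  suff -> : fox [:: (a, b); (a, ~~ b)] = 0 by rewrite subr0; exact: submod0.
  case: b; rewrite /= /fox_letter /letter_color /= scaler0 addr0 ?addNr //.
  by rewrite scalerN scalerA mulrC group_eltN scale1r subrr.
- have := relB k; rewrite pk => /(submodN sB) rk; split.
    by rewrite !word_color_cons /letter_color /word_color big_nil /= !addr0 addrCA subrr addr0.
  by rewrite fox_letter1 fox_conj; rewrite -addrA opprD opprK in rk.
- have := relB k; rewrite (negPf nk) => /(submodN sB) rk; split.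
    by rewrite !word_color_cons /letter_color /word_color big_nil /= !addr0 addrCA subrr addr0.
  by rewrite fox_letter1 fox_conj; rewrite -addrA opprD opprK in rk.
Qed.
End FoxDerivative.

Definition rowspan (A : comNzRingType) q k (r : 'M[A]_(q, k)) : set 'rV[A]_k :=
  [set v | exists w : 'rV[A]_q, v = w *m r].

Lemma rowspan_submodule (A : comNzRingType) q k (r : 'M[A]_(q, k)) : is_submodule (rowspan r).
Proof.
split; first by exists 0; rewrite mul0mx.
  by move=> _ _ [v ->] [w ->]; exists (v + w); rewrite mulmxDl.
by move=> a _ [v ->]; exists (a *: v); rewrite scalemxAl.
Qed.

Lemma rowspan_row (A : comNzRingType) q k (r : 'M[A]_(q, k)) i : rowspan r (row i r).
Proof. by exists (delta_mx 0 i); rewrite -rowE. Qed.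

Section AlphaRows.
Variables (R : realType) (n m mu : nat) (d : diagram R n m) (G : zmodType).
Variables (psi : component n m -> 'I_mu) (t : 'I_mu -> G) (sub : component n m -> seq R) (p :
  nat).
Variables (rows : 'I_(p + n) -> alpha_row d sub) (inner : 'I_p -> tarc d sub).
Hypotheses (hd : is_welded_tangle d) (hadm : alpha_admissible rows inner).
Local Notation RG := (group_ring G).
Local Notation M := (alpha_matrix psi t rows inner).

Definition alpha_arc (k : 'I_(p + (n + n))) : tarc d sub :=
  match fintype.split k with inl i => inner i | inr j => mark_arc d sub j end.

Lemma alpha_arc_rshift j : alpha_arc (rshift p j) = mark_arc d sub j.
Proof. by rewrite /alpha_arc (unsplitK (inr j)). Qed.

Lemma alpha_arc_bij : bijective alpha_arc.
Proof.
have [hsub hb _ inj_inner int] := hadm.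
have arc_inj : injective alpha_arc.
  move=> k l; rewrite /alpha_arc -{2}[k]splitK -{2}[l]splitK.
  case: (fintype.split k) (fintype.split l) => [i|i] [j|j] /= E.
  - by rewrite (inj_inner _ _ E).
  - have /int : exists k, inner k = mark_arc d sub j by exists i.
    by rewrite /internal codom_f.
  - have /int : exists k, inner k = mark_arc d sub i by exists j.
    by rewrite /internal codom_f.
  - by rewrite (mark_arc_inj hd hb E).
have arc_surj x : exists k, alpha_arc k = x.
  have [/int[k <-]|] := boolP (internal x).
    by exists (lshift _ k); rewrite /alpha_arc (unsplitK (inl k)).
  by rewrite negbK => /codomP[j ->]; exists (rshift _ j); exact: alpha_arc_rshift.
have /boolp.choice[g gP] := arc_surj.
by exists g => [k|x //]; apply: arc_inj; rewrite gP.
Qed.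

Lemma alpha_matrixE r k : M r k = alpha_entry psi t (rows r) (alpha_arc k).
Proof.
rewrite /alpha_arc; case: (split_ordP k) => j ->.
  by rewrite row_mxEl mxE.
by rewrite row_mxEr mxE.
Qed.

Variables (idx : tarc d sub -> 'I_(p + (n + n))).
Hypotheses (idxK : cancel idx alpha_arc) (arcK : cancel alpha_arc idx).

Definition arc_basis (x : tarc d sub) : 'rV[RG]_(p + (n + n)) := delta_mx 0 (idx x).

Lemma arc_basisE x k : arc_basis x 0 k = (alpha_arc k == x)%:R.
Proof. by rewrite mxE eqxx /= -(inj_eq (can_inj arcK)) idxK eq_sym; case: eqP. Qed.

Lemma row_alpha_matrix r : row r M = match rows r with
  | inl k =>
    let a := arc_in d sub (under k) in let b := arc_out d sub (under k) in
    - arc_basis (if positive k then b else a) +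
    group_elt (t (psi (Defs.over k).1)) *: arc_basis (if positive k then a else b) +
    (1 - group_elt (t (psi (under k).1))) *: arc_basis (arc_in d sub (Defs.over k))
  | inr q =>
    let P := (tag q, (sub (tag q))`_(tagged q)) in
    arc_basis (arc_in d sub P) - arc_basis (arc_out d sub P)
  end.
Proof.
apply/rowP => l; rewrite [LHS]mxE alpha_matrixE /alpha_entry; case: (rows r) => [k|q] /=.
  have E (x y z : 'rV[RG]_(p + (n + n))) u v :
      (- x + u *: y + v *: z) 0 l = - x 0 l + u * y 0 l + v * z 0 l by rewrite !mxE.
  by rewrite E !arc_basisE.
have E (x y : 'rV[RG]_(p + (n + n))) : (x - y) 0 l = - y 0 l + x 0 l by rewrite !mxE addrC.
by rewrite E !arc_basisE.
Qed.

Lemma arc_basis_crossing (k : 'I_(nclassical d)) :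
  let o := arc_in d sub (Defs.over k) in
  let a := arc_in d sub (under k) in let b := arc_out d sub (under k) in
  rowspan M (- arc_basis (if positive k then b else a) +
     group_elt (t (psi (Defs.over k).1)) *: arc_basis (if positive k then a else b) +
     (1 - group_elt (t (psi (under k).1))) *: arc_basis o).
Proof.
have [_ _ [g gK rK] _ _] := hadm.
by have := rowspan_row M (g (inl k)); rewrite row_alpha_matrix rK.
Qed.

Lemma arc_basis_subdivision c s : s \in sub c ->
  rowspan M (arc_basis (arc_in d sub (c, s)) - arc_basis (arc_out d sub (c, s))).
Proof.
move=> sc; have [_ _ [g gK rK] _ _] := hadm.
have lt : (index s (sub c) < size (sub c))%N by rewrite index_mem.
pose q : {c & 'I_(size (sub c))} := Tagged (fun c => 'I_(size (sub c))) (Ordinal lt).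
by have := rowspan_row M (g (inr q)); rewrite row_alpha_matrix rK /= nth_index.
Qed.

Variable lift_arc : tarc d nosub -> tarc d sub.
Hypothesis lift_arcK : cancel lift_arc (@forget_arc R n m d sub).

(** Subdivided arcs lying on one original arc agree modulo the rows of the subdivision points, so
    any section [lift_arc] of [forget_arc] may be used. *)
Lemma arc_basis_forget x : rowspan M (arc_basis x - arc_basis (lift_arc (forget_arc x))).
Proof.
have [hsub _ _ _ _] := hadm.
apply: (forget_arc_fiber hd hsub (rowspan_submodule M)); last by rewrite lift_arcK.
exact: arc_basis_subdivision.
Qed.

(** The Fox derivative thus descends to $\pi(\tau)$ with values in the cokernel of M, whatever the
    subdivision. *)
Lemma arc_basis_fox (u v : word d) : wirtinger u v ->
  word_color psi t u = word_color psi t v /\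
  rowspan M (fox psi t (arc_basis \o lift_arc) u - fox psi t (arc_basis \o lift_arc) v).
Proof.
have [hsub _ _ _ _] := hadm; have sM := rowspan_submodule M.
apply: (wirtinger_fox sM) => k a b.
rewrite -[X in rowspan _ X](subrK (- arc_basis (if positive k then arc_out d sub (under k) else
  arc_in d sub (under k)) +
     group_elt (t (psi (Defs.over k).1)) *: arc_basis (if positive k then arc_in d sub (under k)
       else arc_out d sub (under k)) +
     (1 - group_elt (t (psi (under k).1))) *: arc_basis (arc_in d sub (Defs.over k)))).
apply: (submodD sM) (arc_basis_crossing k).
have ein P : rowspan M (arc_basis (lift_arc (arc_in d nosub P)) - arc_basis (arc_in d sub P)).
  by rewrite -(forget_arc_in hsub); apply: (submod_sym sM); exact: arc_basis_forget.
have eout P : rowspan M (arc_basis (lift_arc (arc_out d nosub P)) - arc_basis (arc_out d sub P)).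
  by rewrite -(forget_arc_out hsub); apply: (submod_sym sM); exact: arc_basis_forget.
apply: (submod_congr sM); first apply: (submod_congr sM).
- by rewrite -opprD; apply: (submodN sM); case: ifP => _; [exact: eout|exact: ein].
- by rewrite -scalerBr; apply: (submodZ sM); case: ifP => _; [exact: ein|exact: eout].
by rewrite -scalerBr; apply: (submodZ sM); exact: ein.
Qed.

End AlphaRows.

Local Open Scope classical_set_scope.
Local Open Scope ring_scope.

(** * Paths, homotopies and singular chains *)

Section FreeModules.
Variables (A : comNzRingType) (K : choiceType).
Local Notation F := {freeg K / A}.

Lemma freegU_scaleE (a : A) (x : K) : << a *g x >> = a *: << x >> :> F.
Proof. by apply/eqP/freeg_eqP => y; rewrite coeffZ !coeffU mul1r. Qed.

(** An induction principle: a linear property of chains need only be checked on single simplices. *)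
Lemma freeg_spanned (S : set F) : is_submodule S -> (forall x, S << x >>) -> forall c, S c.
Proof.
move=> sS gS c; rewrite -[c]freeg_sumE; apply: (submod_sum sS) => x.
by rewrite freegU_scaleE; apply: (submodZ sS).
Qed.

Variables (M : lmodType A) (f : K -> M).

Lemma fgliftB a b : fglift f (a - b) = fglift f a - fglift f b.
Proof. exact: lift_is_additive. Qed.

Lemma fglift0 : fglift f 0 = 0.
Proof. by rewrite -[X in fglift f X](subrr 0) fgliftB subrr. Qed.

Lemma fgliftN a : fglift f (- a) = - fglift f a.
Proof. by rewrite -[- a]sub0r fgliftB fglift0 sub0r. Qed.

Lemma fgliftD a b : fglift f (a + b) = fglift f a + fglift f b.
Proof. by rewrite -[b]opprK fgliftB fgliftN !opprK. Qed.

Lemma fglift_sum (I : Type) (s : seq I) (c : I -> F) :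
  fglift f (\sum_(i <- s) c i) = \sum_(i <- s) fglift f (c i).
Proof. exact: (big_morph _ fgliftD fglift0). Qed.

Lemma fgliftU x : fglift f << x >> = f x.
Proof. by rewrite liftU scale1r. Qed.

Lemma fgliftZ k a : fglift f (k *: a) = k *: fglift f a.
Proof.
rewrite -[a]freeg_sumE scaler_sumr !fglift_sum scaler_sumr; apply: eq_bigr => x _.
by rewrite (freegU_scaleE (coeff x a)) scalerA -!freegU_scaleE !liftU scalerA.
Qed.
End FreeModules.

Section Paths.
Variables (R : realType) (X : topologicalType).
Implicit Types f g h : rpath R X.

Lemma stdsimplex_sum k (s : @stdsimplex R k) : \sum_i set_val s 0 i = 1.
Proof. by have [] := set_valP s. Qed.

Lemma edge_coord_itv (s : @stdsimplex R 1) : 0 <= edge_coord s <= 1.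
Proof.
have [s0 s1] := set_valP s; rewrite /edge_coord s0 /= -s1 big_ord_recl big_ord1.
by rewrite (_ : fintype.lift _ _ = 1) ?lerDr ?s0 //; apply/val_inj.
Qed.

Lemma path_chain_eq (A : comNzRingType) f g : (forall s, 0 <= s <= 1 -> f s = g s) ->
  path_chain A f = path_chain A g.
Proof.
move=> fg; congr [freeg [:: (_, _)]]; apply/continuousEP => s /=.
by apply: fg; exact: edge_coord_itv.
Qed.

Definition segment (a b : R * R) (s : R) : R * R :=
  (a.1 + s * (b.1 - a.1), a.2 + s * (b.2 - a.2)).

Lemma continuous_pair (T : topologicalType) (u v : T -> R) :
  continuous u -> continuous v -> continuous (fun x => (u x, v x)).
Proof. by move=> cu cv x; apply: (cvg_pair (cu x) (cv x)). Qed.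

Lemma continuous_add (T : topologicalType) (u v : T -> R) :
  continuous u -> continuous v -> continuous (fun x => u x + v x).
Proof. by move=> cu cv x; apply: cvgD; [exact: cu|exact: cv]. Qed.

Lemma continuous_scale (T : topologicalType) (u : T -> R) (a : R) :
  continuous u -> continuous (fun x => u x * a).
Proof. by move=> cu x; apply: cvgM; [exact: cu|exact: cvg_cst]. Qed.

Lemma continuous_affine (a b : R) : continuous (fun s : R => a + s * b).
Proof.
apply: continuous_add; first by move=> s; exact: cvg_cst.
by apply: continuous_scale => s; exact: cvg_id.
Qed.

Lemma segment_continuous a b : continuous (segment a b).
Proof. by apply: continuous_pair; exact: continuous_affine. Qed.

HB.instance Definition _ a b := @isContinuous.Build _ _ (segment a b) (@segment_continuous a b).

Definition triangle (a b c : R * R) (s : @stdsimplex R 2) : R * R :=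
  let v := set_val s in
  (v 0 0 * a.1 + v 0 1 * b.1 + v 0 ord_max * c.1, v 0 0 * a.2 + v 0 1 * b.2 + v 0 ord_max * c.2).

Lemma simplex_coord_continuous k i : continuous (fun s : @stdsimplex R k => set_val s 0 i : R).
Proof.
by move=> s; apply: (@continuous_comp _ _ _ set_val (fun M : 'rV[R]_k.+1 => M 0 i));
  [exact: initial_continuous|exact: coord_continuous].
Qed.

Lemma triangle_continuous a b c : continuous (triangle a b c).
Proof.
by apply: continuous_pair; (apply: continuous_add; first apply: continuous_add);
  apply: continuous_scale; exact: simplex_coord_continuous.
Qed.

HB.instance Definition _ a b c := @isContinuous.Build _ _ (triangle a b c) (@triangle_continuous
  a b c).

Lemma set_val_face k (i : 'I_k.+2) (v : @stdsimplex R k) :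
  (forall l, set_val (face_fun i v) 0 (fintype.lift i l) = set_val v 0 l) *
  (set_val (face_fun i v) 0 i = 0).
Proof. by split=> [l|]; rewrite /= mxE ?liftK // unlift_none. Qed.

Lemma stdsimplex1E (v : @stdsimplex R 1) : set_val v 0 0 = 1 - edge_coord v.
Proof.
rewrite -(stdsimplex_sum v) big_ord_recl big_ord1 (_ : fintype.lift _ _ = 1) ?addrK //.
exact/val_inj.
Qed.

Lemma triangle_face a b c (v : @stdsimplex R 1) :
  [/\ triangle a b c (face_fun ord0 v) = segment b c (edge_coord v),
      triangle a b c (face_fun (fintype.lift ord0 ord0) v) = segment a c (edge_coord v)
    & triangle a b c (face_fun (fintype.lift ord0 (fintype.lift ord0 ord0)) v) =
      segment a b (edge_coord v)].
Proof.
have [e1 e2] : (1 : 'I_3) = fintype.lift ord0 ord0 /\ (ord_max : 'I_3) = fintype.lift ord0 1.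
  by split; apply/val_inj.
have [e3 e4] : (0 : 'I_3) = fintype.lift (fintype.lift ord0 ord0) ord0 /\
    (ord_max : 'I_3) = fintype.lift (fintype.lift ord0 ord0) 1 by split; apply/val_inj.
have [e5 e6] : (0 : 'I_3) = fintype.lift (fintype.lift ord0 (fintype.lift ord0 ord0)) ord0 /\
    (1 : 'I_3) = fintype.lift (fintype.lift ord0 (fintype.lift ord0 ord0)) 1 by split;
      apply/val_inj.
have e7 : (ord_max : 'I_3) = fintype.lift ord0 (fintype.lift ord0 ord0) by apply/val_inj.
have v0 := stdsimplex1E v; rewrite /triangle /segment; split.
- by rewrite e1 e2 !set_val_face -/(edge_coord v) v0; congr (_, _); ring.
- by rewrite {1 2}e3 e4 e1 !set_val_face -/(edge_coord v) v0; congr (_, _); ring.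
- by rewrite {1 2}e5 {1 2}e6 e7 !set_val_face -/(edge_coord v) v0; congr (_, _); ring.
Qed.

(** Restricting maps of the plane to affine triangles lets boundaries of 2-simplices be computed
    with paths. *)
Lemma boundary_triangle (A : comNzRingType) (F : continuousType (R * R)%type X) a b c :
  boundary (<< (F \o triangle a b c : simplex R 2 X) >> : chains R 2 X A) =
  path_chain A (F \o segment b c : rpath R X) - path_chain A (F \o segment a c : rpath R X)
  + path_chain A (F \o segment a b : rpath R X).
Proof.
rewrite /boundary fgliftU !big_ord_recl big_ord0 addr0 /= expr0 expr1 /= addrA.
rewrite (_ : (-1) ^+ _ = 1) ?expr2 ?mulrNN ?mulr1 //.
rewrite /path_chain -freegUN.
by congr (_ - _ + _); congr [freeg [:: (_, _)]]; apply/continuousEP => v /=;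
  have [E0 E1 E2] := triangle_face a b c v;
  rewrite ?E0 ?E1 ?E2.
Qed.

Lemma boundary_submodule (A : comNzRingType) (S : set (chains R 1 X A)) :
  is_submodule S -> is_submodule [set e : chains R 2 X A | S (boundary e)].
Proof.
move=> sS; split=> /= [|x y Sx Sy|k x Sx]; rewrite /boundary ?fglift0 ?fgliftD ?fgliftZ.
- exact: submod0.
- exact: submodD.
- exact: submodZ.
Qed.
End Paths.

Section ContinuityTools.
Variable R : realType.

Lemma continuous_comp' (T U V : topologicalType) (u : T -> U) (v : U -> V) :
  continuous u -> continuous v -> continuous (fun x => v (u x)).
Proof. by move=> cu cv x; apply: continuous_comp; [exact: cu|exact: cv]. Qed.

Lemma continuous_cst' (T U : topologicalType) (y : U) : continuous (fun _ : T => y).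
Proof. by move=> x; exact: cvg_cst. Qed.

Lemma continuous_id' (T : topologicalType) : continuous (fun x : T => x).
Proof. by move=> x; exact: cvg_id. Qed.

Lemma continuous_sub (T : topologicalType) (u v : T -> R) : continuous u -> continuous v ->
  continuous (fun x => u x - v x).
Proof. by move=> cu cv x; apply: cvgB; [exact: cu|exact: cv]. Qed.

Lemma continuous_mul (T : topologicalType) (u v : T -> R) : continuous u -> continuous v ->
  continuous (fun x => u x * v x).
Proof. by move=> cu cv x; apply: cvgM; [exact: cu|exact: cv]. Qed.

Lemma continuous_mull (T : topologicalType) (a : R) (u : T -> R) : continuous u ->
  continuous (fun x => a * u x).
Proof. by move=> cu; apply: continuous_mul => //; exact: continuous_cst'. Qed.

Lemma fst_cont : continuous (@fst R R). Proof. by move=> x; exact: cvg_fst. Qed.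
Lemma snd_cont : continuous (@snd R R). Proof. by move=> x; exact: cvg_snd. Qed.

End ContinuityTools.

Section PathOperations.
Variables (R : realType) (X : topologicalType).
Implicit Types f g h : rpath R X.

Lemma continuous_glue (T : topologicalType) (c : T -> R) (u v : T -> X) :
  continuous c -> continuous u -> continuous v -> (forall x, c x = 0 -> u x = v x) ->
  continuous (fun x => if c x <= 0 then u x else v x).
Proof.
move=> cc cu cv uv x A /=; have FF : Filter (nbhs x) by exact: nbhs_filter.
have [c0|c0|c0] := ltgtP (c x) 0 => Ax.
- have n1 : nbhs x [set y | c y < 0] by exact: (cvgr_lt _ (cc x)).
  have n2 : nbhs x (u @^-1` A) := cu x _ Ax.
  by apply: (@filterS2 _ _ FF _ _ _ _ n1 n2) => y /= /ltW ->.
- have n1 : nbhs x [set y | 0 < c y] by exact: (cvgr_gt _ (cc x)).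
  have n2 : nbhs x (v @^-1` A) := cv x _ Ax.
  by apply: (@filterS2 _ _ FF _ _ _ _ n1 n2) => y /=; rewrite ltNge => /negPf ->.
- have n1 : nbhs x (v @^-1` A) by apply: cv; rewrite -uv.
  have n2 : nbhs x (u @^-1` A) := cu x _ Ax.
  by apply: (@filterS2 _ _ FF _ _ _ _ n1 n2) => y /= vy uy; case: ifP.
Qed.

Definition path_cat_fun f g (s : R) : X := if s - 2^-1 <= 0 then f (2 * s) else g (2 * s - 1).

Lemma path_cat_continuous f g : f 1 = g 0 -> continuous (path_cat_fun f g).
Proof.
move=> fg; apply: continuous_glue.
- by apply: continuous_sub; [exact: continuous_id'|exact: continuous_cst'].
- apply: continuous_comp' (@cts_fun _ _ f).
  by apply: continuous_mull; exact: continuous_id'.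
- apply: continuous_comp' (@cts_fun _ _ g); apply: continuous_sub; last exact: continuous_cst'.
  by apply: continuous_mull; exact: continuous_id'.
move=> s /eqP; rewrite subr_eq0 => /eqP ->.
by rewrite divff ?pnatr_eq0 // subrr.
Qed.

(* the concatenation, with the junk value f when the end points do not match *)
Definition path_cat f g : rpath R X :=
  if pselect (f 1 = g 0) is left e then mkcts (path_cat_continuous e) else f.

Lemma path_catE f g s : f 1 = g 0 ->
  path_cat f g s = if s <= 2^-1 then f (2 * s) else g (2 * s - 1).
Proof. by move=> e; rewrite /path_cat; case: pselect => // e';
  rewrite /= /mkcts /path_cat_fun subr_le0. Qed.

Lemma path_catP f g : f 1 = g 0 -> path_concat f g (path_cat f g).
Proof. by move=> e s _; rewrite path_catE. Qed.

Lemma path_cat0 f g : path_cat f g 0 = f 0.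
Proof.
by rewrite /path_cat; case: pselect => // e; rewrite /= /mkcts /path_cat_fun sub0r oppr_le0
  invr_ge0 ler0n mulr0.
Qed.

Lemma path_cat1 f g : f 1 = g 0 -> path_cat f g 1 = g 1.
Proof.
move=> e; rewrite path_catE // ifF; first by congr (g _); lra.
by apply/negbTE; rewrite -ltNge; lra.
Qed.

Lemma continuous_opp1 : continuous (fun s : R => 1 - s).
Proof. by move=> s; apply: cvgB; [exact: cvg_cst|exact: cvg_id]. Qed.

Definition path_rev f : rpath R X := f \o mkcts continuous_opp1.

Lemma path_revE f s : path_rev f s = f (1 - s). Proof. by []. Qed.
Lemma path_rev0 f : path_rev f 0 = f 1. Proof. by rewrite path_revE subr0. Qed.
Lemma path_rev1 f : path_rev f 1 = f 0. Proof. by rewrite path_revE subrr. Qed.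

(** A retraction of the line onto [0, 1]; it extends to all parameters what is only prescribed on
    that interval. *)
Definition clamp (s : R) : R := if s <= 0 then 0 else if s - 1 <= 0 then s else 1.

Lemma clamp_itv s : 0 <= clamp s <= 1.
Proof. by rewrite /clamp; case: (leP s 0) => s0; [|case: (leP (s - 1) 0) => s1]; apply/andP;
  split; lra. Qed.

Lemma clamp_id s : 0 <= s <= 1 -> clamp s = s.
Proof. by rewrite /clamp => /andP[]; case: (leP s 0) => s0; [|case: (leP (s - 1) 0) => s1];
  lra. Qed.

End PathOperations.

Section Clamp.
Variable R : realType.
Lemma clamp_continuous : continuous (@clamp R).
Proof.
apply: continuous_glue; first by move=> s; exact: cvg_id.
- by move=> s; exact: cvg_cst.
- apply: continuous_glue.
  + by move=> s; apply: cvgB; [exact: cvg_id|exact: cvg_cst].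
  + by move=> s; exact: cvg_id.
  + by move=> s; exact: cvg_cst.
  by move=> s /eqP; rewrite subr_eq0 => /eqP.
by move=> s ->; rewrite sub0r oppr_le0 ler01.
Qed.

HB.instance Definition _ := @isContinuous.Build _ _ (@clamp R) clamp_continuous.
End Clamp.

Section Homotopies.
Variables (R : realType) (X : topologicalType).
Implicit Types f g h : rpath R X.
Local Notation "f ~~ g" := (path_homotopic f g) (at level 70).

Lemma homotopicI f g (H : R * R -> X) : continuous H ->
  (forall s, 0 <= s <= 1 -> [/\ H (0, s) = f s, H (1, s) = g s, H (s, 0) = f 0 & H (s, 1) =
    f 1]) ->
  f ~~ g.
Proof. by move=> cH HP; exists (mkcts cH). Qed.

Lemma homotopic_ends f g : f ~~ g -> f 0 = g 0 /\ f 1 = g 1.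
Proof.
move=> [H HP]; have o1 : 0 <= (1 : R) <= 1 by rewrite ler01 lexx.
have o0 : 0 <= (0 : R) <= 1 by rewrite ler01 lexx.
by have [_ H10 _ _] := HP _ o0; have [_ H11 H0 H1] := HP _ o1; rewrite -H10 -H11.
Qed.

Lemma homotopic_eq f g : (forall s, 0 <= s <= 1 -> f s = g s) -> f ~~ g.
Proof.
move=> fg; apply: (homotopicI (H := fun x => f x.2)).
  by apply: continuous_comp'; [exact: snd_cont|exact: cts_fun].
by move=> s s01 /=; split=> //; exact: fg.
Qed.

Lemma homotopic_refl f : f ~~ f.
Proof. exact: homotopic_eq. Qed.

Lemma homotopic_sym f g : f ~~ g -> g ~~ f.
Proof.
move=> fg; have [e0 e1] := homotopic_ends fg; have [H HP] := fg.
apply: (homotopicI (H := fun x => H (1 - x.1, x.2))).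
  apply: continuous_comp' (@cts_fun _ _ H); apply: continuous_pair; last exact: snd_cont.
  by apply: continuous_sub; [exact: continuous_cst'|exact: fst_cont].
move=> s s01 /=; have [H0 H1 _ _] := HP _ s01; rewrite subr0 subrr.
have s01' : 0 <= 1 - s <= 1 by lra.
by have [_ _ H2 H3] := HP _ s01'; rewrite -e0 -e1.
Qed.

(* Homotopies may be precomposed with the retraction of the plane onto the square. *)
Lemma homotopic_clamp f g : f ~~ g -> exists2 H : R * R -> X, continuous H &
  forall u s, [/\ H (0, s) = f (clamp s), H (1, s) = g (clamp s), H (u, 0) = f 0 & H (u, 1) =
    f 1].
Proof.
move=> [H HP]; exists (fun x => H (clamp x.1, clamp x.2)).
  apply: continuous_comp' (@cts_fun _ _ H); apply: continuous_pair.
    by apply: continuous_comp'; [exact: fst_cont|exact: clamp_continuous].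
  by apply: continuous_comp'; [exact: snd_cont|exact: clamp_continuous].
move=> u s /=; have [H0 H1 _ _] := HP _ (clamp_itv s); have [_ _ H2 H3] := HP _ (clamp_itv u).
by rewrite (clamp_id (s := 0)) ?lexx ?ler01 // (clamp_id (s := 1)) ?lexx ?ler01.
Qed.

Lemma homotopic_trans g f h : f ~~ g -> g ~~ h -> f ~~ h.
Proof.
move=> fg /homotopic_clamp[K cK KP]; have [e0 e1] := homotopic_ends fg.
have [H cH HP] := homotopic_clamp fg.
apply: (homotopicI (H := fun x => if x.1 - 2^-1 <= 0 then H (2 * x.1, x.2) else K (2 * x.1 - 1,
  x.2))).
  apply: continuous_glue.
  - by apply: continuous_sub; [exact: fst_cont|exact: continuous_cst'].
  - apply: continuous_comp' cH; apply: continuous_pair; last exact: snd_cont.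
    exact/continuous_mull/fst_cont.
  - apply: continuous_comp' cK; apply: continuous_pair; last exact: snd_cont.
    by apply: continuous_sub; [exact/continuous_mull/fst_cont|exact: continuous_cst'].
  move=> [u s] /= /eqP; rewrite subr_eq0 => /eqP ->.
  rewrite divff ?pnatr_eq0 // subrr; have [_ -> _ _] := HP 0 s.
  by have [-> _ _ _] := KP 0 s.
move=> s s01 /=; split.
- rewrite ifT; last by lra.
  by rewrite mulr0; have [-> _ _ _] := HP 0 s; rewrite clamp_id.
- rewrite ifF; last by apply/negbTE; rewrite -ltNge; lra.
  rewrite (_ : 2 * 1 - 1 = 1); last by lra.
  by have [_ -> _ _] := KP 0 s; rewrite clamp_id.
- by case: ifP => _; [have [_ _ -> _] := HP (2 * s) 0|have [_ _ -> _] := KP (2 * s - 1) 0].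
- by case: ifP => _; [have [_ _ _ ->] := HP (2 * s) 0|have [_ _ _ ->] := KP (2 * s - 1) 0].
Qed.

Lemma homotopic_cat f f' g g' : f 1 = g 0 -> f ~~ f' -> g ~~ g' ->
  path_cat f g ~~ path_cat f' g'.
Proof.
move=> fg ff' gg'; have [e0 e1] := homotopic_ends ff'; have [e0' e1'] := homotopic_ends gg'.
have fg' : f' 1 = g' 0 by rewrite -e1 -e0'.
have [H cH HP] := homotopic_clamp ff'; have [K cK KP] := homotopic_clamp gg'.
apply: (homotopicI (H := fun x => if x.2 - 2^-1 <= 0 then H (x.1, 2 * x.2) else K (x.1,
  2 * x.2 - 1))).
  apply: continuous_glue.
  - by apply: continuous_sub; [exact: snd_cont|exact: continuous_cst'].
  - apply: continuous_comp' cH; apply: continuous_pair; first exact: fst_cont.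
    exact/continuous_mull/snd_cont.
  - apply: continuous_comp' cK; apply: continuous_pair; first exact: fst_cont.
    by apply: continuous_sub; [exact/continuous_mull/snd_cont|exact: continuous_cst'].
  move=> [u s] /= /eqP; rewrite subr_eq0 => /eqP ->.
  rewrite divff ?pnatr_eq0 // subrr; have [_ _ _ ->] := HP u 0.
  by have [_ _ -> _] := KP u 0.
move=> s s01 /=; rewrite !path_catE // subr_le0; split.
- case: leP => ss; first by have [-> _ _ _] := HP 0 (2 * s); rewrite clamp_id //; lra.
  by have [-> _ _ _] := KP 0 (2 * s - 1); rewrite clamp_id //; lra.
- case: leP => ss; first by have [_ -> _ _] := HP 0 (2 * s); rewrite clamp_id //; lra.
  by have [_ -> _ _] := KP 0 (2 * s - 1); rewrite clamp_id //; lra.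
- rewrite ifT; last by lra.
  rewrite mulr0 ifT; last by lra.
  by have [_ _ -> _] := HP s 0.
- rewrite ifF; last by apply/negbTE; rewrite -ltNge; lra.
  rewrite ifF; last by apply/negbTE; rewrite -ltNge; lra.
  rewrite (_ : 2 * 1 - 1 = 1); last by lra.
  by have [_ _ _ ->] := KP s 0.
Qed.

(** The straight-line homotopy of the plane composed with F; the groupoid identities follow from it
    through [homotopic_reparam]. *)
Lemma homotopic_plane (F : continuousType (R * R)%type X) (u v : R -> R * R)
  (cu : continuous u) (cv : continuous v) : u 0 = v 0 -> u 1 = v 1 ->
  (F \o mkcts cu : rpath R X) ~~ (F \o mkcts cv : rpath R X).
Proof.
move=> e0 e1.
apply: (homotopicI (H := fun x => F ((u x.2).1 + x.1 * ((v x.2).1 - (u x.2).1),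
                                    (u x.2).2 + x.1 * ((v x.2).2 - (u x.2).2)))).
  apply: continuous_comp' (@cts_fun _ _ F).
  have cc (w : R -> R) (w' : R -> R) : continuous w -> continuous w' ->
      continuous (fun x : R * R => w x.2 + x.1 * (w' x.2 - w x.2)).
    move=> cw cw'; have c1 := continuous_comp' (@snd_cont R) cw.
    have c2 := continuous_comp' (@snd_cont R) cw'.
    by apply: continuous_add => //; apply: continuous_mul (@fst_cont R) _; exact: continuous_sub.
  have cfst (w : R -> R * R) : continuous w -> continuous (fun s => (w s).1).
    by move=> cw; exact: continuous_comp' cw (@fst_cont R).
  have csnd (w : R -> R * R) : continuous w -> continuous (fun s => (w s).2).
    by move=> cw; exact: continuous_comp' cw (@snd_cont R).
  exact: continuous_pair (cc _ _ (cfst _ cu) (cfst _ cv)) (cc _ _ (csnd _ cu) (csnd _ cv)).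
move=> s s01 /=; rewrite !mul0r !addr0 !mul1r e0 e1 !subrr !mulr0 !addr0; split=> //.
- by rewrite -surjective_pairing.
- by rewrite !subrKC -surjective_pairing.
- by rewrite /mkcts e0 -surjective_pairing.
- by rewrite /mkcts e1 -surjective_pairing.
Qed.

Lemma homotopic_reparam f g g' (u v : R -> R) : continuous u -> continuous v ->
  u 0 = v 0 -> u 1 = v 1 -> (forall s, 0 <= s <= 1 -> g s = f (u s)) ->
  (forall s, 0 <= s <= 1 -> g' s = f (v s)) -> g ~~ g'.
Proof.
move=> cu cv e0 e1 gf gf'.
have cu' : continuous (fun s => (u s, 0 : R)) by apply: continuous_pair => //;
  exact: continuous_cst'.
have cv' : continuous (fun s => (v s, 0 : R)) by apply: continuous_pair => //;
  exact: continuous_cst'.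
pose F : continuousType (R * R)%type X := f \o mkcts (@fst_cont R).
apply: (@homotopic_trans (F \o mkcts cu' : rpath R X)); first exact: homotopic_eq.
apply: (@homotopic_trans (F \o mkcts cv' : rpath R X)); last first.
  by apply: homotopic_eq => s /gf' ->.
by apply: homotopic_plane; rewrite ?e0 ?e1.
Qed.

End Homotopies.

Section PathGroupoid.
Variables (R : realType) (X : topologicalType).
Implicit Types a b c f g h : rpath R X.
Local Notation "f ~~ g" := (path_homotopic f g) (at level 70).

Lemma continuous_glueR (r : R) (u v : R -> R) : continuous u -> continuous v -> u r = v r ->
  continuous (fun s : R => if s <= r then u s else v s).
Proof.
move=> cu cv uv; under eq_fun do rewrite -subr_le0; apply: continuous_glue => //.
  by apply: continuous_sub; [exact: continuous_id'|exact: continuous_cst'].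
by move=> s /eqP; rewrite subr_eq0 => /eqP ->.
Qed.

Lemma continuous_lin (r q : R) : continuous (fun s : R => r * s + q).
Proof.
apply: continuous_add; last exact: continuous_cst'.
by apply: continuous_mull; exact: continuous_id'.
Qed.

Ltac path_eq := solve [exfalso; lra | congr (Continuous.sort _ _); lra].

Lemma homotopic_catA f g h : f 1 = g 0 -> g 1 = h 0 ->
  path_cat (path_cat f g) h ~~ path_cat f (path_cat g h).
Proof.
move=> fg gh.
(* [u] is the piecewise linear reparametrization sending the break times 1/4 and 1/2 of (f g) h to
   the break times 1/2 and 3/4 of f (g h). *)
pose u (s : R) : R := if s <= 4^-1 then 2 * s + 0 else if s <= 2^-1 then 1 * s + 4^-1 else 2^-1 *
  s + 2^-1.
have cu : continuous u.
  apply: continuous_glueR; [exact: continuous_lin|apply: continuous_glueR|].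
  - exact: continuous_lin.
  - exact: continuous_lin.
  - lra.
  by rewrite ifT; lra.
have E1 : (path_cat f g) 1 = h 0 by rewrite path_cat1.
have E2 : f 1 = (path_cat g h) 0 by rewrite path_cat0.
apply: (homotopic_reparam (f := path_cat f (path_cat g h)) cu (@continuous_id' R)).
- by rewrite /u ifT; lra.
- by rewrite /u !ifF; try (apply/negbTE; rewrite -ltNge); lra.
- move=> s s01; rewrite /u !(path_catE _ E1) !(path_catE _ E2) !(path_catE _ fg) !(path_catE _
  gh).
  clear fg gh E1 E2; case: (leP s 4^-1) => s4; last case: (leP s 2^-1) => s2.
  - by repeat case: leP => ?; path_eq.
  - by repeat case: leP => ?; path_eq.
  - by repeat case: leP => ?; path_eq.
- by [].
Qed.

Lemma homotopic_cat1l f : path_cat (cst (f 0) : rpath R X) f ~~ f.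
Proof.
pose u (s : R) : R := if s <= 2^-1 then 0 else 2 * s + - 1.
have cu : continuous u.
  by apply: continuous_glueR; [exact: continuous_cst'|exact: continuous_lin|lra].
apply: (homotopic_reparam (f := f) cu (@continuous_id' R)) => //.
- by rewrite /u ifT; lra.
- by rewrite /u ifF; try (apply/negbTE; rewrite -ltNge); lra.
- by move=> s s01; rewrite path_catE // /u; case: ifP.
Qed.

Lemma homotopic_revr f : path_cat f (path_rev f) ~~ (cst (f 0) : rpath R X).
Proof.
pose u (s : R) : R := if s <= 2^-1 then 2 * s + 0 else - 2 * s + 2.
have cu : continuous u.
  by apply: continuous_glueR; [exact: continuous_lin|exact: continuous_lin|lra].
apply: (homotopic_reparam (f := f) cu (@continuous_cst' R _ 0)) => //.
- by rewrite /u ifT; lra.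
- by rewrite /u ifF; try (apply/negbTE; rewrite -ltNge); lra.
move=> s s01; rewrite path_catE ?path_rev0 // /u; case: ifP => _; first by rewrite addr0.
by rewrite path_revE; congr (f _); lra.
Qed.

Lemma path_revK f : path_rev (path_rev f) = f.
Proof. by apply/continuousEP => s; rewrite !path_revE; congr (f _); lra. Qed.

Lemma homotopic_revl f : path_cat (path_rev f) f ~~ (cst (f 1) : rpath R X).
Proof. by have := homotopic_revr (path_rev f); rewrite path_revK path_rev0. Qed.

Definition based_loop (a f b : rpath R X) : rpath R X := path_cat (path_cat a f) (path_rev b).

Lemma based_loop_is_loop a f b x : a 0 = x -> b 0 = x -> a 1 = f 0 -> f 1 = b 1 ->
  is_loop x (based_loop a f b).
Proof.
move=> a0 b0 af fb; split; first by rewrite !path_cat0.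
by rewrite path_cat1 ?path_rev1 // path_cat1 ?path_rev0.
Qed.

Lemma based_loop_homotopic a f f' b : a 1 = f 0 -> f 1 = b 1 -> f ~~ f' ->
  based_loop a f b ~~ based_loop a f' b.
Proof.
move=> af fb ff'; apply: homotopic_cat (homotopic_refl _).
  by rewrite path_cat1 // path_rev0.
by apply: homotopic_cat => //; exact: homotopic_refl.
Qed.

(** The inner path b cancels against its reverse. *)
Lemma based_loop_cat a f b g c : a 1 = f 0 -> f 1 = b 1 -> b 1 = g 0 -> g 1 = c 1 -> b 0 = c 0 ->
  path_cat (based_loop a f b) (based_loop b g c) ~~ based_loop a (path_cat f g) c.
Proof.
move=> af fb bg gc bc0.
have e1 : (path_cat a f) 1 = (path_rev b) 0 by rewrite path_cat1 ?path_rev0.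
have e2 : (path_cat b g) 1 = (path_rev c) 0 by rewrite path_cat1 ?path_rev0.
have e3 : f 1 = g 0 by rewrite fb.
apply: (@homotopic_trans _ _ (path_cat (path_cat a f) (path_cat (path_rev b) (based_loop b g
  c)))).
  by apply: homotopic_catA; rewrite // path_rev1 !path_cat0.
apply: (@homotopic_trans _ _ (path_cat (path_cat a f) (path_cat g (path_rev c)))).
  apply: homotopic_cat (homotopic_refl _) _; first by rewrite path_cat1 // path_cat0 path_rev0.
  apply: (@homotopic_trans _ _ (path_cat (path_cat (path_rev b) (path_cat b g)) (path_rev c))).
    by apply: homotopic_sym; apply: homotopic_catA; rewrite // path_rev1 path_cat0.
  apply: homotopic_cat (homotopic_refl _).
    by rewrite path_cat1 ?path_rev1 ?path_cat0 // path_cat1.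
  apply: (@homotopic_trans _ _ (path_cat (path_cat (path_rev b) b) g)).
    by apply: homotopic_sym; apply: homotopic_catA; rewrite ?path_rev1.
  apply: (@homotopic_trans _ _ (path_cat (cst (g 0) : rpath R X) g)); last exact: homotopic_cat1l.
  apply: homotopic_cat (homotopic_refl _); first by rewrite path_cat1 ?path_rev1.
  by rewrite -bg; exact: homotopic_revl.
apply: (@homotopic_trans _ _ (path_cat (path_cat (path_cat a f) g) (path_rev c))).
  by apply: homotopic_sym; apply: homotopic_catA; rewrite ?path_rev0 // path_cat1.
apply: homotopic_cat (homotopic_refl _); first by rewrite !path_cat1 ?path_rev0.
exact: homotopic_catA.
Qed.

End PathGroupoid.

(** * Singular simplices, paths and boundaries *)

Section SimplicesAndPaths.
Variables (R : realType) (X : topologicalType).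
Implicit Types f g h : rpath R X.
Local Notation "f ~~ g" := (path_homotopic f g) (at level 70).

Definition point_chain (A : comNzRingType) (x : X) : chains R 0 X A := << (cst x :
  simplex R 0 X) >>.

Definition boundaries (A : comNzRingType) : set (chains R 1 X A) :=
  [set c | exists e : chains R 2 X A, boundary e = c].

Lemma boundaries_submodule A : is_submodule (@boundaries A).
Proof.
split=> [|_ _ [e <-] [e' <-]|k _ [e <-]].
- by exists 0; rewrite /boundary fglift0.
- by exists (e + e'); rewrite /boundary fgliftD.
- by exists (k *: e); rewrite /boundary fgliftZ.
Qed.

Lemma boundaries_triangle A (F : continuousType (R * R)%type X) a b c f g h :
  (forall s, 0 <= s <= 1 -> f s = F (segment a b s)) ->
  (forall s, 0 <= s <= 1 -> g s = F (segment b c s)) ->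
  (forall s, 0 <= s <= 1 -> h s = F (segment a c s)) ->
  boundaries (path_chain A f + path_chain A g - path_chain A h).
Proof.
move=> Ef Eg Eh; exists << (F \o triangle a b c : simplex R 2 X) >>.
rewrite boundary_triangle (path_chain_eq A (f := f) (g := F \o segment a b)) //.
rewrite (path_chain_eq A (f := g) (g := F \o segment b c)) //.
by rewrite (path_chain_eq A (f := h) (g := F \o segment a c)) // addrAC [X in X - _]addrC.
Qed.

(** A degenerate triangle with collinear vertices 0, 1/2, 1 has f, g and their concatenation as
    sides. *)
Lemma boundaries_cat A f g : f 1 = g 0 ->
  boundaries (path_chain A f + path_chain A g - path_chain A (path_cat f g)).
Proof.
move=> fg; apply: (boundaries_triangle A (F := path_cat f g \o mkcts (@fst_cont R))
   (a := (0, 0)) (b := (2^-1, 0)) (c := (1, 0))) => s s01 /=.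
- rewrite /= /mkcts /segment /= path_catE // ifT; last lra.
  by congr (f _); lra.
- rewrite /= /mkcts /segment /= path_catE //; case: (leP (2^-1 + s * (1 - 2^-1)) 2^-1) => l.
    have -> : s = 0 by lra.
    by rewrite -fg; congr (f _); lra.
  by congr (g _); lra.
- by rewrite /= /mkcts /segment /=; congr (path_cat f g _); lra.
Qed.

Lemma boundaries_cst A x : boundaries (path_chain A (cst x : rpath R X)).
Proof.
have := @boundaries_triangle A (cst x) (0, 0) (0, 0) (0, 0) (cst x) (cst x) (cst x).
by rewrite addrK; apply.
Qed.

(** The degenerate triangle 0, 1, 0 gives f plus its reverse minus a constant path, which is itself
    a boundary. *)
Lemma boundaries_rev A f : boundaries (path_chain A f + path_chain A (path_rev f)).
Proof.
have sB := boundaries_submodule A.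
rewrite -[X in boundaries X](subrK (path_chain A (cst (f 0) : rpath R X))).
apply: (submodD sB) (boundaries_cst A _).
apply: (boundaries_triangle A (F := f \o mkcts (@fst_cont R)) (a := (0, 0)) (b := (1, 0)) (c :=
  (0, 0)))
  => s s01; rewrite ?path_revE /= /mkcts /segment /=; congr (f _); lra.
Qed.

(** The square of the homotopy is cut along its diagonal into two triangles; its constant sides are
    boundaries. *)
Lemma boundaries_homotopic A f g : f ~~ g -> boundaries (path_chain A f - path_chain A g).
Proof.
move=> [H HP]; have sB := boundaries_submodule A.
have cdiag : continuous (fun s : R => (s, s)) by apply: continuous_pair; exact: continuous_id'.
pose d : rpath R X := H \o mkcts cdiag.
have T1 : boundaries (path_chain A f + path_chain A (cst (f 1) : rpath R X) - path_chain A d).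
  apply: (boundaries_triangle A (F := H) (a := (0, 0)) (b := (0, 1)) (c := (1, 1))) => s s01;
    have [H0 H1 H2 H3] := HP _ s01; rewrite /= /mkcts /segment /= ?subr0 ?subrr ?mulr0 ?mulr1
      ?add0r ?addr0 //.
have T2 : boundaries (path_chain A (cst (f 0) : rpath R X) + path_chain A g - path_chain A d).
  apply: (boundaries_triangle A (F := H) (a := (0, 0)) (b := (1, 0)) (c := (1, 1))) => s s01;
    have [H0 H1 H2 H3] := HP _ s01; rewrite /= /mkcts /segment /= ?subr0 ?subrr ?mulr0 ?mulr1
      ?add0r ?addr0 //.
have := submodB sB T1 (boundaries_cst A (f 1)); rewrite addrAC addrK => D1.
have := submodB sB T2 (boundaries_cst A (f 0)); rewrite addrC !addrA addNr add0r => D2.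
by have := submodB sB D1 D2; rewrite opprB addrA subrK.
Qed.

Definition simplex_point k (w : 'rV[R]_k.+1) (hw : w \in @stdsimplex R k) : @stdsimplex R k :=
  exist (fun w => w \in @stdsimplex R k) w hw.

Lemma continuous_into_simplex (T : topologicalType) k (w : T -> 'rV[R]_k.+1)
    (hw : forall x, w x \in @stdsimplex R k) : (forall i, continuous (fun x => w x 0 i)) ->
  continuous (fun x => simplex_point (hw x)).
Proof.
move=> cw; apply: (continuous_comp_initial (w := set_val)) => v A [P vP PA].
suff : \forall x \near v, forall i' j, P i' j (w x i' j).
  by apply: filterS => x Px; exact: PA.
have FF : Filter (nbhs v) by exact: nbhs_filter.
apply: (@filter_forall _ _ (fun i' x => forall j, P i' j (w x i' j)) _ FF) => i'.
apply: (@filter_forall _ _ (fun j x => P i' j (w x i' j)) _ FF) => j.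
have := vP i' j; rewrite (ord1 i') => /=; exact: cw.
Qed.

Lemma simplex0_eq (s : simplex R 0 X) : exists x, s = (cst x : simplex R 0 X).
Proof.
have hv : \row_(j < 1) (1 : R) \in @stdsimplex R 0.
  by apply/mem_set; split=> [i|]; rewrite ?big_ord1 mxE.
exists (s (simplex_point hv)); apply/continuousEP => v; congr (s _); apply/val_inj/rowP => i /=.
by rewrite mxE ord1 -(stdsimplex_sum v) big_ord1.
Qed.

Lemma boundary_path A f : boundary (path_chain A f) = point_chain A (f 1) - point_chain A (f 0).
Proof.
rewrite /boundary fgliftU !big_ord_recl big_ord0 addr0 /= expr0 expr1 -freegUN.
have e0 (v : @stdsimplex R 0) : set_val v 0 0 = 1 by rewrite -(stdsimplex_sum v) big_ord1.
have e1 : (1 : 'I_2) = fintype.lift ord0 0 by apply/val_inj.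
congr (_ - _); congr [freeg [:: (_, _)]]; apply/continuousEP => v /=; congr (f _);
  rewrite /edge_coord.
  by rewrite e1 set_val_face.
by rewrite (_ : (1 : 'I_2) = fintype.lift ord0 ord0) ?set_val_face //; apply/val_inj.
Qed.

(** Composition with a retraction extends a simplex to the whole line, so that 1-chains can be
    handled as combinations of paths. *)
Lemma simplex1_eq (s : simplex R 1 X) : exists f, s = (f \o @edge_coord R : simplex R 1 X).
Proof.
pose w (t : R) : 'rV[R]_2 := \row_j (if j == 0 then 1 - clamp t else clamp t).
have hw t : w t \in @stdsimplex R 1.
  apply/mem_set; split=> [i|]; rewrite ?mxE.
    by have := clamp_itv t; case: ifP => _ /andP[]; lra.
  by rewrite big_ord_recl big_ord1 !mxE /=; lra.
have cw : continuous (fun t => simplex_point (hw t)).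
  apply: continuous_into_simplex => i; under eq_fun do rewrite mxE.
  case: (i == 0); last exact: clamp_continuous.
  by apply: continuous_sub; [exact: continuous_cst'|exact: clamp_continuous].
exists (s \o mkcts cw); apply/continuousEP => v /=; congr (s _); apply/val_inj/rowP => i /=.
rewrite mxE clamp_id ?edge_coord_itv //; case: eqP => [->|/eqP i0]; first exact: stdsimplex1E.
by congr (set_val v 0 _); apply/val_inj => /=; case: i i0 => -[|[]].
Qed.

Lemma simplex2_eq (s : simplex R 2 X) : exists F : continuousType (R * R)%type X,
  s = (F \o triangle (0, 0) (1, 0) (0, 1) : simplex R 2 X).
Proof.
(* Capping the second coordinate by 1 minus the first retracts the unit square onto the triangle. *)
pose y (q : R * R) : R := if clamp q.2 - (1 - clamp q.1) <= 0 then clamp q.2 else 1 - clamp q.1.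
have c1 : continuous (fun q : R * R => 1 - clamp q.1).
  apply: continuous_sub; first exact: continuous_cst'.
  by apply: continuous_comp'; [exact: fst_cont|exact: clamp_continuous].
have c2 : continuous (fun q : R * R => clamp q.2).
  by apply: continuous_comp'; [exact: snd_cont|exact: clamp_continuous].
have cy : continuous y.
  apply: continuous_glue => //; first exact: continuous_sub.
  by move=> q /eqP; rewrite subr_eq0 => /eqP.
have cx : continuous (fun q : R * R => clamp q.1).
  by apply: continuous_comp'; [exact: fst_cont|exact: clamp_continuous].
have y01 q : 0 <= y q <= 1 - clamp q.1.
  rewrite /y; have /andP[] := clamp_itv q.1; have /andP[] := clamp_itv q.2.
  by case: (leP (clamp q.2 - (1 - clamp q.1)) 0) => *; apply/andP; split; lra.
pose w (q : R * R) : 'rV[R]_3 :=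
  \row_j (if j == 0 then 1 - clamp q.1 - y q else if j == 1 then clamp q.1 else y q).
have hw q : w q \in @stdsimplex R 2.
  apply/mem_set; split=> [i|]; rewrite ?mxE.
    have /andP[] := y01 q; have /andP[] := clamp_itv q.1.
    by case: ifP => _; [|case: ifP => _]; lra.
  by rewrite !big_ord_recl big_ord0 !mxE /=; lra.
have cw : continuous (fun t => simplex_point (hw t)).
  apply: continuous_into_simplex => i; under eq_fun do rewrite mxE.
  by case: (i == 0); [exact: continuous_sub|case: (i == 1)].
exists (s \o mkcts cw); apply/continuousEP => v /=; congr (s _).
have [v0 v1] := set_valP v.
have e1 : (1 : 'I_3) = fintype.lift ord0 ord0 by apply/val_inj.
have e2 : (ord_max : 'I_3) = fintype.lift ord0 (fintype.lift ord0 ord0) by apply/val_inj.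
have vs : set_val v 0 0 + set_val v 0 1 + set_val v 0 ord_max = 1.
  by rewrite -[RHS]v1 !big_ord_recl big_ord0 addr0 e1 e2 addrA.
have := v0 0; have := v0 1; have := v0 ord_max => p2 p1 p0.
have t1 : (triangle (0, 0) (1, 0) (0, 1) v).1 = set_val v 0 1 by rewrite /triangle /=; lra.
have t2 : (triangle (0, 0) (1, 0) (0, 1) v).2 = set_val v 0 ord_max by rewrite /triangle /=; lra.
have E1 : clamp (triangle (0, 0) (1, 0) (0, 1) v).1 = set_val v 0 1.
  by rewrite t1 clamp_id //; apply/andP; split; lra.
have E2 : y (triangle (0, 0) (1, 0) (0, 1) v) = set_val v 0 ord_max.
  rewrite /y E1 t2 clamp_id; last by apply/andP; split; lra.
  by case: leP => //; lra.
apply/val_inj/rowP => i /=; rewrite mxE E1 E2.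
case: eqP => [->|/eqP i0]; first lra.
case: eqP => [->//|/eqP i1]; congr (set_val v 0 _); apply/val_inj => /=.
by case: i i0 i1 => -[|[|[]]].
Qed.

End SimplicesAndPaths.

(** * Coverings *)

(** Connectedness of [0, 1]: P propagates past the supremum of the times up to which it holds.
    Existence, uniqueness and continuity of lifts are all proved by taking suitable properties P. *)
Lemma locally_constant_itv (R : realType) (P : R -> Prop) :
  (forall T, 0 <= T <= 1 -> exists2 e, 0 < e & forall s t, 0 <= s <= 1 -> 0 <= t <= 1 ->
     `|s - T| < e -> `|t - T| < e -> P s -> P t) ->
  P 0 -> forall t, 0 <= t <= 1 -> P t.
Proof.
move=> loc P0 t /andP[t0 t1].
pose S := [set t : R | 0 <= t <= 1 /\ forall s, 0 <= s <= t -> P s].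
have S0 : S 0.
  split; first by rewrite lexx ler01.
  by move=> s s0; have -> : s = 0 by lra.
have hS : has_sup S by split; [exists 0|exists 1 => s [/andP[]]].
have T01 : 0 <= sup S <= 1.
  by rewrite (sup_ubound hS.2 S0) /=; apply: ge_sup => [|s [/andP[]//]]; exists 0.
have [e e0 loce] := loc _ T01.
have [u [u01 uP] uT] := sup_adherent e0 hS.
have uleT : u <= sup S by exact: (sup_ubound hS.2).
have near s : 0 <= s <= 1 -> s < sup S + e -> P s.
  move=> s01 sT; have [su|us] := leP s u; first by apply: uP; lra.
  apply: (loce u s) => //; last by apply: uP; lra.
    by rewrite ltr_norml; apply/andP; split; lra.
  by rewrite ltr_norml; apply/andP; split; lra.
have [T1|T1] := leP 1 (sup S + e / 2); first by apply: near; lra.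
have : S (sup S + e / 2).
  split; first by apply/andP; split; lra.
  by move=> s s01; apply: near; lra.
by move=> /(sup_ubound hS.2); lra.
Qed.

Lemma convex_comb_itv (R : realType) (a b s : R) : 0 <= s <= 1 ->
  (a <= a + s * (b - a) <= b) || (b <= a + s * (b - a) <= a).
Proof.
move=> /andP[s0 s1]; have s1' : 0 <= 1 - s by rewrite subr_ge0.
have [ab|/ltW ba] := leP a b.
  have ab' : 0 <= b - a by rewrite subr_ge0.
  by apply/orP; left; have := mulr_ge0 s0 ab'; have := mulr_ge0 s1' ab'; lra.
have ba' : 0 <= a - b by rewrite subr_ge0.
by apply/orP; right; have := mulr_ge0 s0 ba'; have := mulr_ge0 s1' ba'; lra.
Qed.

Lemma open_nbhsI (T : topologicalType) (A : set T) x : open A -> A x -> nbhs x A.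
Proof. by move=> oA Ax; apply: open_nbhs_nbhs; split. Qed.

Section Coverings.
Variables (R : realType) (X' X : topologicalType) (p : continuousType X' X).
Hypothesis hp : is_covering p.

Lemma covering_sheets x : exists (U : set X) (Vs : set (set X')),
  [/\ open U, U x, forall z, U (p z) -> exists2 V, Vs V & V z,
      forall V W z, Vs V -> Vs W -> V z -> W z -> V = W
    & forall V, Vs V -> [/\ open V, forall z, V z -> U (p z),
        forall a b, V a -> V b -> p a = p b -> a = b,
        forall y, U y -> exists2 z, V z & p z = y
      & forall W, open W -> W `<=` V -> open (p @` W)]].
Proof.
have [_ /(_ x)[U [oU Ux [I [V [pU disj bij op]]]]]] := hp.
exists U, [set W | exists i, W = V i]; split=> //.
- move=> z Uz; have [i _ Viz] : (\bigcup_i V i) z by rewrite -pU.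
  by exists (V i) => //; exists i.
- by move=> _ _ z [i ->] [j ->] Vi Vj; rewrite (disj i j) //; exists z.
- move=> _ [i ->]; have [oV [pV inj surj]] := bij i; split=> //.
  + by move=> a b Va Vb; apply: inj; rewrite inE.
  + exact: op.
Qed.

Lemma path_in_sheet (V : set X') (Vs : set (set X')) (U : set X) (g : R -> X') :
  Vs V -> (forall W, Vs W -> open W) -> (forall z, U (p z) -> exists2 W, Vs W & W z) ->
  (forall W W' z, Vs W -> Vs W' -> W z -> W' z -> W = W') ->
  continuous g -> (forall s, 0 <= s <= 1 -> U (p (g s))) -> V (g 0) -> V (g 1).
Proof.
move=> VV oV cov disj cg gU V0.
have := @locally_constant_itv R (fun s => V (g s)) _ V0; apply; last by rewrite ler01 lexx.
move=> T T01; have [W VW WT] := cov _ (gU _ T01).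
have : nbhs T (g @^-1` W) by apply: cg; apply: open_nbhsI => //; exact: oV.
move=> /nbhs_ballP[e e0 eW]; exists e => // s t s01 t01 sT tT Vs'.
have Wg u : `|u - T| < e -> W (g u) by move=> uT; apply: eW; rewrite /ball /= distrC.
by rewrite (disj V W (g s)) //; exact: Wg.
Qed.

(** On a sheet p is injective and open, so a lift with values in the sheet inherits the continuity
    of g. *)
Lemma section_continuous_at (T : topologicalType) (V : set X') (g : T -> X) (h : T -> X') (W :
  set T) x :
  open V -> (forall a b, V a -> V b -> p a = p b -> a = b) ->
  (forall O, open O -> O `<=` V -> open (p @` O)) ->
  continuous g -> nbhs x W -> (forall y, W y -> V (h y) /\ p (h y) = g y) ->
  {for x, continuous h}.
Proof.
move=> oV inj op cg nW hW A; rewrite nbhsE => -[Q [oQ Qhx] QA].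
have [Vx px] := hW _ (nbhs_singleton nW).
have oOV : open (p @` (Q `&` V)) by apply: op; [exact: openI|move=> ? []].
have nO : nbhs x (g @^-1` (p @` (Q `&` V))).
  by apply: cg; apply: open_nbhsI => //; exists (h x).
have FF : Filter (nbhs x) by exact: nbhs_filter.
apply: (@filterS2 _ _ FF _ _ _ _ nO nW) => y /= [z [Qz Vz] pz] /hW[Vy py].
by apply: QA; rewrite (inj (h y) z) // py.
Qed.

Lemma lift_unique (g h : rpath R X') : (forall s, 0 <= s <= 1 -> p (g s) = p (h s)) ->
  g 0 = h 0 -> forall s, 0 <= s <= 1 -> g s = h s.
Proof.
move=> pgh; apply: locally_constant_itv => T T01.
have [U [Vs [oU UT cov disj VP]]] := covering_sheets (p (g T)).
have [V VV Vg] := cov _ UT; have [W WW Wh] : exists2 W, Vs W & W (h T).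
  by apply: cov; rewrite -pgh.
have [oV _ inj _ _] := VP _ VV; have [oW _ _ _ _] := VP _ WW.
have : nbhs T (g @^-1` V) by apply: (@cts_fun _ _ g); exact: open_nbhsI.
have : nbhs T (h @^-1` W) by apply: (@cts_fun _ _ h); exact: open_nbhsI.
move=> /nbhs_ballP[e e0 eW] /nbhs_ballP[e' e'0 eV].
exists (Num.min e e'); first by rewrite lt_min e0.
move=> s t s01 t01; rewrite !lt_min => /andP[s1 s2] /andP[t1 t2] ghs.
have Vu u : `|u - T| < e' -> V (g u) by move=> uT; apply: eV; rewrite /ball /= distrC.
have Wu u : `|u - T| < e -> W (h u) by move=> uT; apply: eW; rewrite /ball /= distrC.
have VW : V = W by apply: (disj V W (g s)) => //; [exact: Vu|rewrite ghs; exact: Wu].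
by apply: inj; [exact: Vu|rewrite VW; exact: Wu|exact: pgh].
Qed.

Lemma path_lifting (f : rpath R X) x' : p x' = f 0 ->
  exists2 g : rpath R X', g 0 = x' & forall s, 0 <= s <= 1 -> p (g s) = f s.
Proof.
move=> px'.
pose P t := exists2 g : rpath R X', g 0 = x' & forall s, 0 <= s <= t -> p (g s) = f s.
have P0 : P 0.
  exists (cst x') => // s s0; have -> : s = 0 by lra.
  exact: px'.
apply: (@locally_constant_itv R P _ P0); last by rewrite ler01 lexx.
move=> T T01; have [U [Vs [oU UT cov disj VP]]] := covering_sheets (f T).
have : nbhs T (f @^-1` U) by apply: (@cts_fun _ _ f); exact: open_nbhsI.
move=> /nbhs_ballP[e e0 eU]; exists e => // a b a01 b01 aT bT [g g0 pg].
have Uu u : `|u - T| < e -> U (f u) by move=> uT; apply: eU; rewrite /ball /= distrC.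
have [ba|ab] := leP b a; first by exists g => // s s01; apply: pg; lra.
have [V VV Vg] : exists2 V, Vs V & V (g a) by apply: cov; rewrite pg; [exact: Uu|lra].
have [oV VU inj surj op] := VP _ VV.
have ba0 : 0 < b - a by rewrite subr_gt0.
(* [r] retracts the line onto [a, b], so that the new piece of the lift is defined at all times and
   stays in one sheet before being glued to g at time a. *)
pose r (s : R) := a + (b - a) * clamp ((s - a) * (b - a)^-1).
have cr : continuous r.
  apply: continuous_add; first exact: continuous_cst'.
  apply: continuous_mull; apply: continuous_comp' (@clamp_continuous R).
  by apply: continuous_scale; apply: continuous_sub;
    [exact: continuous_id'|exact: continuous_cst'].
have r_ab s : a <= r s <= b.
  have /andP[c0 c1] := clamp_itv ((s - a) * (b - a)^-1); rewrite /r lerDl mulr_ge0 ?(ltW ba0) //=.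
  by rewrite -lerBrDl ler_piMr // ltW.
have rE s : a <= s <= b -> r s = s.
  move=> /andP[as_ sb]; have nz : b - a != 0 by rewrite gt_eqF.
  rewrite /r clamp_id; first by rewrite mulrC divfK // subrKC.
  rewrite mulr_ge0 ?invr_ge0 ?subr_ge0 ?(ltW ab) //= ler_pdivrMr // mul1r; lra.
have Ur s : U (f (r s)).
  by apply: Uu; have := r_ab s; move: aT bT; rewrite !ltr_norml => /andP[? ?] /andP[? ?] /andP[?
    ?];
    apply/andP; split; lra.
have /boolp.choice[h hP] s : exists z, V z /\ p z = f (r s).
  by have [z Vz pz] := surj _ (Ur s); exists z.
have ch : continuous h.
  move=> s; apply: (section_continuous_at oV inj op (g := fun s => f (r s)) (W := setT)) => //.
    by apply: continuous_comp' cr _; exact: cts_fun.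
  exact: filterT.
have cgh : continuous (fun s => if s - a <= 0 then g s else h s).
  apply: continuous_glue => //.
  - by apply: continuous_sub; [exact: continuous_id'|exact: continuous_cst'].
  - exact: cts_fun.
  move=> s /eqP; rewrite subr_eq0 => /eqP ->; have [Vh ph] := hP a.
  by apply: inj => //; rewrite ph rE ?pg //; lra.
exists (mkcts cgh); first by rewrite /= /mkcts ifT //; lra.
move=> s s01; rewrite /= /mkcts; case: (leP (s - a) 0) => sa; first by apply: pg; lra.
by have [_ ->] := hP s; rewrite rE //; lra.
Qed.

(* A map from the plane is lifted along the rays from the origin. *)
Lemma plane_lifting (F : continuousType (R * R)%type X) x' : p x' = F (0, 0) ->
  exists2 F' : continuousType (R * R)%type X', F' (0, 0) = x' & forall v, p (F' v) = F v.
Proof.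
move=> px'.
have cmul : continuous (fun q : R * (R * R) => (q.1 * q.2.1, q.1 * q.2.2)).
  have c1 : continuous (@fst R (R * R)) by move=> x; exact: cvg_fst.
  have c2 : continuous (@snd R (R * R)) by move=> x; exact: cvg_snd.
  by apply: continuous_pair; apply: continuous_mul => //; apply: continuous_comp' c2 _;
    [exact: fst_cont|exact: snd_cont].
have cray v : continuous (fun s : R => (s * v.1, s * v.2)).
  by apply: continuous_pair; apply: continuous_scale; exact: continuous_id'.
have cscale s : continuous (fun v : R * R => (s * v.1, s * v.2)).
  by apply: continuous_pair; apply: continuous_mull; [exact: fst_cont|exact: snd_cont].
have /boolp.choice[L LP] (v : R * R) : exists g : rpath R X', g 0 = x' /\
    forall s, 0 <= s <= 1 -> p (g s) = F (s * v.1, s * v.2).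
  have [|g g0 pg] := @path_lifting (F \o mkcts (cray v)) x'; last by exists g.
  by rewrite /= /mkcts !mul0r.
(* Continuity at v0 of the time-t point of the lifted rays is propagated from t = 0, where this
   point is constant, to t = 1. *)
have cE : continuous (fun v => L v 1).
  move=> v0.
  have := @locally_constant_itv R (fun t => {for v0, continuous (fun v => L v t)}) _ _ 1.
  apply; last by rewrite ler01 lexx.
    move=> T T01; have [U [Vs [oU UT cov disj VP]]] := covering_sheets (F (T * v0.1, T * v0.2)).
    have cF : continuous (fun q : R * (R * R) => F (q.1 * q.2.1, q.1 * q.2.2)).
      by apply: continuous_comp' cmul _; exact: cts_fun.
    have : nbhs (T, v0) [set q : R * (R * R) | U (F (q.1 * q.2.1, q.1 * q.2.2))].
      by apply: cF; exact: open_nbhsI.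
    move=> [[A B] [/= /nbhs_ballP[e e0 eA] nB] AB]; exists e => // a b a01 b01 aT bT ca.
    have UP s v : `|s - T| < e -> B v -> U (F (s * v.1, s * v.2)).
      by move=> sT Bv; apply: (AB (s, v)); split=> //=; apply: eA; rewrite /ball /= distrC.
    have Bv0 : B v0 by exact: nbhs_singleton.
    have [V VV Vg] : exists2 V, Vs V & V (L v0 a).
      by apply: cov; rewrite (LP v0).2 //; exact: UP.
    have [oV VU inj surj op] := VP _ VV.
    have nV : nbhs v0 [set v | V (L v a)] by apply: ca; exact: open_nbhsI.
    apply: (section_continuous_at oV inj op (g := fun v => F (b * v.1, b * v.2))
        (W := B `&` [set v | V (L v a)])).
    - by apply: continuous_comp' (cscale b) _; exact: cts_fun.
    - exact: filterI.
    move=> v [Bv Va]; split; last by rewrite (LP v).2.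
    have cg : continuous (fun s : R => L v (a + s * (b - a))).
      exact: continuous_comp' (@continuous_affine R a (b - a)) (@cts_fun _ _ (L v)).
    have itv s : 0 <= s <= 1 -> 0 <= a + s * (b - a) <= 1 /\ `|a + s * (b - a) - T| < e.
      move=> s01; move: aT bT; rewrite !ltr_norml => /andP[a1 a2] /andP[b1 b2].
      by case/orP: (convex_comb_itv a b s01) => /andP[l u]; split; apply/andP; split; lra.
    have := @path_in_sheet V Vs U _ VV (fun W VW => let: And5 oW _ _ _ _ :=
      VP W VW in oW) cov disj cg.
    rewrite mul0r addr0 mul1r subrKC; apply => // s /itv[s01 sT].
    by rewrite (LP v).2 //; exact: UP.
  have -> : (fun v => L v 0) = (fun=> x') by apply/funext => v; rewrite (LP v).1.
  exact: (@continuous_cst' _ X' x' v0).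
exists (mkcts cE) => [|v]; rewrite /= /mkcts.
  have := @lift_unique (L (0, 0)) (cst x') _ _ 1; apply; rewrite ?ler01 ?lexx //.
    by move=> s s01; rewrite (LP _).2 // !mulr0 -px'.
  by rewrite (LP _).1.
by rewrite (LP v).2 ?ler01 ?lexx // !mul1r -surjective_pairing.
Qed.

(** The whole square is lifted, and uniqueness of path lifting identifies its four sides. *)
Lemma homotopic_lift (f g : rpath R X) (f' g' : rpath R X') :
  (forall s, 0 <= s <= 1 -> p (f' s) = f s) -> (forall s, 0 <= s <= 1 -> p (g' s) = g s) ->
  f' 0 = g' 0 -> path_homotopic f g -> path_homotopic f' g'.
Proof.
have o0 : 0 <= (0 : R) <= 1 by rewrite lexx ler01.
have o1 : 0 <= (1 : R) <= 1 by rewrite lexx ler01.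
move=> pf pg fg0 [H HP].
have [|F F0 pF] := @plane_lifting H (f' 0).
  by have [-> _ _ _] := HP _ o0; rewrite pf.
have cl (u : R) : continuous (fun s : R => (u, s)).
  by apply: continuous_pair; [exact: continuous_cst'|exact: continuous_id'].
have cr (u : R) : continuous (fun s : R => (s, u)).
  by apply: continuous_pair; [exact: continuous_id'|exact: continuous_cst'].
have left s : 0 <= s <= 1 -> F (0, s) = f' s.
  apply: (lift_unique (g := F \o mkcts (cl 0))) => // {}s s01 /=.
  by rewrite pF; have [-> _ _ _] := HP _ s01; rewrite pf.
have bottom s : 0 <= s <= 1 -> F (s, 0) = f' 0.
  apply: (lift_unique (g := F \o mkcts (cr 0)) (h := cst (f' 0))) => // {}s s01 /=.
  by rewrite pF; have [_ _ -> _] := HP _ s01; rewrite pf.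
have right s : 0 <= s <= 1 -> F (1, s) = g' s.
  apply: (lift_unique (g := F \o mkcts (cl 1))) => [{}s s01 /=|/=].
    by rewrite pF; have [_ -> _ _] := HP _ s01; rewrite pg.
  by rewrite /mkcts bottom.
have top s : 0 <= s <= 1 -> F (s, 1) = f' 1.
  apply: (lift_unique (g := F \o mkcts (cr 1)) (h := cst (f' 1))) => [{}s s01 /=|/=].
    by rewrite pF; have [_ _ _ ->] := HP _ s01; rewrite pf.
  by rewrite /mkcts left.
by exists F => s s01; split; auto.
Qed.

End Coverings.

(** * Twisted homology of the maximal abelian cover *)

Section LinSpan.
Variables (A : comNzRingType) (V : lmodType A).
Implicit Types S T : set V.

Lemma lin_span_submodule S : is_submodule (lin_span S).
Proof.
split=> [|_ _ [s [sS ->]] [t [tS ->]]|a _ [s [sS ->]]].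
- by exists [::]; rewrite big_nil.
- exists (s ++ t); rewrite big_cat; split=> // q; rewrite mem_cat => /orP[/sS|/tS] //.
- exists [seq (a * q.1, q.2) | q <- s]; split=> [q /mapP[r /sS rS ->] //|].
  by rewrite big_map scaler_sumr; apply: eq_bigr => q _; rewrite scalerA.
Qed.

Lemma mem_lin_span S v : S v -> lin_span S v.
Proof.
move=> Sv; exists [:: (1, v)]; rewrite big_seq1 scale1r; split=> // q.
by rewrite inE => /eqP ->.
Qed.

Lemma lin_span_sub S T : is_submodule T -> (forall v, S v -> T v) -> forall v, lin_span S v ->
  T v.
Proof.
move=> sT ST _ [s [sS ->]]; rewrite big_seq; elim/big_ind: _ => [|x y|q qs].
- exact: (submod0 sT).
- exact: (submodD sT).
- by apply: (submodZ sT); apply: ST; exact: sS.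
Qed.
End LinSpan.

Section H1Homomorphism.
Variables (R : realType) (X : topologicalType) (G : zmodType) (phi : chains R 1 X int -> G).
Hypothesis hphi : is_H1_hom phi.
Local Notation pc := (@path_chain R X int).
Local Notation cycle c := (boundary c = 0).

Lemma boundaryB c c' : @boundary R 0 X int (c - c') = boundary c - boundary c'.
Proof. exact: fgliftB. Qed.
Lemma boundaryD c c' : @boundary R 0 X int (c + c') = boundary c + boundary c'.
Proof. exact: fgliftD. Qed.

(** [phi] is constrained only on cycles, which is why cycle conditions accompany every computation
    with it. *)
Lemma H1_hom_congr c c' : cycle c -> cycle c' -> boundaries (c - c') -> phi c = phi c'.
Proof.
move=> zc zc' [e ee]; rewrite -(subrK c' c) -ee (hphi.1) ?hphi.2 ?add0r //.
by rewrite ee boundaryB zc zc' subrr.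
Qed.

Lemma H1_hom0 : phi 0 = 0.
Proof. by rewrite -(hphi.2 0) /boundary fglift0. Qed.

Lemma H1_homD c c' : cycle c -> cycle c' -> phi (c + c') = phi c + phi c'.
Proof. exact: hphi.1. Qed.

Lemma cycle_path (f : rpath R X) : f 0 = f 1 -> cycle (pc f).
Proof. by move=> f01; rewrite boundary_path f01 subrr. Qed.

End H1Homomorphism.

Section AbelianCover.
Variables (R : realType) (X' X : topologicalType) (p : continuousType X' X).
Hypothesis hp : is_max_abelian_cover R p.
Variables (G : zmodType) (phi : chains R 1 X int -> G).
Hypothesis hphi : is_H1_hom phi.
Local Notation pc f := (path_chain int (p \o f : rpath R X)).
Local Notation RG := (group_ring G).
Let cov : is_covering p. Proof. by case: hp. Qed.

Lemma cover_path (x y : X') : exists f : rpath R X', f 0 = x /\ f 1 = y.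
Proof. by case: hp => _ pcn _ _; exact: pcn. Qed.

Lemma cover_surj x : exists x', p x' = x.
Proof. by case: cov. Qed.

Lemma cover_deck x y : p x = p y -> exists d, is_deck p d /\ d x = y.
Proof. by case: hp => _ _ h _; exact: h. Qed.

(* The two paths form a loop upstairs, hence a null-homologous loop downstairs. *)
Lemma phi_same_ends (f g : rpath R X') : f 0 = g 0 -> f 1 = g 1 -> phi (pc f - pc g) = 0.
Proof.
move=> fg0 fg1; have sB := boundaries_submodule R X int.
have e : f 1 = (path_rev g) 0 by rewrite path_rev0.
have [_ _ _ nul] := hp; have := nul (path_cat f (path_rev g)).
rewrite path_cat0 path_cat1 // path_rev1 fg0 => /(_ erefl)[/(_ erefl)[c bc] _].
rewrite -(H1_hom0 hphi); apply: (H1_hom_congr hphi).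
- by rewrite boundaryB !boundary_path /= fg0 fg1 subrr.
- by rewrite /boundary fglift0.
have h1 : boundaries (pc f + path_chain int (path_rev (p \o g :
  rpath R X)) - pc (path_cat f (path_rev g))).
  rewrite (path_chain_eq int (f := p \o path_cat f (path_rev g))
     (g := path_cat (p \o f : rpath R X) (path_rev (p \o g : rpath R X)))).
    by apply: boundaries_cat; rewrite path_rev0 /= fg1.
  move=> s s01 /=; rewrite !path_catE //; last by rewrite path_rev0 /= fg1.
  by case: ifP.
have h2 : boundaries (pc (path_cat f (path_rev g))) by exists c.
have h3 := boundaries_rev int (p \o g : rpath R X).
have := submodB sB (submodD sB h1 h2) h3.
by rewrite subrK subr0 opprD addrACA [_ - path_chain _ (path_rev _)]subrr addr0.
Qed.

(** The chain c closes up the paths, since the value of [phi] is controlled on cycles only. *)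
Lemma phi_path_cat (f g h : rpath R X') : f 1 = g 0 -> h 0 = f 0 -> h 1 = g 1 ->
  forall c, boundary (pc h - c) = 0 -> phi (pc h - c) = phi (pc f + pc g - c).
Proof.
move=> fg h0 h1 c zc; have sB := boundaries_submodule R X int.
have zh : boundary (pc h - pc (path_cat f g)) = 0.
  by rewrite boundaryB !boundary_path /= h0 h1 path_cat0 path_cat1 // subrr.
have E : boundaries (pc f + pc g - pc (path_cat f g)).
  rewrite (path_chain_eq int (f := p \o path_cat f g)
     (g := path_cat (p \o f : rpath R X) (p \o g : rpath R X))).
    by apply: boundaries_cat; rewrite /= fg.
  by move=> s s01 /=; rewrite !path_catE /= ?fg //; case: ifP.
have zc' : boundary (pc (path_cat f g) - c) = 0.
  by rewrite -zc !boundaryB !boundary_path /= h0 h1 path_cat0 path_cat1.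
rewrite -[pc h](subrK (pc (path_cat f g))) -addrA [LHS](H1_homD hphi) //.
rewrite phi_same_ends ?add0r ?path_cat0 ?path_cat1 //.
apply: (H1_hom_congr hphi) => //; last first.
  by rewrite opprB addrA subrK; apply: (submod_sym sB).
rewrite -zc !boundaryB boundaryD !boundary_path /= h0 h1 fg.
by rewrite [X in X - _]addrC addrA subrK.
Qed.

(* the image in G of the deck transformation d *)
Definition deck_shift (d : continuousType X' X') (g : G) : Prop :=
  forall f : rpath R X', f 1 = d (f 0) -> phi (pc f) = g.

(** Let g join the start of h to the start of f. Then h followed by d g, and g followed by f, have
    the same ends, while g and d g have the same projection; so h and f have the same value. *)
Lemma deck_shift_path d (f : rpath R X') : is_deck p d -> f 1 = d (f 0) ->
  deck_shift d (phi (pc f)).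
Proof.
move=> [_ pd] fd h hd; have [g [g0 g1]] := cover_path (h 0) (f 0).
pose dg : rpath R X' := d \o g.
have pdg : pc dg = pc g by apply: path_chain_eq => s _ /=; rewrite pd.
have e1 : h 1 = dg 0 by rewrite hd /= g0.
have e2 : g 1 = f 0 by [].
have [k [k0 k1]] := cover_path (h 0) (f 1).
have zk : boundary (pc k - pc g) = 0.
  by rewrite boundaryB !boundary_path /= k0 k1 g0 g1 fd pd subrr.
have E1 := phi_path_cat (f := h) (g := dg) (h := k) e1 k0 _ zk.
have E2 := phi_path_cat (f := g) (g := f) (h := k) e2 _ k1 zk.
have : phi (pc h + pc dg - pc g) = phi (pc g + pc f - pc g).
  by rewrite -E1 ?k1 ?fd /= ?g1 // E2 // k0 g0.
by rewrite pdg addrK addrC addKr.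
Qed.

Lemma deck_shift_ex d : is_deck p d -> exists g, deck_shift d g.
Proof.
move=> hd; have [x0|nx] := pselect (exists x : X', True); last first.
  by exists 0 => f; case: nx; exists (f 0).
have [x _] := x0; have [f [f0 f1]] := cover_path x (d x).
by exists (phi (pc f)); apply: deck_shift_path; rewrite // f1 f0.
Qed.

End AbelianCover.

Lemma is_loop_cat (R : realType) (X : topologicalType) (x : X) (f g : rpath R X) :
  is_loop x f -> is_loop x g -> is_loop x (path_cat f g).
Proof.
by move=> [f0 f1] [g0 g1]; split; rewrite ?path_cat0 // path_cat1 // f1.
Qed.

Section TwistedComplex.
Variables (R : realType) (X' X : topologicalType) (p : continuousType X' X).
Variables (G : zmodType) (phi : chains R 1 X int -> G) (Y : set X).
Local Notation RG := (group_ring G).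
Local Notation tz k := (@twisted_zero R X' X p G phi Y k).
Local Notation bd := (@twisted_bound R X' X p G phi Y 0).
Local Notation cyc := (@twisted_cycle R X' X p G phi Y 0).

Lemma twisted_zero_submodule k : is_submodule (tz k).
Proof. exact: lin_span_submodule. Qed.

Lemma twisted_bound_submodule : is_submodule bd.
Proof.
have sT := twisted_zero_submodule 1.
split=> [|c c' [e ce] [e' ce']|a c [e ce]].
- by exists 0; rewrite /boundary fglift0 subrr; exact: submod0 sT.
- exists (e + e'); rewrite /boundary fgliftD opprD addrACA.
  exact: (submodD sT).
- exists (a *: e); rewrite /boundary fgliftZ -scalerBr.
  exact: (submodZ sT).
Qed.

Lemma twisted_cycle_submodule : is_submodule cyc.
Proof.
have sT := twisted_zero_submodule 0.
split=> [|c c' zc zc'|a c zc]; rewrite /twisted_cycle /= /boundary ?fglift0 ?fgliftD ?fgliftZ.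
- exact: (submod0 sT).
- exact: (submodD sT).
- exact: (submodZ sT).
Qed.

Lemma twisted_bound_boundaries c : boundaries c -> bd c.
Proof.
by case=> e <-; exists e; rewrite subrr; exact: submod0 (twisted_zero_submodule 1).
Qed.

Lemma twisted_bound_zero c : tz 1 c -> bd c.
Proof. by move=> tc; exists 0; rewrite /boundary fglift0 subr0. Qed.

Lemma twisted_zero_deck k (d : continuousType X' X') (f : rpath R X') (s : simplex R k X') :
  is_deck p d -> f 1 = d (f 0) ->
  tz k (<< (d \o s : simplex R k X') >>
        - group_elt (phi (path_chain int (p \o f : rpath R X))) *: << s >>).
Proof. by move=> hd fd; apply: mem_lin_span; left; exists d, f, s. Qed.

Lemma twisted_zero_over k (s : simplex R k X') : (forall v, Y (p (s v))) -> tz k << s >>.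
Proof. by move=> Ys; apply: mem_lin_span; right; exists s. Qed.

Lemma twisted_bound_deck (d : continuousType X' X') g (f : rpath R X') :
  is_max_abelian_cover R p -> is_H1_hom phi -> is_deck p d -> deck_shift p phi d g ->
  bd (path_chain RG (d \o f : rpath R X') - group_elt g *: path_chain RG f).
Proof.
move=> hp hphi hd dg; apply: twisted_bound_zero.
have [h [h0 h1]] := cover_path hp (f 0) (d (f 0)).
rewrite -(dg h) ?h0 //.
have := twisted_zero_deck (f \o @edge_coord R : simplex R 1 X') hd (f := h).
rewrite h0 => /(_ h1).
by congr (tz _ (_ - _)); congr [freeg [:: (_, _)]]; apply/continuousEP.
Qed.

Lemma path_edge_inj (Z : topologicalType) (f g : rpath R Z) :
  (f \o @edge_coord R : simplex R 1 Z) = (g \o @edge_coord R : simplex R 1 Z) ->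
  forall s, 0 <= s <= 1 -> f s = g s.
Proof.
move=> /continuousEP fg s /andP[s0 s1].
have hw : \row_(j < 2) (if j == 0 then 1 - s else s) \in @stdsimplex R 1.
  apply/mem_set; split=> [i|]; first by rewrite mxE; case: ifP => _; lra.
  by rewrite big_ord_recl big_ord1 !mxE /=; lra.
by have := fg (simplex_point hw); rewrite /= /edge_coord /= mxE.
Qed.

End TwistedComplex.

(** * Twisted homology computed from a crossed homomorphism on loops *)

Section TwistedPresentation.
Variables (R : realType) (X' X : topologicalType) (p : continuousType X' X).
Hypothesis hp : is_max_abelian_cover R p.
Variables (G : zmodType) (phi : chains R 1 X int -> G).
Hypothesis hphi : is_H1_hom phi.
Variables (x0 : X').
Local Notation b := (p x0).
Local Notation pc f := (path_chain int (p \o f : rpath R X)).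
Local Notation RG := (group_ring G).
Local Notation tz k := (@twisted_zero R X' X p G phi [set b] k).
Local Notation bd := (@twisted_bound R X' X p G phi [set b] 0).
Local Notation cyc := (@twisted_cycle R X' X p G phi [set b] 0).
Let cov : is_covering p. Proof. by case: hp. Qed.
Let sbd : is_submodule bd. Proof. exact: twisted_bound_submodule. Qed.

Variables (V : lmodType RG) (N : set V) (D : rpath R X -> V).
Hypothesis sN : is_submodule N.
Hypothesis D_homotopic : forall f g, is_loop b f -> is_loop b g -> path_homotopic f g ->
  N (D f - D g).
Hypothesis D_cat : forall f g, is_loop b f -> is_loop b g ->
  N (D (path_cat f g) - (D f + group_elt (phi (path_chain int f)) *: D g)).

(** The base point is tethered by the constant path, so that simplices lying over it close up to
    trivial loops. *)
Lemma tether_ex (x : X) : exists k : rpath R X, [/\ k 0 = b, k 1 = x & x = b -> k = cst b].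
Proof.
have [->|xb] := pselect (x = b); first by exists (cst b).
have [y yx] := cover_surj hp x; have [f [f0 f1]] := cover_path hp x0 y.
by exists (p \o f : rpath R X); rewrite /= f0 f1.
Qed.

Definition tether x : rpath R X := projT1 (cid (tether_ex x)).

Lemma tetherP x : [/\ tether x 0 = b, tether x 1 = x & x = b -> tether x = cst b].
Proof. exact: projT2 (cid (tether_ex x)). Qed.
Lemma tether0 x : tether x 0 = b. Proof. by case: (tetherP x). Qed.
Lemma tether1 x : tether x 1 = x. Proof. by case: (tetherP x). Qed.
Lemma tether_base : tether b = cst b. Proof. by case: (tetherP b) => _ _; exact. Qed.

Lemma upstairs_ex (x : X') : exists f : rpath R X', f 0 = x0 /\ f 1 = x.
Proof. exact: (cover_path hp). Qed.

Definition upstairs x : rpath R X' := projT1 (cid (upstairs_ex x)).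
Lemma upstairs0 x : upstairs x 0 = x0. Proof. by have [] := projT2 (cid (upstairs_ex x)). Qed.
Lemma upstairs1 x : upstairs x 1 = x. Proof. by have [] := projT2 (cid (upstairs_ex x)). Qed.

Definition closing (f : rpath R X') : rpath R X :=
  based_loop (tether (p (f 0))) (p \o f) (tether (p (f 1))).

Lemma closing_loop f : is_loop b (closing f).
Proof. by apply: based_loop_is_loop; rewrite ?tether0 ?tether1. Qed.

Lemma closing_chain f : boundaries (path_chain int (closing f) -
  (path_chain int (tether (p (f 0))) + pc f - path_chain int (tether (p (f 1))))).
Proof.
have sB := boundaries_submodule R X int.
have e1 : tether (p (f 0)) 1 = (p \o f : rpath R X) 0 by rewrite tether1.
have e2 : (path_cat (tether (p (f 0))) (p \o f)) 1 = (path_rev (tether (p (f 1)))) 0.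
  by rewrite path_cat1 ?path_rev0 ?tether1.
have h1 := boundaries_cat int e1; have h2 := boundaries_cat int e2.
have h3 := boundaries_rev int (tether (p (f 1))).
apply: (submod_sym sB).
have := submodB sB (submodD sB h1 h2) h3.
set u := path_chain _ _ + _; set c := path_chain _ (path_cat _ _); rewrite -/(closing f).
set k := path_chain _ (tether _); set r := path_chain _ (path_rev _);
  set l := path_chain _ (closing f).
suff -> : u - c + (c + r - l) - (k + r) = u - k - l by [].
rewrite !addrA subrK [k + r]addrC opprD addrA [u + r - l]addrAC addrK.
by rewrite addrAC.
Qed.

(** The sheet of x: the image in G of a deck transformation taking the end of the tether of [p x],
    lifted from [x0], to x. *)
Definition displacement (x : X') : G := phi (pc (upstairs x) - path_chain int (tether (p x))).

Lemma displacement_cycle x (f : rpath R X') : f 0 = x0 -> f 1 = x ->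
  boundary (pc f - path_chain int (tether (p x))) = 0.
Proof. by move=> f0 f1; rewrite boundaryB !boundary_path /= f0 f1 tether0 tether1 subrr. Qed.

Lemma displacementE x (f : rpath R X') : f 0 = x0 -> f 1 = x ->
  displacement x = phi (pc f - path_chain int (tether (p x))).
Proof.
move=> f0 f1; rewrite /displacement -(subrK (pc f) (pc (upstairs x))) -addrA.
rewrite [LHS](H1_homD hphi); last 2 first.
- by rewrite boundaryB !boundary_path /= f0 f1 upstairs0 upstairs1 subrr.
- exact: displacement_cycle.
by rewrite (phi_same_ends hp hphi) ?add0r // ?f0 ?f1 ?upstairs0 ?upstairs1.
Qed.

(** This cocycle rule is what matches the twist in the product rule of D. *)
Lemma displacement_path (f : rpath R X') :
  displacement (f 1) = displacement (f 0) + phi (path_chain int (closing f)).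
Proof.
have e : upstairs (f 0) 1 = f 0 by rewrite upstairs1.
have h0 : path_cat (upstairs (f 0)) f 0 = x0 by rewrite path_cat0 upstairs0.
have h1 : path_cat (upstairs (f 0)) f 1 = f 1 by rewrite path_cat1.
rewrite (displacementE h0 h1).
rewrite (phi_path_cat hp hphi e) ?path_cat0 //; last exact: displacement_cycle.
set k0 := path_chain int (tether (p (f 0))); set k1 := path_chain int (tether (p (f 1))).
have -> : pc (upstairs (f 0)) + pc f - k1 = (pc (upstairs (f 0)) - k0) + (k0 + pc f - k1).
  by rewrite !addrA subrK.
have zc : boundary (k0 + pc f - k1) = 0.
  rewrite boundaryB boundaryD !boundary_path /= !tether0 !tether1.
  by rewrite [_ - _ + (_ - _)]addrC addrA subrK subrr.
rewrite [LHS](H1_homD hphi) //; last by apply: displacement_cycle; rewrite ?upstairs0 ?upstairs1.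
congr (_ + _); apply: (H1_hom_congr hphi) => //.
  by apply: cycle_path; rewrite (closing_loop f).1 (closing_loop f).2.
by apply: (submod_sym (boundaries_submodule R X int)); exact: closing_chain.
Qed.

Lemma displacement_base : displacement x0 = 0.
Proof.
have -> : displacement x0 = phi (pc (cst x0) - path_chain int (tether b)) by exact: displacementE.
rewrite tether_base (path_chain_eq int (f := p \o cst x0) (g := cst b)) ?subrr //.
exact: H1_hom0.
Qed.

Lemma closing_base (f : rpath R X') : p (f 0) = b -> p (f 1) = b ->
  path_homotopic (closing f) (p \o f : rpath R X).
Proof.
move=> f0 f1; rewrite /closing f0 f1 tether_base.
pose c : rpath R X := cst b.
apply: (@homotopic_trans _ _ (path_cat (p \o f : rpath R X) (path_rev c))).
  apply: homotopic_cat (homotopic_refl _); first by rewrite path_cat1 /= ?f1.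
  have := homotopic_cat1l (p \o f : rpath R X); rewrite /= f0; exact.
apply: (homotopic_reparam (f := p \o f) (u := fun s => if s <= 2^-1 then 2 * s + 0 else 0 * s +
  1) (v := fun s => s)) => //.
- by apply: continuous_glueR; [exact: continuous_lin|exact: continuous_lin|lra].
- exact: continuous_id'.
- by rewrite ifT; lra.
- by rewrite ifF; try (apply/negbTE; rewrite -ltNge); lra.
move=> s s01; rewrite path_catE /= ?f1 //; case: ifP => _; first by rewrite addr0.
by rewrite /= mul0r add0r f1.
Qed.

Lemma displacement_deck d g x : is_deck p d -> deck_shift p phi d g ->
  displacement (d x) = displacement x + g.
Proof.
move=> hd dg; have [f [f0 f1]] := cover_path hp x (d x).
rewrite -f1 displacement_path f0 -(dg f) ?f0 //; congr (_ + _).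
have sB := boundaries_submodule R X int.
apply: (H1_hom_congr hphi).
- by apply: cycle_path; rewrite (closing_loop f).1 (closing_loop f).2.
- by apply: cycle_path; rewrite /= f0 f1 hd.2.
have := closing_chain f; rewrite f0 f1 hd.2.
by rewrite [_ + pc f]addrC addrK.
Qed.

Definition simplex_path (s : simplex R 1 X') : rpath R X' := projT1 (cid (simplex1_eq s)).
Lemma simplex_pathE s : s = (simplex_path s \o @edge_coord R : simplex R 1 X').
Proof. exact: projT2 (cid (simplex1_eq s)). Qed.

(** D is extended to paths of the cover: the projection is closed up by tethers, and the sheet of
    the starting point supplies the coefficient. *)
Definition cross_value (f : rpath R X') : V := group_elt (displacement (f 0)) *: D (closing f).
Definition cross_chain (c : chains R 1 X' RG) : V :=
  fglift (fun s => cross_value (simplex_path s)) c.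

Lemma cross_value_eq (f g : rpath R X') : (forall s, 0 <= s <= 1 -> f s = g s) ->
  N (cross_value f - cross_value g).
Proof.
move=> fg; have e0 : f 0 = g 0 by apply: fg; rewrite lexx ler01.
have e1 : f 1 = g 1 by apply: fg; rewrite lexx ler01.
rewrite /cross_value e0 -scalerBr; apply: (submodZ sN); apply: D_homotopic;
  try exact: closing_loop.
rewrite /closing e0 e1; apply: based_loop_homotopic; rewrite ?tether1 /= ?e0 ?e1 //.
by apply: homotopic_eq => s /fg /= ->.
Qed.

Lemma cross_chain_path (f : rpath R X') : N (cross_chain (path_chain RG f) - cross_value f).
Proof.
rewrite /cross_chain fgliftU; apply: cross_value_eq; apply: path_edge_inj.
by rewrite -simplex_pathE.
Qed.

Lemma D_closing_cat (f g : rpath R X') : f 1 = g 0 ->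
  N (D (closing (path_cat f g)) - (D (closing f) + group_elt (phi (path_chain int (closing f)))
    *: D (closing g))).
Proof.
move=> fg; apply: (submod_trans sN) (D_cat (closing_loop f) (closing_loop g)).
have e : closing f 1 = closing g 0 by rewrite (closing_loop f).2 (closing_loop g).1.
apply: D_homotopic; first exact: closing_loop.
  by apply: is_loop_cat; exact: closing_loop.
apply: homotopic_sym; rewrite /closing path_cat0 path_cat1 //.
have h := @based_loop_cat R X (tether (p (f 0))) (p \o f) (tether (p (f 1))) (p \o g) (tether (p
  (g 1))).
apply: (@homotopic_trans _ _ (based_loop (tether (p (f 0))) (path_cat (p \o f) (p \o g)) (tether
  (p (g 1))))).
  by rewrite -fg; apply: h; rewrite ?tether1 ?tether0 //= fg.
apply: based_loop_homotopic; rewrite ?path_cat0 ?path_cat1 ?tether1 //= ?fg //.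
by apply: homotopic_eq => s s01; rewrite /= !path_catE /= ?fg //; case: ifP.
Qed.

(** The coefficient in the crossed product rule is exactly the change of displacement along f. *)
Lemma cross_value_cat (f g h : rpath R X') : f 1 = g 0 -> path_homotopic (path_cat f g) h ->
  N (cross_value f + cross_value g - cross_value h).
Proof.
move=> fg fgh; have [e0 e1] := homotopic_ends fgh.
have f0 : f 0 = h 0 by rewrite -e0 path_cat0.
rewrite /cross_value -fg displacement_path group_eltD -f0 -scalerA -scalerDr -scalerBr.
apply: (submodZ sN); apply: (submod_sym sN).
apply: (submod_trans sN) (D_closing_cat fg); apply: D_homotopic; try exact: closing_loop.
apply: homotopic_sym; rewrite /closing e0 e1; apply: based_loop_homotopic; rewrite ?tether1 //=.
- by rewrite -e0.
- by rewrite -e1.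
have [H HP] := fgh; exists (p \o H) => s s01 /=.
by have [-> -> -> ->] := HP _ s01.
Qed.

Lemma cross_chain_submodule : is_submodule [set c : chains R 1 X' RG | N (cross_chain c)].
Proof.
split; rewrite /= /cross_chain.
- by rewrite fglift0; exact: submod0.
- by move=> x y; rewrite fgliftD; exact: submodD.
- by move=> a x; rewrite fgliftZ; exact: submodZ.
Qed.

(** Two consecutive sides of a triangle are homotopic in the plane to the third, so
    [cross_value_cat] applies. *)
Lemma cross_chain_boundary (e : chains R 2 X' RG) : N (cross_chain (boundary e)).
Proof.
have sS : is_submodule [set e : chains R 2 X' RG | N (cross_chain (boundary e))].
  exact: (boundary_submodule cross_chain_submodule).
apply: (freeg_spanned sS) => s /=.
have [F ->] := simplex2_eq s; rewrite boundary_triangle.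
set f := _ \o segment (0, 0) (1, 0); set g := _ \o segment (1, 0) (0, 1);
  set h := _ \o segment (0, 0) (0, 1).
rewrite /cross_chain fgliftD fgliftB -!/(cross_chain _).
have fg : (f : rpath R X') 1 = (g : rpath R X') 0.
  by rewrite /f /g /= /segment /= !mul1r !mul0r !addr0 !subrKC.
have fgh : path_homotopic (path_cat f g) h.
  pose u : rpath R (R * R)%type := path_cat (segment (0, 0) (1, 0) : rpath R (R * R)%type)
    (segment (1, 0) (0, 1) : rpath R (R * R)%type).
  have e' : segment ((0, 0) : R * R) (1, 0) 1 = segment ((1, 0) : R * R) (0, 1) 0.
    by rewrite /segment /= !mul1r !mul0r !addr0 !subrKC.
  have cv := @segment_continuous R (0, 0) (0, 1).
  have h1 := @homotopic_plane R X' F u _ (@cts_fun _ _ u) cv.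
  have u0 : u 0 = segment (0, 0) (0, 1) 0 by rewrite /u path_cat0 /= /segment /= !mul0r.
  have u1 : u 1 = segment (0, 0) (0, 1) 1 by rewrite /u path_cat1 // /= /segment /= !mul1r
    !subrKC.
  apply: homotopic_trans _ (h1 u0 u1); apply: homotopic_eq => v v01.
  by rewrite path_catE //= /mkcts /u path_catE //; case: ifP.
have h1 := cross_value_cat fg fgh.
have hN : N (- cross_chain (path_chain RG h) - - cross_value h).
  by rewrite -opprD; apply: (submodN sN); exact: cross_chain_path.
have h2 := submod_congr sN (submod_congr sN (cross_chain_path g) hN) (cross_chain_path f).
have h3 : N (cross_value g - cross_value h + cross_value f) by rewrite addrC addrA.
by have := submodD sN h2 h3; rewrite subrK.
Qed.

Lemma D_cst : N (D (cst b)).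
Proof.
have lc : is_loop b (cst b : rpath R X) by [].
have := D_cat lc lc; have -> : phi (path_chain int (cst b : rpath R X)) = 0.
  rewrite -(H1_hom0 hphi); apply: (H1_hom_congr hphi); first exact: cycle_path.
    by rewrite /boundary fglift0.
  by rewrite subr0; exact: boundaries_cst.
rewrite group_elt0 scale1r => h.
have h' : N (D (path_cat (cst b : rpath R X) (cst b)) - D (cst b)).
  apply: D_homotopic => //; first exact: is_loop_cat.
  by apply: homotopic_eq => s s01; rewrite path_catE //; case: ifP.
have := submodB sN h' h; by rewrite opprB addrC addrA subrK addrK.
Qed.

(** A deck transformation keeps the closing loop up to homotopy and shifts the displacement by its
    image in G; a path over the base point closes up to the constant loop, on which D vanishes
    modulo N. *)
Lemma cross_chain_zero c : tz 1 c -> N (cross_chain c).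
Proof.
apply: (lin_span_sub cross_chain_submodule) => _ [[d [f [s [hd fd ->]]]]|[s [Ys ->]]] /=.
  have dg := deck_shift_path hp hphi hd fd; set g := phi _ in dg *.
  rewrite /cross_chain fgliftB fgliftZ -!/(cross_chain _) (simplex_pathE s).
  set q := simplex_path s.
  have hq := cross_chain_path q.
  have hdq := cross_chain_path (d \o q : rpath R X').
  have E : N (cross_value (d \o q : rpath R X') - group_elt g *: cross_value q).
    rewrite /cross_value /= (displacement_deck _ hd dg) group_eltD mulrC -scalerA -!scalerBr.
    do 2 apply: (submodZ sN); apply: D_homotopic; try exact: closing_loop.
    rewrite /closing /= !hd.2; apply: based_loop_homotopic; rewrite /= ?tether1 ?hd.2 //.
    by apply: homotopic_eq => u _ /=; rewrite hd.2.
  apply: (submod_trans sN) _ (submod_trans sN E _).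
    by move: hdq; congr (N (cross_chain _ - _)); congr [freeg [:: (_, _)]]; apply/continuousEP.
  by rewrite -scalerBr; apply: (submodZ sN); apply: (submod_sym sN).
rewrite (simplex_pathE s); set q := simplex_path s.
have pq u : 0 <= u <= 1 -> p (q u) = b.
  apply: (path_edge_inj (f := p \o q) (g := cst b)); apply/continuousEP => v /=.
  by have := Ys v; rewrite {1}(simplex_pathE s).
have -> : cross_chain << (q \o @edge_coord R : simplex R 1 X') >> =
    cross_chain (path_chain RG q) - cross_value q + cross_value q by rewrite subrK.
apply: (submodD sN) (cross_chain_path q) _; apply: (submodZ sN).
have q0 : p (q 0) = b by apply: pq; rewrite lexx ler01.
have q1 : p (q 1) = b by apply: pq; rewrite lexx ler01.
rewrite -[D _](subrK (D (cst b))); apply: (submodD sN) D_cst.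
apply: D_homotopic; [exact: closing_loop|by []|].
apply: homotopic_trans (closing_base q0 q1) _.
by apply: homotopic_eq => u /pq.
Qed.

Lemma cross_chain_bound c : bd c -> N (cross_chain c).
Proof.
move=> [e /cross_chain_zero]; rewrite /cross_chain fgliftB => /(submodD sN) h.
by have := h _ (cross_chain_boundary e); rewrite subrK.
Qed.

Lemma cross_value_lift (f : rpath R X) (f' : rpath R X') : is_loop b f -> f' 0 = x0 ->
  (forall s, 0 <= s <= 1 -> p (f' s) = f s) -> N (cross_value f' - D f).
Proof.
move=> lf f0 pf; rewrite /cross_value f0 displacement_base group_elt0 scale1r.
have o0 : p (f' 0) = b by rewrite f0.
have o1 : p (f' 1) = b by rewrite pf ?lexx ?ler01 // lf.2.
apply: D_homotopic => //; first exact: closing_loop.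
by apply: homotopic_trans (closing_base o0 o1) _; apply: homotopic_eq.
Qed.

Variable Psi : V -> chains R 1 X' RG.
Hypothesis PsiZ : forall a v, Psi (a *: v) = a *: Psi v.
Hypothesis PsiD : forall v w, Psi (v + w) = Psi v + Psi w.
Hypothesis Psi_lift : forall (f : rpath R X) (f' : rpath R X'), is_loop b f -> f' 0 = x0 ->
  (forall s, 0 <= s <= 1 -> p (f' s) = f s) -> bd (path_chain RG f' - Psi (D f)).

(** The tether is lifted so as to end at x, by lifting its reverse; its start is then some point
    over the base point, usually not [x0]. *)
Lemma cotether_ex (x : X') : exists f : rpath R X', f 1 = x /\
  forall s, 0 <= s <= 1 -> p (f s) = tether (p x) s.
Proof.
have e : p x = path_rev (tether (p x)) 0 by rewrite path_rev0 tether1.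
have [g g0 pg] := path_lifting cov e; exists (path_rev g); rewrite path_rev1; split=> // s s01.
rewrite path_revE pg; first by rewrite path_revE; congr (tether _ _); lra.
by move/andP: s01 => [? ?]; apply/andP; split; lra.
Qed.

Definition cotether x : rpath R X' := projT1 (cid (cotether_ex x)).
Lemma cotether1 x : cotether x 1 = x.
Proof. by have [] := projT2 (cid (cotether_ex x)). Qed.
Lemma cotetherP x s : 0 <= s <= 1 -> p (cotether x s) = tether (p x) s.
Proof. by have [_ h] := projT2 (cid (cotether_ex x)); exact: h. Qed.
Lemma cotether0 x : p (cotether x 0) = b.
Proof. by rewrite cotetherP ?tether0 // lexx ler01. Qed.

Lemma displacement_cotether x : displacement x = displacement (cotether x 0).
Proof.
rewrite -{1}(cotether1 x) displacement_path -[RHS]addr0; congr (_ + _).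
rewrite -(H1_hom0 hphi); apply: (H1_hom_congr hphi).
- by apply: cycle_path; rewrite (closing_loop _).1 (closing_loop _).2.
- by rewrite /boundary fglift0.
have sB := boundaries_submodule R X int.
have := closing_chain (cotether x); rewrite cotether1 cotether0 tether_base.
have -> : pc (cotether x) = path_chain int (tether (p x)) 
  by apply: path_chain_eq => s s01; exact: cotetherP.
by rewrite addrK => h; have := submodD sB h (boundaries_cst R int b); rewrite subrK subr0.
Qed.

(** The lifted tether of the start, f, and the reversed lifted tether of the end form a path L over
    the closing loop. L is a deck translate of the lift of that loop at [x0], whose class is given
    by Psi, and the class of L is also the sum of its three pieces. *)
Lemma path_decomposition (f : rpath R X') :
  bd (path_chain RG f -
      (Psi (cross_value f) + (path_chain RG (cotether (f 1)) - path_chain RG (cotether (f 0))))).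
Proof.
set k0 := cotether (f 0); set k1 := cotether (f 1).
have e0 : k0 1 = f 0 by rewrite /k0 cotether1.
have e1 : (path_cat k0 f) 1 = (path_rev k1) 0 by rewrite path_cat1 // path_rev0 /k1 cotether1.
pose L := path_cat (path_cat k0 f) (path_rev k1).
have pL s : 0 <= s <= 1 -> p (L s) = closing f s.
  move=> /andP[s0 s1]; rewrite /L /closing /based_loop.
  have t0 : tether (p (f 0)) 1 = (p \o f) 0 by rewrite tether1.
  have t1 : path_cat (tether (p (f 0))) (p \o f) 1 = path_rev (tether (p (f 1))) 0.
    by rewrite path_cat1 // path_rev0 tether1.
  rewrite (path_catE _ e1) (path_catE _ t1) (path_catE _ e0) (path_catE _ t0) !path_revE.
  case: (leP s 2^-1) => sa; last by rewrite cotetherP //; apply/andP; split; lra.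
  by case: (leP (2 * s) 2^-1) => sb //; rewrite cotetherP //; apply/andP; split; lra.
have pL0 : p (L 0) = b by rewrite pL ?(closing_loop f).1 // lexx ler01.
have [d [hd dx0]] := cover_deck hp (esym pL0).
have [g dg] := deck_shift_ex hp hphi hd.
have lf : p x0 = closing f 0 by rewrite (closing_loop f).1.
have [l l0 pl] := path_lifting cov lf.
have Ldl s : 0 <= s <= 1 -> L s = (d \o l : rpath R X') s.
  apply: (lift_unique cov); last by rewrite /= l0.
  by move=> u u01 /=; rewrite hd.2 pL // pl.
(* The coefficient used in [cross_value] is the image in G of the deck transformation d. *)
have gE : displacement (f 0) = g.
  rewrite displacement_cotether -/k0.
  have -> : k0 0 = d x0 by rewrite dx0 /L !path_cat0.
  by rewrite (displacement_deck _ hd dg) displacement_base add0r.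
have h1 : bd (path_chain RG L - Psi (cross_value f)).
  rewrite (path_chain_eq RG Ldl) /cross_value gE PsiZ.
  apply: (submod_trans sbd) (twisted_bound_deck [set b] l hp hphi hd dg) _.
  rewrite -scalerBr; apply: (submodZ sbd); exact: Psi_lift (closing_loop f) l0 pl.
have h2 := twisted_bound_boundaries p phi [set b] (boundaries_cat RG e1).
have h3 := twisted_bound_boundaries p phi [set b] (boundaries_cat RG e0).
have h4 := twisted_bound_boundaries p phi [set b] (boundaries_rev RG k1).
rewrite -/L in h2.
have := submodB sbd (submodD sbd (submodD sbd h3 h2) h1) h4.
set u := path_chain RG k0; set v := path_chain RG f; set w := path_chain RG (path_cat _ _).
set r := path_chain RG (path_rev _); set z := path_chain RG k1; set y := Psi _;
  set x := path_chain RG L.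
suff -> : u + v - w + (w + r - x) + (x - y) - (z + r) = v - (y + (z - u)) by [].
rewrite !addrA !subrK [z + r]addrC opprB [- (r + z)]opprD addrA [_ - y - r]addrAC addrK.
by rewrite [- (y + z)]opprD !addrA [v + u]addrC.
Qed.

Definition simplex_pt (s : simplex R 0 X') : X' := projT1 (cid (simplex0_eq s)).
Lemma simplex_ptE s : s = (cst (simplex_pt s) : simplex R 0 X').
Proof. exact: projT2 (cid (simplex0_eq s)). Qed.

Lemma simplex0_cst_inj (x y : X') : (cst x : simplex R 0 X') = (cst y : simplex R 0 X') -> x = y.
Proof.
have hv : \row_(j < 1) (1 : R) \in @stdsimplex R 0.
  by apply/mem_set; split=> [i|]; rewrite ?big_ord1 mxE.
by move=> /continuousEP /(_ (simplex_point hv)).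
Qed.

Lemma simplex_pt_cst x : simplex_pt (cst x : simplex R 0 X') = x.
Proof. by apply: simplex0_cst_inj; rewrite -simplex_ptE. Qed.

Lemma simplex_pt_comp (d : continuousType X' X') (s : simplex R 0 X') :
  simplex_pt (d \o s : simplex R 0 X') = d (simplex_pt s).
Proof.
apply: simplex0_cst_inj; rewrite -simplex_ptE {1}(simplex_ptE s).
exact/continuousEP.
Qed.

(** The chain homotopy operator in degree 0. *)
Definition cone (c : chains R 0 X' RG) : chains R 1 X' RG :=
  fglift (fun s => path_chain RG (cotether (simplex_pt s))) c.

Lemma cotether_deck d x : is_deck p d ->
  path_chain RG (cotether (d x)) = path_chain RG (d \o cotether x : rpath R X').
Proof.
move=> hd; apply: path_chain_eq => s s01.
have e : path_rev (cotether (d x)) 0 = path_rev (d \o cotether x : rpath R X') 0.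
  by rewrite !path_rev0 /= !cotether1.
have inv (u : R) : 0 <= u <= 1 -> 0 <= 1 - u <= 1 by move=> /andP[? ?]; apply/andP; split; lra.
have := lift_unique cov _ e (inv s s01); rewrite !path_revE subKr; apply.
by move=> u u01; rewrite !path_revE /= hd.2 !cotetherP ?hd.2 //; exact: inv.
Qed.

Lemma cone_zero c : tz 0 c -> bd (cone c).
Proof.
have sC : is_submodule [set c | bd (cone c)].
  split; rewrite /= /cone.
  - by rewrite fglift0; exact: submod0.
  - by move=> x y; rewrite fgliftD; exact: submodD.
  - by move=> a x; rewrite fgliftZ; exact: submodZ.
apply: (lin_span_sub sC) => _ [[d [f [s [hd fd ->]]]]|[s [Ys ->]]] /=; rewrite /cone.
  rewrite fgliftB fgliftZ !fgliftU simplex_pt_comp cotether_deck //.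
  exact: twisted_bound_deck hp hphi hd (deck_shift_path hp hphi hd fd).
rewrite fgliftU; apply: twisted_bound_zero; apply: twisted_zero_over => v /=.
rewrite cotetherP ?edge_coord_itv //.
have -> : p (simplex_pt s) = b.
  have hv : \row_(j < 1) (1 : R) \in @stdsimplex R 0.
    by apply/mem_set; split=> [i|]; rewrite ?big_ord1 mxE.
  by have := Ys (simplex_point hv); rewrite {1}(simplex_ptE s).
by rewrite tether_base.
Qed.

(** [cone] is a homotopy between the identity and Psi after [cross_chain]; by linearity it suffices
    to treat one path. *)
Lemma chain_decomposition c : bd (c - (Psi (cross_chain c) + cone (boundary c))).
Proof.
have Psi0 : Psi 0 = 0 by rewrite -(scale0r (0 : V)) PsiZ scale0r.
have sS : is_submodule [set c | bd (c - (Psi (cross_chain c) + cone (boundary c)))].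
  split; rewrite /= /cross_chain /boundary /cone.
  - by rewrite !fglift0 Psi0 addr0 subr0; exact: submod0.
  - move=> x y hx hy; rewrite !fgliftD PsiD [X in _ - X]addrACA opprD addrACA.
    exact: submodD.
  - move=> a x hx; rewrite !fgliftZ PsiZ -scalerDr -scalerBr; exact: submodZ.
apply: (freeg_spanned sS) => s /=.
have := path_decomposition (simplex_path s).
have -> : path_chain RG (simplex_path s) = << s >> by rewrite /path_chain -simplex_pathE.
rewrite /cross_chain fgliftU.
have -> : boundary (<< s >> : chains R 1 X' RG) = point_chain R RG (simplex_path s 1) -
  point_chain R RG (simplex_path s 0).
  by rewrite -boundary_path /path_chain -simplex_pathE.
by rewrite /cone fgliftB !fgliftU !simplex_pt_cst.
Qed.

Lemma twisted_cycle_lift (f : rpath R X') : p (f 0) = b -> p (f 1) = b -> cyc (path_chain RG f).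
Proof.
move=> f0 f1; rewrite /twisted_cycle /= boundary_path.
by apply: (submodB (twisted_zero_submodule _ _ _ _)); apply: twisted_zero_over => v /=.
Qed.

Lemma twisted_generation z : cyc z -> bd (z - Psi (cross_chain z)).
Proof.
move=> cz; have h := chain_decomposition z.
by have := submodD sbd h (cone_zero cz); rewrite opprD addrA subrK.
Qed.

End TwistedPresentation.

(** [cross_chain] and [lincomb c] are mutually inverse between cycles modulo boundaries and the
    cokernel of r: one composite gives generation, the other that every relation among the c i lies
    in the row span. *)
Lemma crossed_presentation (R : realType) (X' X : topologicalType) (p : continuousType X' X)
    (G : zmodType) (phi : chains R 1 X int -> G) (x0 : X') (k q : nat)
    (D : rpath R X -> 'rV[group_ring G]_k) (r : 'M[group_ring G]_(q, k))
    (l : 'I_k -> rpath R X) (l' : 'I_k -> rpath R X') :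
  is_max_abelian_cover R p -> is_H1_hom phi ->
  let b := p x0 in let N := rowspan r in
  let c i := path_chain (group_ring G) (l' i) in
  let bd := @twisted_bound R X' X p G phi [set b] 0 in
  (forall f g, is_loop b f -> is_loop b g -> path_homotopic f g -> N (D f - D g)) ->
  (forall f g, is_loop b f -> is_loop b g ->
    N (D (path_cat f g) - (D f + group_elt (phi (path_chain int f)) *: D g))) ->
  (forall i, [/\ is_loop b (l i), l' i 0 = x0, forall s, 0 <= s <= 1 -> p (l' i s) = l i s
     & N (D (l i) - delta_mx 0 i)]) ->
  (forall (f : rpath R X) (f' : rpath R X'), is_loop b f -> f' 0 = x0 ->
    (forall s, 0 <= s <= 1 -> p (f' s) = f s) ->
    bd (path_chain (group_ring G) f' - lincomb c (D f))) ->
  (forall i, bd (lincomb c (row i r))) ->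
  presents (@twisted_cycle R X' X p G phi [set b] 0) bd c r.
Proof.
move=> hp hphi b N c bd Dh Dc hl Psi_lift relr.
have sN := rowspan_submodule r; have sbd := twisted_bound_submodule p phi [set b].
have PsiN v : N v -> bd (lincomb c v).
  move=> [w ->]; rewrite lincomb_mulmx; apply: (submod_sum sbd) => i.
  by apply: (submodZ sbd); exact: relr.
have PsiZ a v : lincomb c (a *: v) = a *: lincomb c v by exact: lincombZ.
have PsiD v w : lincomb c (v + w) = lincomb c v + lincomb c w by exact: lincombD.
split.
- move=> i; have [li l0 pl _] := hl i; apply: twisted_cycle_lift; first by rewrite l0.
  by rewrite pl ?lexx ?ler01 // li.2.
- move=> z cz; exists (cross_chain hp phi x0 D z).
  exact: (twisted_generation hp hphi PsiZ PsiD Psi_lift cz).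
move=> v; rewrite -/(lincomb c v) -/(N v); split=> [bv|]; last exact: PsiN.
have := cross_chain_bound hp hphi sN Dh Dc bv.
have -> : cross_chain hp phi x0 D (lincomb c v) = lincomb (fun i => cross_chain hp phi x0 D (c
  i)) v.
  rewrite /cross_chain /lincomb fglift_sum; apply: eq_bigr => i _; exact: fgliftZ.
have E : N (lincomb (fun i => cross_chain hp phi x0 D (c i)) v - lincomb (fun i => delta_mx 0 i)
  v).
  apply: (lincomb_congr sN) => i; have [li l0 pl Dl] := hl i.
  have h1 := cross_chain_path hp phi sN Dh (l' i).
  have h2 := cross_value_lift hp hphi Dh li l0 pl.
  have h3 := submod_trans sN h2 Dl; exact: (submod_trans sN h1 h3).
move=> /(submodB sN E); rewrite addrAC subrr sub0r => /(submodN sN); rewrite opprK.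
by rewrite /lincomb -row_sum_delta.
Qed.

(** * The presentation given by the diagram *)

Section WordLifts.
Variables (R : realType) (X' X : topologicalType) (p : continuousType X' X).
Hypothesis hp : is_max_abelian_cover R p.
Variables (G : zmodType) (phi : chains R 1 X int -> G).
Hypothesis hphi : is_H1_hom phi.
Variables (x0 : X').
Local Notation b := (p x0).
Local Notation RG := (group_ring G).
Local Notation bd := (@twisted_bound R X' X p G phi [set b] 0).
Let cov : is_covering p. Proof. by case: hp. Qed.
Let sbd : is_submodule bd. Proof. exact: twisted_bound_submodule. Qed.

Definition lift_at (f : rpath R X) (f' : rpath R X') : Prop :=
  f' 0 = x0 /\ forall s, 0 <= s <= 1 -> p (f' s) = f s.

Lemma lift_at_ex f : is_loop b f -> exists f', lift_at f f'.
Proof. by move=> [f0 _]; have [f' h0 h1] := path_lifting cov (esym f0); exists f'. Qed.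

Lemma lift_at_homotopic f g f' g' : lift_at f f' -> lift_at g g' -> path_homotopic f g ->
  bd (path_chain RG f' - path_chain RG g').
Proof.
move=> [f0 pf] [g0 pg] fg; apply: twisted_bound_boundaries; apply: boundaries_homotopic.
by apply: (homotopic_lift cov pf pg) fg; rewrite f0.
Qed.

(** After f' the lift continues along a deck translate of g', and the translation has image phi(f)
    in G. *)
Lemma lift_at_cat f g f' g' h' : is_loop b f -> is_loop b g ->
  lift_at f f' -> lift_at g g' -> lift_at (path_cat f g) h' ->
  bd (path_chain RG h' - (path_chain RG f' + group_elt (phi (path_chain int f)) *:
    path_chain RG g')).
Proof.
move=> lf lg [f0 pf] [g0 pg] [h0 ph].
have i01 : 0 <= (1 : R) <= 1 by rewrite ler01 lexx.
have fg : f 1 = g 0 by rewrite lf.2 lg.1.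
have [d [hd dx0]] : exists d, is_deck p d /\ d x0 = f' 1.
  by apply: (cover_deck hp); rewrite pf // lf.2.
have e : f' 1 = (d \o g' : rpath R X') 0 by rewrite /= g0 dx0.
have hcat s : 0 <= s <= 1 -> h' s = path_cat f' (d \o g' : rpath R X') s.
  apply: (lift_unique cov); last by rewrite path_cat0 h0 f0.
  move=> u u01; rewrite ph // !path_catE //; move: u01 => /andP[u0 u1].
  case: (leP u 2^-1) => uh; first by rewrite pf //; apply/andP; split; lra.
  by rewrite /= hd.2 pg //; apply/andP; split; lra.
have dg : deck_shift p phi d (phi (path_chain int f)).
  rewrite -(path_chain_eq int (f := p \o f')) //.
  by apply: (deck_shift_path hp hphi hd); rewrite f0 dx0.
have h1 := twisted_bound_boundaries p phi [set b] (boundaries_cat RG e).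
have h2 := twisted_bound_deck [set b] g' hp hphi hd dg.
rewrite (path_chain_eq RG hcat); apply: (submod_trans sbd) (submod_sym sbd h1) _.
by apply: (submod_congr sbd); first by rewrite subrr; exact: (submod0 sbd).
Qed.

Variables (n m mu : nat) (dg : diagram R n m) (psi : component n m -> 'I_mu) (t : 'I_mu -> G).
Variable iota : rpath R X -> word dg.
Hypothesis hiota : is_group_iso b iota.
Hypothesis hcomm : forall f, is_loop b f -> phi (path_chain int f) = word_color psi t (iota f).
Local Notation "u ~~ v" := (wirtinger u v) (at level 70).

Lemma wirtinger_color (u v : word dg) : u ~~ v -> word_color psi t u = word_color psi t v.
Proof.
(* With values in the zero module, Fox calculus retains only the statement about colors. *)
have sT : is_submodule [set: 'rV[RG]_0] by [].
by move=> /(@wirtinger_fox _ _ _ _ _ _ psi t _ (fun=> 0 : 'rV[RG]_0) _ sT (fun=> I))[].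
Qed.

Lemma iota_cat f g : is_loop b f -> is_loop b g -> iota (path_cat f g) ~~ iota f ++ iota g.
Proof.
move=> lf lg; have [h _ _] := hiota; apply: h => //; first exact: is_loop_cat.
by apply: path_catP; rewrite lf.2 lg.1.
Qed.

Lemma iota_homotopic f g : is_loop b f -> is_loop b g -> iota f ~~ iota g <-> path_homotopic f g.
Proof. by move=> lf lg; have [_ h _] := hiota; exact: h. Qed.

Lemma word_loop_ex (w : word dg) : exists f, is_loop b f /\ iota f ~~ w.
Proof. by have [_ _ h] := hiota; have [f lf fw] := h w; exists f. Qed.

Definition arc_loop (a : tarc dg nosub) : rpath R X := projT1 (cid (word_loop_ex [:: (a,
  false)])).
Lemma arc_loopP a : is_loop b (arc_loop a) /\ iota (arc_loop a) ~~ [:: (a, false)].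
Proof. exact: projT2 (cid (word_loop_ex [:: (a, false)])). Qed.

Definition arc_lift (a : tarc dg nosub) : rpath R X' := projT1 (cid (lift_at_ex (arc_loopP a).1)).
Lemma arc_liftP a : lift_at (arc_loop a) (arc_lift a).
Proof. exact: projT2 (cid (lift_at_ex (arc_loopP a).1)). Qed.

Definition arc_chain (a : tarc dg nosub) : chains R 1 X' RG := path_chain RG (arc_lift a).

Lemma word_lift_congr (w : word dg) (c : chains R 1 X' RG) f f' g g' :
  is_loop b f -> is_loop b g -> lift_at f f' -> lift_at g g' -> iota f ~~ w -> iota g ~~ w ->
  bd (path_chain RG f' - c) -> bd (path_chain RG g' - c).
Proof.
move=> lf lg hf hg fw gw; apply: (submod_trans sbd); apply: (lift_at_homotopic hg hf).
by apply/iota_homotopic => //; apply: wirt_trans gw (wirt_sym fw).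
Qed.

(** By induction on w with the crossed product rule. A loop with trivial word is homotopic to its
    square, so its class c satisfies c + c = c and vanishes; an inverse letter is treated by
    composing with the loop of the arc to get a trivial word. *)
Lemma word_lift (w : word dg) f f' : is_loop b f -> lift_at f f' -> iota f ~~ w ->
  bd (path_chain RG f' - fox psi t arc_chain w).
Proof.
have nil f1 f1' : is_loop b f1 -> lift_at f1 f1' -> iota f1 ~~ [::] -> bd (path_chain RG f1').
  move=> lf hf fw; have lff := is_loop_cat lf lf; have [g' hg] := lift_at_ex lff.
  have fff : path_homotopic (path_cat f1 f1) f1.
    apply/iota_homotopic => //; apply: wirt_trans (iota_cat lf lf) _.
    exact: wirt_cat fw (wirt_refl _).
  have h1 := lift_at_cat lf lf hf hf hg; have h2 := lift_at_homotopic hg hf fff.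
  have := submodB sbd h2 h1.
  rewrite hcomm // (wirtinger_color fw) /word_color big_nil group_elt0 scale1r.
  by rewrite opprB addrC addrA subrK addrK.
have cat u v f1 f1' f2 f2' h h' : is_loop b f1 -> lift_at f1 f1' -> iota f1 ~~ u ->
    bd (path_chain RG f1' - fox psi t arc_chain u) ->
    is_loop b f2 -> lift_at f2 f2' -> iota f2 ~~ v ->
    bd (path_chain RG f2' - fox psi t arc_chain v) ->
    is_loop b h -> lift_at h h' -> iota h ~~ u ++ v ->
      bd (path_chain RG h' - fox psi t arc_chain (u ++ v)).
  move=> l1 h1 w1 b1 l2 h2 w2 b2 lh hh wh.
  have l12 := is_loop_cat l1 l2; have [g' hg] := lift_at_ex l12.
  have w12 : iota (path_cat f1 f2) ~~ u ++ v.
    by apply: wirt_trans (iota_cat l1 l2) _; exact: wirt_cat.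
  apply: (word_lift_congr l12 lh hg hh w12 wh).
  apply: (submod_trans sbd) (lift_at_cat l1 l2 h1 h2 hg) _.
  rewrite fox_cat hcomm // (wirtinger_color w1); apply: (submod_congr sbd) b1 _.
  by rewrite -scalerBr; exact: (submodZ sbd).
have pos a f1 f1' : is_loop b f1 -> lift_at f1 f1' -> iota f1 ~~ [:: (a, false)] ->
    bd (path_chain RG f1' - fox psi t arc_chain [:: (a, false)]).
  move=> l1 h1 w1; rewrite fox_letter1.
  apply: (word_lift_congr (arc_loopP a).1 l1 (arc_liftP a) h1 (arc_loopP a).2 w1).
  by rewrite subrr; exact: (submod0 sbd).
have neg a f1 f1' : is_loop b f1 -> lift_at f1 f1' -> iota f1 ~~ [:: (a, true)] ->
    bd (path_chain RG f1' - fox psi t arc_chain [:: (a, true)]).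
  move=> l1 h1 w1; have [la wa] := arc_loopP a; have lc := is_loop_cat la l1.
  have [g' hg] := lift_at_ex lc.
  have wg : iota (path_cat (arc_loop a) f1) ~~ [::].
    apply: wirt_trans (iota_cat la l1) _; apply: wirt_trans (wirt_cat wa w1) _.
    exact: (wirt_cancel a false).
  have := submodB sbd (nil _ _ lc hg wg) (lift_at_cat la l1 (arc_liftP a) h1 hg).
  rewrite opprB addrC subrK -/(arc_chain a) hcomm // (wirtinger_color wa).
  rewrite word_color_cons /letter_color /word_color big_nil addr0 /=.
  move/(submodZ sbd (group_elt (- t (psi (tag a))))).
  by rewrite scalerDr scalerA group_eltN scale1r /= scaler0 addr0 /fox_letter /= opprK addrC.
elim: w f f' => [|[a s] w IH] f f' lf hf fw; first by rewrite subr0; exact: nil fw.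
have [f1 [l1 w1]] := word_loop_ex [:: (a, s)]; have [f2 [l2 w2]] := word_loop_ex w.
have [f1' h1] := lift_at_ex l1; have [f2' h2] := lift_at_ex l2.
apply: (cat [:: (a, s)] w _ _ _ _ _ _ l1 h1 w1 _ l2 h2 w2 (IH _ _ l2 h2 w2) lf hf fw).
by case: s {fw} w1 => w1; [exact: (neg _ _ _ l1 h1)|exact: (pos _ _ _ l1 h1)].
Qed.

(** A single loop represents both words, and its lift has only one class. *)
Lemma arc_chain_wirtinger (u v : word dg) : u ~~ v ->
  bd (fox psi t arc_chain u - fox psi t arc_chain v).
Proof.
move=> uv; have [f [lf fu]] := word_loop_ex u; have [f' hf] := lift_at_ex lf.
have hu := word_lift lf hf fu; have hv := word_lift lf hf (wirt_trans fu uv).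
exact: (submod_trans sbd) (submod_sym sbd hu) hv.
Qed.

End WordLifts.

Section AlphaPresentation.
Variables (R : realType) (X' X : topologicalType) (p : continuousType X' X).
Hypothesis hp : is_max_abelian_cover R p.
Variables (G : zmodType) (phi : chains R 1 X int -> G).
Hypothesis hphi : is_H1_hom phi.
Variables (x0 : X').
Local Notation b := (p x0).
Local Notation RG := (group_ring G).
Local Notation bd := (@twisted_bound R X' X p G phi [set b] 0).
Local Notation cyc := (@twisted_cycle R X' X p G phi [set b] 0).
Let sbd : is_submodule bd. Proof. exact: twisted_bound_submodule. Qed.
Variables (n m mu : nat) (tau : diagram R n m) (psi : component n m -> 'I_mu) (t : 'I_mu -> G).
Variable iota : rpath R X -> word tau.
Hypotheses (htau : is_welded_tangle tau) (hiota : is_group_iso b iota).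
Hypothesis hcomm : forall f, is_loop b f -> phi (path_chain int f) = word_color psi t (iota f).
Variables (sub : component n m -> seq R) (q : nat).
Variables (rows : 'I_(q + n) -> alpha_row tau sub) (inner : 'I_q -> tarc tau sub).
Hypothesis hadm : alpha_admissible rows inner.
Local Notation M := (alpha_matrix psi t rows inner).
Local Notation C := (arc_chain hp G hiota).

Definition alpha_chain (k : 'I_(q + (n + n))) : chains R 1 X' RG :=
  C (forget_arc (alpha_arc inner k)).

Lemma lincomb_fox (V W : lmodType RG) (F : V -> W) (e : tarc tau nosub -> V) (w : word tau) :
  (forall a v, F (a *: v) = a *: F v) -> (forall u v, F (u + v) = F u + F v) ->
  F (fox psi t e w) = fox psi t (F \o e) w.
Proof.
move=> FZ FD; elim: w => [|[a s] w IH] /=; first by rewrite -(scale0r 0) FZ scale0r.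
by rewrite FD FZ IH; case: s; rewrite /fox_letter //= -!scaleN1r !FZ.
Qed.

(** At a crossing the row is, up to sign, the Fox derivative of a Wirtinger relation; at a
    subdivision point the two arcs carry the same chain. *)
Lemma alpha_chain_row r : bd (lincomb alpha_chain (row r M)).
Proof.
have [idx arcK idxK] := alpha_arc_bij htau hadm; have [hsub _ _ _ _] := hadm.
have lb x : lincomb alpha_chain (arc_basis G idx x) = C (forget_arc x).
  by rewrite /arc_basis lincomb_delta /alpha_chain idxK.
rewrite (row_alpha_matrix _ _ _ idxK arcK); case: (rows r) => [k|[c s]] /=; last first.
  rewrite lincombB !lb (forget_arc_subdivision hsub) ?subrr; first exact: (submod0 sbd).
  exact: mem_nth.
have sgn u v w : bd (u - (v + w)) -> bd (- u + v + w).
  by move/(submodN sbd); rewrite opprB addrC addrA.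
rewrite !(lincombD, lincombN, lincombZ) !lb; apply: sgn.
case: ifP => [pk|/negbT nk]; rewrite !(forget_arc_in hsub, forget_arc_out hsub).
  have := arc_chain_wirtinger hp hphi hiota hcomm (wirt_positive pk).
  by rewrite fox_letter1 fox_conj.
have := arc_chain_wirtinger hp hphi hiota hcomm (wirt_negative nk).
by rewrite fox_letter1 fox_conj.
Qed.

Lemma alpha_presents : presents cyc bd alpha_chain M.
Proof.
have [idx arcK idxK] := alpha_arc_bij htau hadm; have [hsub _ _ _ _] := hadm.
have /boolp.choice[lift_arc liftK] := forget_arc_surj hsub.
(* The crossed homomorphism is the Fox derivative of the word of a loop, with values in the free
   module on the columns of M. *)
pose D f := fox psi t (arc_basis G idx \o lift_arc) (iota f).
have sM := rowspan_submodule M.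
have DE f : lincomb alpha_chain (D f) = fox psi t C (iota f).
  rewrite /D (lincomb_fox _ _ (lincombZ alpha_chain) (lincombD alpha_chain)).
  congr (fox _ _ _ _); apply/funext => a /=.
  by rewrite /arc_basis lincomb_delta /alpha_chain idxK liftK.
have Dw u v := arc_basis_fox psi t htau hadm idxK arcK liftK (u := u) (v := v).
apply: (crossed_presentation (x0 := x0) (D := D) (l :=
  fun k => arc_loop hiota (forget_arc (alpha_arc inner k)))
  (l' := fun k => arc_lift hp hiota (forget_arc (alpha_arc inner k))) hp hphi).
- by move=> f g lf lg fg; apply: (Dw _ _ _).2; apply/(iota_homotopic hiota).
- move=> f g lf lg; rewrite /D hcomm // -fox_cat; apply: (Dw _ _ _).2.
  exact: (iota_cat hiota).
- move=> k; have [l0 pl] := arc_liftP hp hiota (forget_arc (alpha_arc inner k)).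
  have [la wa] := arc_loopP hiota (forget_arc (alpha_arc inner k)); split=> //.
  apply: (submod_trans sM) (Dw _ _ wa).2 _; rewrite fox_letter1 /=.
  apply: (submod_sym sM); have := arc_basis_forget psi t htau hadm idxK arcK liftK (alpha_arc
    inner k).
  by rewrite {1}/arc_basis arcK.
- move=> f f' lf f0 pf; rewrite DE.
  exact: (word_lift hp hphi hiota hcomm lf (conj f0 pf) (wirt_refl _)).
exact: alpha_chain_row.
Qed.
End AlphaPresentation.

(** * Naturality of twisted chains under the lifted inclusion *)

Section PushChain.
Variables (R : realType) (X' X Y' Y : topologicalType).
Variables (pX : continuousType X' X) (pY : continuousType Y' Y).
Hypotheses (hpX : is_max_abelian_cover R pX) (hpY : is_max_abelian_cover R pY).
Variables (j : continuousType Y X) (jhat : continuousType Y' X').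
Hypothesis hjhat : forall y, pX (jhat y) = j (pY y).
Variables (G : zmodType) (phi : chains R 1 X int -> G).
Variable y0 : Y.
Local Notation RG := (group_ring G).
Local Notation tzX k := (@twisted_zero R X' X pX G phi [set j y0] k).
Local Notation tzY k := (@twisted_zero R Y' Y pY G (phi_bd j phi) [set y0] k).

Lemma push_chain_submodule k (B : set (chains R k X' RG)) : is_submodule B ->
  is_submodule [set c : chains R k Y' RG | B (push_chain jhat c)].
Proof.
move=> sB; split; rewrite /= /push_chain.
- by rewrite fglift0; exact: submod0.
- by move=> x y; rewrite fgliftD; exact: submodD.
- by move=> a x; rewrite fgliftZ; exact: submodZ.
Qed.

Lemma push_chainB k (c c' : chains R k Y' RG) :
  push_chain jhat (c - c') = push_chain jhat c - push_chain jhat c'.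
Proof. exact: fgliftB. Qed.

Lemma push_chain_path (A : comNzRingType) (T S : topologicalType) (h : continuousType T S) (f :
  rpath R T) :
  push_chain h (path_chain A f) = path_chain A (h \o f : rpath R S).
Proof.
rewrite /push_chain /path_chain fgliftU; congr [freeg [:: (_, _)]].
exact/continuousEP.
Qed.

Lemma push_chain_lincomb k l (c : 'I_l -> chains R k Y' RG) v :
  push_chain jhat (lincomb c v) = lincomb (fun i => push_chain jhat (c i)) v.
Proof. by rewrite /push_chain fglift_sum; apply: eq_bigr => i _; exact: fgliftZ. Qed.

Lemma push_chain_boundary k (e : chains R k.+1 Y' RG) :
  push_chain jhat (boundary e) = boundary (push_chain jhat e).
Proof.
have sS : is_submodule [set e : chains R k.+1 Y' RG |
    push_chain jhat (boundary e) = boundary (push_chain jhat e)].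
  split; rewrite /= /push_chain /boundary.
  - by rewrite !fglift0.
  - by move=> x y hx hy; rewrite !fgliftD hx hy.
  - by move=> a x hx; rewrite !fgliftZ hx.
apply: (freeg_spanned sS) => s /=.
rewrite /push_chain /boundary !fgliftU fglift_sum; apply: eq_bigr => i _.
rewrite liftU -freegU_scaleE; congr [freeg [:: (_, _)]].
exact/continuousEP.
Qed.

(** d' is chosen to be correct at one point; along any path from it, both sides lift the same path,
    so uniqueness of lifts gives the equality everywhere. *)
Lemma deck_push d : is_deck pY d -> forall y1 : Y', exists2 d', is_deck pX d' & forall y,
  d' (jhat y) = jhat (d y).
Proof.
move=> hd y1; have [d' [hd' dy]] : exists d', is_deck pX d' /\ d' (jhat y1) = jhat (d y1).
  by apply: (cover_deck hpX); rewrite !hjhat hd.2.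
exists d' => // y; have [f [f0 f1]] := cover_path hpY y1 y.
have covX : is_covering pX by case: hpX.
rewrite -f1.
apply: (lift_unique covX (g := d' \o (jhat \o f : rpath R X')) (h := jhat \o (d \o f :
  rpath R Y'))).
- by move=> s _ /=; rewrite hd'.2 !hjhat hd.2.
- by rewrite /= f0.
by rewrite ler01 lexx.
Qed.

Lemma push_chain_zero k (c : chains R k Y' RG) : tzY k c -> tzX k (push_chain jhat c).
Proof.
have sX := twisted_zero_submodule pX phi [set j y0] k.
apply: (lin_span_sub (push_chain_submodule sX)) => _ [[d [f [s [hd fd ->]]]]|[s [Ys ->]]] /=.
  have [d' hd' dE] := deck_push hd (f 0).
  have fd' : (jhat \o f : rpath R X') 1 = d' ((jhat \o f : rpath R X') 0) by rewrite /= dE fd.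
  have := twisted_zero_deck phi [set j y0] (jhat \o s : simplex R k X') hd' fd'.
  rewrite push_chainB /push_chain fgliftZ !fgliftU.
  have -> : path_chain int (pX \o (jhat \o f : rpath R X') : rpath R X) =
            push_chain j (path_chain int (pY \o f : rpath R Y)).
    by rewrite push_chain_path; apply: path_chain_eq => u _; exact: hjhat.
  by congr (tzX k ([freeg [:: (_, _)]] - _)); apply/continuousEP => v /=; rewrite dE.
rewrite /push_chain fgliftU; apply: twisted_zero_over => v /=.
by rewrite hjhat Ys.
Qed.

Lemma push_chain_bound c : bdY pY j phi y0 c -> bdX pX j phi y0 (push_chain jhat c).
Proof.
move=> [e /push_chain_zero]; rewrite push_chainB push_chain_boundary => h.
by exists (push_chain jhat e).
Qed.
End PushChain.

Theorem theorem4p6 (R : realType) (mu n m : nat) (hmu : (0 < mu)%N)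
    (G : zmodType) (hG : free_abelian_of_rank mu G)
    (* the colored welded tangle (tau, psi) *)
    (tau : diagram R n m) (htau : is_welded_tangle tau) (psi : component n m -> 'I_mu)
    (* the colored ribbon tangle (T, phi), image of tau by the Tube map *)
    (T : tangle4 R n m) (hT : is_ribbon_tangle T)
    (phi : chains R 1 (exterior T) int -> G) (hphi : is_H1_hom phi)
    (D : tube_data R n m) (hD : is_tube tau D T)
    (* the base point, and the inclusion of S^3 \ L in X_T *)
    (y0 : link_exterior T) (j : continuousType (link_exterior T) (exterior T))
    (hj : forall y, set_val (j y) = set_val y)
    (* the isomorphism pi_1(X_T) -> pi(tau), taking meridians to arcs *)
    (iota : rpath R (exterior T) -> word tau) (hiota : is_group_iso (j y0) iota)
    (harcs : forall a : tarc tau nosub, exists s f,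
       [/\ tdom (tag a) s, s \notin breaks tau nosub (tag a),
           arc_in tau nosub (tag a, s) = a,
           is_meridian D (j y0) (tag a) s f & wirtinger (iota f) [:: (a, false)]])
    (* the meridians of L corresponding to the marked points *)
    (x : 'I_(n + n) -> rpath R (link_exterior T))
    (hx : forall i,
       is_meridian D y0 (inl (ends tau i).1) (nat_of_bool (ends tau i).2)%:R (x i) /\
       wirtinger (iota (j \o x i : rpath R (exterior T)))
         [:: (mark_arc tau nosub i, false)])
    (* the commutative diagram *)
    (t : 'I_mu -> G) (ht : generates t)
    (hcomm : forall f, is_loop (j y0) f ->
       phi (path_chain int f) = word_color psi t (iota f))
    (* maximal abelian covers of X_T and S^3 \ L, and lifts of j and of the x i *)
    (X' Y' : topologicalType)
    (pX : continuousType X' (exterior T)) (hpX : is_max_abelian_cover R pX)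
    (pY : continuousType Y' (link_exterior T)) (hpY : is_max_abelian_cover R pY)
    (jhat : continuousType Y' X') (hjhat : forall y, pX (jhat y) = j (pY y))
    (y0hat : Y') (hy0hat : pY y0hat = y0)
    (xhat : 'I_(n + n) -> rpath R Y')
    (hxhat : forall i, xhat i 0 = y0hat /\
       forall s, 0 <= s <= 1 -> pY (xhat i s) = x i s)
    (* H_bd is free on the meridians *)
    (hbasis : free_on (cycY pY j phi y0) (bdY pY j phi y0) (xclass G xhat))
    (* subdivision of the arcs, and orders of the rows and columns of M *)
    (sub : component n m -> seq R) (p : nat)
    (rows : 'I_(p + n) -> alpha_row tau sub) (inner : 'I_p -> tarc tau sub)
    (halpha : alpha_admissible rows inner) :
  forall a : ext (group_ring G) (n + n),
    represents_A pX pY j jhat phi y0 xhat a <->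
    exists2 u, is_unit_elt u & a = ext_scale u (alpha psi t rows inner).
Proof.
move=> a.
have E0 : j y0 = pX (jhat y0hat) by rewrite hjhat hy0hat.
rewrite E0 in hiota; have hc f : is_loop (pX (jhat y0hat)) f ->
    phi (path_chain int f) = word_color psi t (iota f) by rewrite -E0; exact: hcomm.
pose Z := cycX pX j phi y0; pose B := bdX pX j phi y0.
have sZ : is_submodule Z by exact: twisted_cycle_submodule.
have sB : is_submodule B by exact: twisted_bound_submodule.
pose C := alpha_chain hpX G hiota inner.
pose M := alpha_matrix psi t rows inner.
have pC : presents Z B C M.
  by rewrite /Z /B /cycX /bdX E0; exact: (alpha_presents hpX hphi htau hiota hc halpha).
have intG := free_abelian_group_ring_integral hG.
(* The word of the meridian $x_i$ is its marked arc, so its lift has the class of the generator of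
   the corresponding boundary column. *)
have hxc i : B (push_chain jhat (xclass G xhat i) - C (rshift p i)).
  have [mx wx] := hx i; have [x0h xh] := hxhat i.
  have lx : is_loop (pX (jhat y0hat)) (j \o x i : rpath R (exterior T)).
    by rewrite -E0; case: mx => q [e [tail [g [_ _ _ [_ [[<- x1] _]] _]]]]; split=> //=;
      rewrite x1.
  have hl : lift_at pX (jhat y0hat) (j \o x i) (jhat \o xhat i).
    by split=> [|s s01] /=; rewrite ?x0h // hjhat xh.
  have := word_lift hpX hphi hiota hc lx hl wx.
  rewrite fox_letter1 /B /bdX E0 push_chain_path /C /alpha_chain alpha_arc_rshift.
  by have [hsub _ _ _ _] := halpha; rewrite (forget_mark_arc hsub).
(* Hence $m_\partial$ is given by the matrix [0 1] in the generators of the presentation. *)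
have hlin (v : 'rV[group_ring G]_(n + n)) :
    B (push_chain jhat (lincomb (xclass G xhat) v) - lincomb C (row_mx 0 v)).
  rewrite push_chain_lincomb; set w := lincomb _ v.
  have -> : lincomb C (row_mx 0 v) = lincomb (fun i => C (rshift p i)) v.
    rewrite /lincomb big_split_ord /= big1 ?add0r; last by move=> i _;
      rewrite row_mxEl mxE scale0r.
    by apply: eq_bigr => i _; rewrite row_mxEr.
  exact: lincomb_congr.
have sY : is_submodule (bdY pY j phi y0) by exact: twisted_bound_submodule.
have lrow (W : lmodType (group_ring G)) k (g : 'I_k -> W) (w : 'M[group_ring G]_(n, k)) i :
    \sum_l w i l *: g l = lincomb g (row i w).
  by apply: eq_bigr => l _; rewrite mxE.
apply: (iff_trans _ (alexander_element sZ sB intG pC a)).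
(* [represents_A] tests arbitrary cycles z i with coordinates v, [alexander_element] only the
   combinations of the generators with these coefficients. The two agree because boundaries are
   pushed to boundaries. *)
split=> -[ha [q [gens [r [nu [pr nu1 hA]]]]]]; split=> //; exists q, gens, r, nu; split=> //.
  move=> v ut h; apply: (hA (fun i => lincomb (xclass G xhat) (row i v)) v ut) => i.
  - by apply: (lincomb_submodule _ _ hbasis.1); exact: twisted_cycle_submodule.
  - by rewrite lrow subrr; exact: submod0.
  by rewrite lrow; exact: (submod_trans sB) (hlin _) (h i).
move=> z v ut cz bz bu; apply: hA => i.
have := push_chain_bound hpX hpY hjhat (bz i); have := bu i; rewrite !lrow push_chainB => h1 h2.
apply: (submod_trans sB) (submod_sym sB (hlin (row i v))) _.
exact: (submod_trans sB) (submod_sym sB h2) h1.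
Qed.
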